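(* Let $r\ge1$ and let $J\in\hat{\mathcal{B}}_1^r(\mathbb{R}^2)$ be closed and supported in a bounded open set $U\subset\mathbb{C}\simeq\mathbb{R}^2$ such that $\mathrm{Ind}_J(w)=0$ for all $w\in\mathbb{C}\setminus U$. Suppose there exists $K\in\hat{\mathcal{B}}_2^{r-1}(\mathbb{R}^2)$ with finite mass such that $\partial K=J$. Let $f$ be holomorphic in $U$ except at finitely many points $a_k\in U\setminus\mathrm{supp}(J)$. For each $k$ let $D_k$ be an open neighborhood of $a_k$, such that the closures of the $D_k$ are pairwise disjoint and contained in $U\setminus\mathrm{supp}(J)$, and let $B_k=\partial\widetilde{D_k}$, where $\widetilde{D_k}$ is the $2$-chain canonically associated to $D_k$. Then $$\int_Jf(z)\,dz=\sum_k\mathrm{Ind}_J(a_k)\int_{B_k}f(z)\,dz .$$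
   Context: Differential chains. $\mathcal{P}_k(\mathbb{R}^n)$ is the real vector space of finitely supported sections of $\Lambda^kT\mathbb{R}^n$ (pointed $k$-chains), written as formal sums $A=\sum_i(p_i;\alpha_i)$ with $\alpha_i\in\Lambda^kT_{p_i}\mathbb{R}^n$. The mass of a $k$-vector is $\|\alpha\|=\inf\{\sum|\alpha_i|:\alpha=\sum\alpha_i,\ \alpha_i\text{ simple}\}$, with $|\alpha_i|$ the Euclidean $k$-volume. Put $\Delta_u(p;\alpha)=(p+u;\alpha)-(p;\alpha)$ (extended linearly), and for $U'=\{u_1,\dots,u_j\}$ (repetitions allowed) $\Delta_{U'}^j=\Delta_{u_1}\circ\cdots\circ\Delta_{u_j}$, $\Delta^0=\mathrm{Id}$, and $|\Delta_{U'}^j(p;\alpha)|_j=\|u_1\|\cdots\|u_j\|\,\|\alpha\|$. For an integer $r\ge0$, $$\|A\|_{B^r}=\inf\Big\{\sum_{i=1}^N|\Delta_{U_i}^{j_i}(p_i;\alpha_i)|_{j_i}:A=\sum_{i=1}^N\Delta_{U_i}^{j_i}(p_i;\alpha_i),\ 0\le j_i\le r\Big\}.$$ $\hat{\mathcal{B}}_k^r(\mathbb{R}^n)$ is the completion of $\mathcal{P}_k(\mathbb{R}^n)$ in this norm; its elements are (differential) $k$-chains of order $r$. Lower-order chains are regarded as higher-order chains via the canonical maps $\hat{\mathcal B}_k^r\to\hat{\mathcal B}_k^s$, $r\le s$, extending the identity. Mass. The mass of a chain $K$ is $\inf\{\liminf_i\|A_i\|_{B^0}:A_i\to K\}$, the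 infimum over all sequences of pointed chains $A_i$ converging to $K$. Forms and integral. $\mathcal{B}_k^r(\mathbb{R}^n)$ is the space of bounded $k$-forms $\omega$ with $\sup\{|\omega(\Delta_{U'}^j(p;\alpha))|:|\Delta_{U'}^j(p;\alpha)|_j=1,\ 0\le j\le r\}<\infty$, where $\omega(\sum(p_i;\alpha_i))=\sum\omega_{p_i}(\alpha_i)$ (for $r\ge1$: forms of class $C^{r-1}$ with bounded derivatives up to order $r-1$ and Lipschitz derivatives of order $r-1$). Each $\omega\in\mathcal{B}_k^r(\mathbb{R}^n)$ extends to a continuous functional on $\hat{\mathcal{B}}_k^r(\mathbb{R}^n)$; the Harrison integral is $\int_J\omega:=\omega(J)$, extended complex-linearly to complex-valued forms. Support. A closed set $X\subseteq\mathbb{R}^n$ supports $J$ if for every nonempty open $W\supseteq X$ there are $A_i\in\mathcal{P}_k(\mathbb{R}^n)$ supported at points of $W$ with $A_i\to J$ in $\hat{\mathcal B}_k^r(\mathbb{R}^n)$. $\mathrm{supp}(J)$ is the intersection of all closed sets supporting $J$, and $J$ is supported in a set $Z$ if $\mathrm{supp}(J)\subseteq Z$. Boundary. $J\in\hat{\mathcal{B}}_1^r(\mathbb{R}^2)$ is closed if $\partial J=0$, i.e. $\int_Jdg=0$ for all $g\in\mathcal{B}_0^{r+1}(\mathbb{R}^2)$. For a $2$-chain $K\in\hat{\mathcal{B}}_2^{s}(\mathbb{R}^2)$, $\partial K$ is characterized by $\int_{\partial K}\omega=\int_Kd\omega$ for $\omega\in\mathcal{B}_1^{s+1}(\mathbb{R}^2)$;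 for $K\in\hat{\mathcal{B}}_2^{r-1}(\mathbb{R}^2)$, $\partial K=J$ means $\int_Kd\omega=\int_J\omega$ for all $\omega\in\mathcal{B}_1^{r+1}(\mathbb{R}^2)$. Chain of an open set. For a bounded open set $D\subset\mathbb{R}^2$ with the standard orientation, $\widetilde D$ is the unique element of $\hat{\mathcal{B}}_2^1(\mathbb{R}^2)$ with $\int_{\widetilde D}\omega=\int_D\omega$ (Lebesgue integral) for all $\omega\in\mathcal{B}_2^1(\mathbb{R}^2)$. The support of $\partial\widetilde D$ lies in the topological boundary of $D$. Integral of a locally defined form. If a $1$-chain $J\in\hat{\mathcal{B}}_1^r(\mathbb{R}^2)$ has compact support contained in an open set $V$ and $g:V\to\mathbb{C}$ is smooth, then $\int_Jg(z)\,dz:=\int_J\chi g\,dz$ with $dz=dx+i\,dy$, where $\chi$ is any smooth function with compact support in $V$ equal to $1$ on a neighborhood of $\mathrm{supp}(J)$; the value does not depend on $\chi$. Winding number. For $z\notin\mathrm{supp}(J)$, $\mathrm{Ind}_J(z):=\frac1{2\pi i}\int_J\frac{dw}{w-z}$, where the integrand is understood as multiplied by a smooth function vanishing near $z$ and equal to $1$ outside a small disc about $z$ whose closure is disjoint from $\mathrm{supp}(J)$ (the value is independent of this choice). *)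

(* Defs.v *)
From HB Require Import structures.
From mathcomp Require Import all_boot all_order all_algebra.
From mathcomp Require Import generic_quotient.
From mathcomp Require Import all_classical all_reals all_analysis.
From mathcomp Require Import complex.

Set Implicit Arguments.
Unset Strict Implicit.
Unset Printing Implicit Defensive.

Import Order.TTheory GRing.Theory Num.Theory numFieldNormedType.Exports.

Local Open Scope classical_set_scope.
Local Open Scope ring_scope.
Local Open Scope quotient_scope.

(* Increasing multi-indices i_1 < ... < i_k; the basis e_{i_1} /\ ... /\ e_{i_k}
   of the k-vectors of R^n (and the dual basis of the k-covectors). *)
Definition kidx (n k : nat) : finType :=
  {s : k.-tuple 'I_n | sorted ltn [seq val i | i <- s]}.

Section KVectors.
Context {R : realType}.

(* The norm of the library on 'rV[R]_n is the sup norm. *)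
Definition enorm n (u : 'rV[R]_n) : R := Num.sqrt (\sum_i u 0 i ^+ 2).

Definition kvec n k := {ffun kidx n k -> R^o}.

Definition pairing n k (w a : kvec n k) : R := \sum_s w s * a s.

(* Exterior product of the k rows of v. *)
Definition wedge n k (v : 'M[R]_(k, n)) : kvec n k :=
  [ffun s => \det (colsub (tnth (val s)) v)].

Definition kvol n k (v : 'M[R]_(k, n)) : R := Num.sqrt (\det (v *m v^T)).

(* Simple k-vectors are written c *: wedge v; the scalar c only matters for
   k = 0, where every 0-vector is simple and wedge v = 1. *)
Definition kmass n k (a : kvec n k) : R :=
  inf [set x | exists s : seq (R * 'M[R]_(k, n)),
         a = \sum_(t <- s) t.1 *: wedge t.2 /\
         x = \sum_(t <- s) `|t.1| * kvol t.2].

End KVectors.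

Arguments kvec : clear implicits.

Section PointedChains.
Context {R : realType} {n k : nat}.

Definition pointed_pred : {pred 'rV[R]_n -> kvec R n k} :=
  [pred A | `[< finite_set [set p | A p != 0] >]].

Lemma pointedP (A : 'rV[R]_n -> kvec R n k) :
  reflect (finite_set [set p | A p != 0]) (A \in pointed_pred).
Proof. exact: asboolP. Qed.

Lemma pointed_submod_closed : submod_closed pointed_pred.
Proof.
split=> [|c A B].
  by apply/pointedP; apply: sub_finite_set (finite_set0 _) => p /=; rewrite eqxx.
move=> /pointedP fA /pointedP fB; apply/pointedP.
apply: (@sub_finite_set _ _ ([set p | A p != 0] `|` [set p | B p != 0])).
  move=> p /=; apply: contraPP => /not_orP[/negP + /negP].
  rewrite !negbK => /eqP A0 /eqP B0; apply/negP; rewrite negbK.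
  by rewrite -[(c *: A + B) p]/(c *: A p + B p) A0 B0 scaler0 addr0.
by rewrite finite_setU.
Qed.

HB.instance Definition _ :=
  GRing.isSubmodClosed.Build R ('rV[R]_n -> kvec R n k) pointed_pred
    pointed_submod_closed.

Record pchain := PChain {
  pchain_val :> 'rV[R]_n -> kvec R n k;
  _ : pchain_val \in pointed_pred }.

HB.instance Definition _ := [isSub of pchain for pchain_val].
HB.instance Definition _ := [Choice of pchain by <:].
HB.instance Definition _ := [SubChoice_isSubLmodule of pchain by <:].

End PointedChains.
Arguments pchain : clear implicits.

Section BNorm.
Context {R : realType} {n k : nat}.
Implicit Types (A : pchain R n k) (r : nat).

Definition ptchain (p : 'rV[R]_n) (a : kvec R n k) : 'rV[R]_n -> kvec R n k :=
  fun x => if x == p then a else 0.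

(* Translating by u moves (p; a) to (p + u; a). *)
Definition diffop (u : 'rV[R]_n) (A : 'rV[R]_n -> kvec R n k) :
    'rV[R]_n -> kvec R n k :=
  fun x => A (x - u) - A x.

Record dcell := DCell {
  dc_shifts : seq 'rV[R]_n; dc_point : 'rV[R]_n; dc_vec : kvec R n k }.

Definition dchain (c : dcell) : 'rV[R]_n -> kvec R n k :=
  foldr diffop (ptchain (dc_point c) (dc_vec c)) (dc_shifts c).

Definition dsize (c : dcell) : R :=
  (\prod_(u <- dc_shifts c) enorm u) * kmass (dc_vec c).

Definition dorder (c : dcell) : nat := size (dc_shifts c).

Definition Bnorm_set r A : set R :=
  [set x | exists s : seq dcell,
     [/\ all (fun c => dorder c <= r)%N s,
         pchain_val A = \sum_(c <- s) dchain c &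
         x = \sum_(c <- s) dsize c]].

Definition Bnorm r A : R := inf (Bnorm_set r A).

End BNorm.
Arguments dcell : clear implicits.

Section BNormTheory.
Context {R : realType} {n k : nat}.
Implicit Types (A B : pchain R n k) (r : nat).

Lemma kmass_ge0 (a : kvec R n k) : 0 <= kmass a.
Proof.
rewrite /kmass; set S := [set _ | _].
have [->|/set0P S0] := eqVneq S set0; first by rewrite inf0.
apply: lb_le_inf => // x [s [_ ->]]; apply: sumr_ge0 => t _.
by rewrite mulr_ge0 ?sqrtr_ge0.
Qed.

Lemma kmassN (a : kvec R n k) : kmass (- a) = kmass a.
Proof.
have sub b : [set x | exists s : seq (R * 'M[R]_(k, n)),
      b = \sum_(t <- s) t.1 *: wedge t.2 /\
      x = \sum_(t <- s) `|t.1| * kvol t.2] `<=`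
    [set x | exists s : seq (R * 'M[R]_(k, n)),
      - b = \sum_(t <- s) t.1 *: wedge t.2 /\
      x = \sum_(t <- s) `|t.1| * kvol t.2].
  move=> x [s [-> ->]]; exists [seq (- t.1, t.2) | t <- s].
  rewrite !big_map /= -sumrN; split.
    by apply: eq_bigr => t _; rewrite scaleNr.
  by apply: eq_bigr => t _; rewrite normrN.
rewrite /kmass; congr inf; apply/seteqP; split; last exact: sub.
by move=> x /sub; rewrite opprK.
Qed.

Lemma dsize_ge0 (c : dcell R n k) : 0 <= dsize c.
Proof.
by rewrite mulr_ge0 ?kmass_ge0// prodr_ge0// => u _; rewrite sqrtr_ge0.
Qed.

Lemma Bnorm_set_ge0 r A : lbound (Bnorm_set r A) 0.
Proof.
by move=> x [s [_ _ ->]]; apply: sumr_ge0 => c _; exact: dsize_ge0.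
Qed.

Lemma Bnorm_set_neq0 r A : Bnorm_set r A !=set0.
Proof.
have /pointedP fA := valP A.
pose s := [seq DCell [::] p (A p) | p <- finmap.enum_fset (fset_set [set p | A p != 0])].
exists (\sum_(c <- s) dsize c), s; split=> //.
  by rewrite all_map; apply/allP.
rewrite big_map; apply/funext => x; rewrite fct_sumE /dchain /ptchain /=.
have [Ax0|Ax0] := eqVneq (A x) 0.
  rewrite big1_seq ?Ax0// => p _.
  by have [<-|//] := eqVneq x p.
rewrite (bigD1_seq x) /= ?finmap.fset_uniq ?in_fset_set ?inE//.
rewrite eqxx big1 ?addr0// => p; rewrite eq_sym => /negbTE px.
by rewrite px.
Qed.

Lemma Bnorm_ge0 r A : 0 <= Bnorm r A.
Proof. by apply: lb_le_inf; [exact: Bnorm_set_neq0|exact: Bnorm_set_ge0]. Qed.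

Lemma Bnorm_le r A x : Bnorm_set r A x -> Bnorm r A <= x.
Proof. by apply: ge_inf; exists 0; exact: Bnorm_set_ge0. Qed.

Lemma Bnorm0 r : Bnorm r (0 : pchain R n k) = 0.
Proof.
apply/le_anti/andP; split; last exact: Bnorm_ge0.
by apply: Bnorm_le; exists [::]; rewrite !big_nil.
Qed.

Lemma dchainN (c : dcell R n k) :
  dchain (DCell (dc_shifts c) (dc_point c) (- dc_vec c)) = - dchain c.
Proof.
case: c => s p a; rewrite /dchain /=; elim: s => [|u s IHs] /=.
  apply/funext => x; rewrite /ptchain -[RHS]/(- (if x == p then a else 0)).
  by case: ifP => _ //; rewrite oppr0.
rewrite IHs; apply/funext => x.
rewrite -[RHS]/(- diffop u (foldr diffop (ptchain p a) s) x) /diffop.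
by rewrite -[X in X - _]/(- _) -[X in _ - X]/(- _) opprB opprK addrC.
Qed.

Lemma BnormN r A : Bnorm r (- A) = Bnorm r A.
Proof.
have sub B : Bnorm_set r B `<=` Bnorm_set r (- B).
  move=> x [s [sr Bs ->]].
  exists [seq DCell (dc_shifts c) (dc_point c) (- dc_vec c) | c <- s]; split.
  - by rewrite all_map.
  - rewrite big_map /=; under eq_bigr do rewrite dchainN.
    by rewrite sumrN -Bs.
  - by rewrite big_map; apply: eq_bigr => c _; rewrite /dsize /= kmassN.
rewrite /Bnorm; congr inf; apply/seteqP; split; last exact: sub.
by move=> x /sub; rewrite opprK.
Qed.

Lemma ler_BnormD r A B : Bnorm r (A + B) <= Bnorm r A + Bnorm r B.
Proof.
apply/ler_addgt0Pr => e e0; have e20 : 0 < e / 2 by rewrite divr_gt0.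
have hinf (C : pchain R n k) : has_inf (Bnorm_set r C).
  by split; [exact: Bnorm_set_neq0|exists 0; exact: Bnorm_set_ge0].
have [_ [s [sr As ->]] sA] := inf_adherent e20 (hinf A).
have [_ [t [tr Bt ->]] tB] := inf_adherent e20 (hinf B).
have /le_trans -> // : Bnorm r (A + B) <=
    \sum_(c <- s) dsize c + \sum_(c <- t) dsize c.
  apply: Bnorm_le; exists (s ++ t); rewrite all_cat sr tr !big_cat /=.
  by rewrite -As -Bt.
rewrite [in leRHS](splitr e) addrACA; exact/ltW/ltrD.
Qed.

End BNormTheory.

Section Completion.
Context {R : realType} {n k r : nat}.

Definition B_cauchy (A : nat -> pchain R n k) : Prop :=
  forall e : R, 0 < e -> exists N : nat, forall i j : nat,
    (N <= i)%N -> (N <= j)%N -> Bnorm r (A i - A j) < e.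

Record cauchy_pchain := CauchyPchain {
  cauchy_val :> nat -> pchain R n k;
  _ : `[< B_cauchy cauchy_val >] }.

HB.instance Definition _ := [isSub of cauchy_pchain for cauchy_val].
HB.instance Definition _ := [Choice of cauchy_pchain by <:].

Definition cauchy_equiv (A B : cauchy_pchain) : bool :=
  `[< Bnorm r (A i - B i) @[i --> \oo] --> (0 : R) >].

Lemma cauchy_equiv_is_equiv : equiv_class_of cauchy_equiv.
Proof.
split=> [A|A B|B A C].
- apply/asboolP; under eq_fun do rewrite subrr Bnorm0.
  exact: cvg_cst.
- by congr asbool; under eq_fun do rewrite -BnormN opprB.
- move=> /asboolP AB /asboolP BC; apply/asboolP.
  apply: (@squeeze_cvgr _ _ _ _ (fun=> 0)
    (fun i => Bnorm r (A i - B i) + Bnorm r (B i - C i))).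
  + near=> i; rewrite Bnorm_ge0 /=.
    by rewrite (le_trans _ (ler_BnormD _ _ _))// addrA subrK.
  + exact: cvg_cst.
  + by rewrite -[X in _ --> X](addr0 0); exact: cvgD.
Unshelve. all: by end_near.
Qed.

Canonical cauchy_equiv_rel := EquivRelPack cauchy_equiv_is_equiv.

(* Completion of (pchain R n k, Bnorm r). *)
Definition chain := {eq_quot cauchy_equiv}.

End Completion.
Arguments chain : clear implicits.

Section ChainTheory.
Context {R : realType} {n k r : nat}.
Implicit Types (J : chain R n k r) (A : pchain R n k).

(* The norm of A - J in the completion. *)
Definition chain_dist A J : R := limn (fun j => Bnorm r (A - repr J j)).

Definition chain_cvg (A : nat -> pchain R n k) J : Prop :=
  chain_dist (A i) J @[i --> \oo] --> (0 : R).

Definition chain_mass J : \bar R :=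
  ereal_inf [set limn_einf (fun i => (Bnorm 0 (A i))%:E)
            | A in [set A | chain_cvg A J]].

Definition supports (X : set 'rV[R]_n) J : Prop :=
  forall W : set 'rV[R]_n, open W -> W !=set0 -> X `<=` W ->
  exists2 A : nat -> pchain R n k,
    forall i, [set p | A i p != 0] `<=` W & chain_cvg A J.

Definition supp J : set 'rV[R]_n :=
  \bigcap_(X in [set X | closed X /\ supports X J]) X.

End ChainTheory.

Section Forms.
Context {R : realType}.

(* A k-form, by its coefficients in the basis dx_{i_1} /\ ... /\ dx_{i_k}. *)
Definition form n k := 'rV[R]_n -> kvec R n k.

Definition form_eval n k (w : form n k) (A : 'rV[R]_n -> kvec R n k) : R :=
  \sum_(p \in [set: 'rV[R]_n]) pairing (w p) (A p).

Definition Bform n k (r : nat) (w : form n k) : Prop :=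
  has_ubound [set `|form_eval w (dchain c)|
             | c in [set c : dcell R n k | (dorder c <= r)%N /\ dsize c = 1]].

(* (d w)_p(v_0, ..., v_k) =
     sum_j (-1)^j D_{v_j} [q |-> w_q(v_0, ..., v_{j-1}, v_{j+1}, ..., v_k)] (p),
   evaluated at v_j = e_{s_j}, the j-th row of E. *)
Definition extd n k (w : form n k) : form n k.+1 := fun p =>
  [ffun s : kidx n k.+1 =>
     let E : 'M[R]_(k.+1, n) := rowsub (tnth (val s)) 1%:M in
     \sum_(j < k.+1)
       (-1) ^+ j * 'D_(row j E) (fun q => pairing (w q) (wedge (row' j E))) p].

(* The limit exists, and does not depend on the representative, for w in
   Bform r. *)
Definition integral n k r (J : chain R n k r) (w : form n k) : R :=
  limn (fun i => form_eval w (repr J i)).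

Definition cform n k := 'rV[R]_n -> {ffun kidx n k -> R[i]}.

Definition cintegral n k r (J : chain R n k r) (w : cform n k) : R[i] :=
  (integral J (fun p => [ffun s => complex.Re (w p s)])
   +i* integral J (fun p => [ffun s => complex.Im (w p s)]))%C.

(* C^oo: all iterated directional derivatives exist and are differentiable. *)
Definition smooth n (f : 'rV[R]_n -> R) : Prop :=
  forall (vs : seq 'rV[R]_n) (p : 'rV[R]_n),
    differentiable (foldr (fun v g => 'D_v g) f vs) p.

End Forms.
Arguments form : clear implicits.
Arguments cform : clear implicits.

Section Plane.
Context {R : realType}.

Definition closed_chain r (J : chain R 2 1 r) : Prop :=
  forall g : form R 2 0, Bform r.+1 g -> integral J (extd g) = 0.

(* The boundary of K is J, tested on the 1-forms of class m. *)
Definition is_boundary m s r (K : chain R 2 2 s) (J : chain R 2 1 r) : Prop :=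
  forall w : form R 2 1, Bform m w -> integral K (extd w) = integral J w.

Definition pt2 (z : R * R) : 'rV[R]_2 :=
  \row_(j < 2) (if j == 0 then z.1 else z.2).

Definition is_chain_of_open (D : set 'rV[R]_2) (K : chain R 2 2 1) : Prop :=
  forall w : form R 2 2, Bform 1 w ->
    integral K w =
    \int[(lebesgue_measure \x lebesgue_measure)%E]_(z in pt2 @^-1` D)
      pairing (w (pt2 z)) (wedge 1%:M).

Definition toC (p : 'rV[R]_2) : R[i] := (p 0 0 +i* p 0 1)%C.

(* g dz = g (dx + i dy); dz takes the value toC e_j on the basis vector e_j. *)
Definition form_dz (g : 'rV[R]_2 -> R[i]) : cform R 2 1 := fun p =>
  [ffun s : kidx 2 1 => g p * toC (delta_mx 0 (tnth (val s) ord0))].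

Definition cutoff (V S : set 'rV[R]_2) (chi : 'rV[R]_2 -> R) : Prop :=
  [/\ smooth chi,
      compact (closure [set p | chi p != 0]),
      closure [set p | chi p != 0] `<=` V &
      exists O : set 'rV[R]_2,
        [/\ open O, S `<=` O & forall p, O p -> chi p = 1]].

(* The Harrison integral of g dz for g smooth on V, where V is an open
   neighbourhood of the compact set supp J; the values of g outside V are
   irrelevant, and the integral is the same for every cutoff chi. *)
Definition integral_dz r (J : chain R 2 1 r) (V : set 'rV[R]_2)
    (g : R[i] -> R[i]) : R[i] :=
  let chi := xget (cst 0) (cutoff V (supp J)) in
  cintegral J (form_dz (fun p => (chi p)%:C%C * g (toC p))).

Definition pole_cutoff (z : 'rV[R]_2) (S : set 'rV[R]_2)
    (psi : 'rV[R]_2 -> R) : Prop :=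
  [/\ smooth psi,
      \forall p \near z, psi p = 0 &
      exists e : R, [/\ 0 < e,
        forall p, enorm (p - z) <= e -> ~ S p &
        forall p, e <= enorm (p - z) -> psi p = 1]].

(* Meaningful for z outside supp J; the value is the same for every psi. *)
Definition winding r (J : chain R 2 1 r) (z : 'rV[R]_2) : R[i] :=
  let psi := xget (cst 0) (pole_cutoff z (supp J)) in
  (2 * pi%:C * 'i)%C^-1 *
    cintegral J (form_dz (fun p => (psi p)%:C%C / (toC p - toC z))).

Definition holomorphic_on (V : set 'rV[R]_2) (f : R[i] -> R[i]) : Prop :=
  forall p, V p -> derivable (f : R[i]^o -> R[i]^o) (toC p) 1.

End Plane.

(* Main.v *)
(* Off supp J the chain K has no boundary, so on test functions supported in a small
   square K and the Lebesgue integral both annihilate all partial derivatives; two such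
   functionals are proportional. Testing on the exterior derivative of a smoothed Cauchy
   kernel identifies the factor as the winding number. Hence K annihilates the densities
   supported off the compact set P = supp J union {Ind_J <> 0}, which lies in U.
   Let chi be a cutoff supported in U minus the poles, equal to 1 near P and near the
   closures of the D_k except in small discs about the poles. Then the integral of f dz over
   J is that of d(chi f dz) over K. Near P, this density lives in the small discs (f is
   smooth, by Cauchy's formula on squares, and satisfies the Cauchy-Riemann equations),
   where K is Ind_J(a_k) times the Lebesgue integral; and the Lebesgue integral of
   d(chi f dz) over D_k is the integral of f dz over B_k. The same chi serves for B_k because
   supp B_k lies in the frontier of D_k: otherwise, by the Hahn-Banach theorem, a form
   vanishing near the frontier would have a nonzero integral over B_k, against Stokes. *)
Require Import Defs.
From mathcomp Require Import all_boot all_order all_algebra.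
From mathcomp Require Import all_classical all_reals all_analysis.
From mathcomp Require Import complex.
From mathcomp Require Import ring lra zify.
Set Implicit Arguments.
Unset Strict Implicit.
Unset Printing Implicit Defensive.
Import Order.TTheory GRing.Theory Num.Theory numFieldNormedType.Exports.
Local Open Scope classical_set_scope.
Local Open Scope ring_scope.

(** * Finite differences *)

(** The class of a form is a bound on its finite differences over the whole plane. Every integrand,
    [f] included, is therefore replaced by a globally defined function with bounded differences of
    all orders ([DB N] for every [N]), so that the orders of the chains impose no constraint. This
    is why the kernel 1/z is smoothed inside a disc, and why regularity of [f] is read off a contour
    integral, through which difference bounds pass at once. The chain K is only a functional, with
    no density to work with: local proportionality to the Lebesgue integral rests on writing a
    function without mass as derivatives of test functions on the same square. Of [f] only pointwise
    complex differentiability is known. Goursat's argument gives Cauchy's formula with the contour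
    integral of the kernel as divisor; that divisor is merely bounded away from 0, and 2 pi is
    computed once, as the Lebesgue integral of the divergence of the smoothed kernel. Supports are
    defined by approximation, while computations only test forms; [localize] goes from supports to
    forms, Hahn-Banach back. *)

Section Differences.
Context {R : realType} {n : nat}.
Implicit Types (g h : 'rV[R]_n -> R) (u v p : 'rV[R]_n) (us vs : seq 'rV[R]_n).

Lemma enorm_ge0 u : 0 <= enorm u.
Proof. exact: sqrtr_ge0. Qed.

Lemma enormZ (t : R) u : enorm (t *: u) = `|t| * enorm u.
Proof.
rewrite /enorm -sqrtr_sqr -sqrtrM ?sqr_ge0//; congr Num.sqrt.
by rewrite mulr_sumr; apply: eq_bigr => i _; rewrite mxE exprMn.
Qed.

Lemma enormN u : enorm (- u) = enorm u.
Proof. by rewrite -scaleN1r enormZ normrN normr1 mul1r. Qed.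

Lemma enorm0 : enorm (0 : 'rV[R]_n) = 0.
Proof. by rewrite -(scale0r 0) enormZ normr0 mul0r. Qed.

Lemma coord_le_enorm u i : `|u 0 i| <= enorm u.
Proof.
rewrite /enorm -sqrtr_sqr ler_sqrt; last by apply: sumr_ge0 => j _; exact: sqr_ge0.
by rewrite (bigD1 i)//= lerDl; apply: sumr_ge0 => j _; exact: sqr_ge0.
Qed.

Definition fdiff u g : 'rV[R]_n -> R := fun p => g (p + u) - g p.
Definition fdiffs us g := foldr fdiff g us.
Definition shiftprod us : R := \prod_(u <- us) enorm u.

(** The condition that [Bform] puts on one coefficient of a form, with a single constant for all
    orders up to [N]. It passes to limits and integrals, and presupposes no differentiability. *)
Definition bdiff (N : nat) (C : R) g :=
  forall us p, (size us <= N)%N -> `|fdiffs us g p| <= C * shiftprod us.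
Arguments bdiff : simpl never.
Definition DB N g := exists C, bdiff N C g.

Lemma shiftprod_ge0 us : 0 <= shiftprod us.
Proof. by apply: prodr_ge0 => u _; exact: enorm_ge0. Qed.

Lemma shiftprod_cons u us : shiftprod (u :: us) = enorm u * shiftprod us.
Proof. by rewrite /shiftprod big_cons. Qed.

Lemma shiftprod_nil : shiftprod [::] = 1.
Proof. by rewrite /shiftprod big_nil. Qed.

Lemma fdiffC u v g : fdiff u (fdiff v g) = fdiff v (fdiff u g).
Proof. by apply/funext => p; rewrite /fdiff (addrAC p u v); ring. Qed.

Lemma fdiffs_fdiff us u g : fdiffs us (fdiff u g) = fdiff u (fdiffs us g).
Proof. by elim: us => //= v us ->; rewrite fdiffC. Qed.

Lemma fdiffsD us g h :
  fdiffs us (fun p => g p + h p) = (fun p => fdiffs us g p + fdiffs us h p).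
Proof. by elim: us => //= u us ->; apply/funext => p; rewrite /fdiff; ring. Qed.

Lemma fdiffsZ us c g : fdiffs us (fun p => c * g p) = (fun p => c * fdiffs us g p).
Proof. by elim: us => //= u us ->; apply/funext => p; rewrite /fdiff; ring. Qed.

Lemma bdiff_norm N C g : bdiff N C g -> forall p, `|g p| <= C.
Proof. by move=> Hg p; have := Hg [::] p isT; rewrite shiftprod_nil mulr1. Qed.

Lemma bdiff_ge0 N C g : bdiff N C g -> 0 <= C.
Proof. by move=> /bdiff_norm /(_ 0); apply: le_trans. Qed.

(** Differences commute, so one shift can be split off and absorbed in the constant. This is the
    induction on [N] behind reflections, products and inverses. *)
Lemma bdiffS N C g : bdiff N.+1 C g <->
  (forall p, `|g p| <= C) /\ forall u, bdiff N (C * enorm u) (fdiff u g).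
Proof.
split=> [Hg|[Hg Hd]].
  split=> [p|u us p sus]; first exact: (bdiff_norm Hg).
  by rewrite fdiffs_fdiff -mulrA -shiftprod_cons; exact: (Hg (u :: us)).
case=> [|u us] p sus; first by rewrite shiftprod_nil mulr1.
by rewrite shiftprod_cons mulrA /= -fdiffs_fdiff; exact: Hd.
Qed.

Lemma bdiff0 C g : (forall p, `|g p| <= C) -> bdiff 0 C g.
Proof. by move=> Hg [|//] p _; rewrite shiftprod_nil mulr1. Qed.

Lemma bdiff_le M N C D g : (M <= N)%N -> C <= D -> bdiff N C g -> bdiff M D g.
Proof.
move=> MN CD Hg us p sus; apply: le_trans (Hg us p (leq_trans sus MN)) _.
by rewrite ler_wpM2r// shiftprod_ge0.
Qed.

Lemma bdiffD N C D g h : bdiff N C g -> bdiff N D h -> bdiff N (C + D) (fun p => g p + h p).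
Proof.
move=> Hg Hh us p sus; rewrite fdiffsD mulrDl (le_trans (ler_normD _ _))//.
by rewrite lerD ?Hg ?Hh.
Qed.

Lemma bdiffZ N C c g : bdiff N C g -> bdiff N (`|c| * C) (fun p => c * g p).
Proof. by move=> Hg us p sus; rewrite fdiffsZ normrM -mulrA ler_wpM2l ?Hg. Qed.

Lemma bdiff_shift N C g q : bdiff N C g -> bdiff N C (fun p => g (p + q)).
Proof.
move=> Hg us p sus; suff -> : fdiffs us (fun p => g (p + q)) = (fun p => fdiffs us g (p + q)).
  exact: Hg.
by elim: us {sus} => //= u us ->; apply/funext => x; rewrite /fdiff addrAC.
Qed.

Lemma bdiff_reflect N C g q : bdiff N C g -> bdiff N C (fun p => g (q - p)).
Proof.
elim: N C g => [|N IH] C g.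
  by move=> Hg; apply: bdiff0 => p; exact: (bdiff_norm Hg).
move=> /bdiffS[Hg Hd]; apply/bdiffS; split=> [p|u]; first exact: Hg.
have -> : fdiff u (fun p => g (q - p)) = (fun p => fdiff (- u) g (q - p)).
  by apply/funext => p; rewrite /fdiff opprD addrA.
by rewrite -enormN; exact: IH.
Qed.

Lemma bdiffM N C D g h : bdiff N C g -> bdiff N D h ->
  bdiff N (2 ^+ N * (C * D)) (fun p => g p * h p).
Proof.
elim: N C D g h => [|N IH] C D g h Hg Hh.
  apply: bdiff0 => p; rewrite expr0 mul1r normrM.
  by rewrite ler_pM// ?(bdiff_norm Hg) ?(bdiff_norm Hh).
apply/bdiffS; split=> [p|u].
  have C0 := bdiff_ge0 Hg; have D0 := bdiff_ge0 Hh.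
  rewrite normrM; apply: (@le_trans _ _ (C * D)).
    by rewrite ler_pM// ?(bdiff_norm Hg) ?(bdiff_norm Hh).
  by rewrite ler_peMl ?mulr_ge0// exprn_ege1// ler1n.
have -> : fdiff u (fun p => g p * h p) =
    (fun p => fdiff u g p * h (p + u) + g p * fdiff u h p).
  by apply/funext => p; rewrite /fdiff; ring.
have [_ /(_ u) Hgu] := (bdiffS _ _ _).1 Hg.
have [_ /(_ u) Hhu] := (bdiffS _ _ _).1 Hh.
have Hg' := bdiff_le (leqnSn N) (lexx C) Hg.
have Hh' := bdiff_shift u (bdiff_le (leqnSn N) (lexx D) Hh).
apply: bdiff_le (leqnn N) _ (bdiffD (IH _ _ _ _ Hgu Hh') (IH _ _ _ _ Hg' Hhu)).
by rewrite exprS le_eqVlt; apply/orP; left; apply/eqP; ring.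
Qed.

Lemma bdiff_cst N c : bdiff N `|c| (fun=> c).
Proof.
elim: N c => [|N IH] c; first exact: bdiff0.
apply/bdiffS; split=> // u; have -> : fdiff u (fun=> c) = (fun=> 0).
  by apply/funext => p; rewrite /fdiff subrr.
by apply: bdiff_le (leqnn _) _ (IH 0); rewrite normr0 mulr_ge0 ?enorm_ge0.
Qed.

Lemma bdiffV N C c : 0 < c -> exists D, forall g, bdiff N C g ->
  (forall p, c <= `|g p|) -> bdiff N D (fun p => (g p)^-1).
Proof.
move=> c0; elim: N => [|N [D IH]].
  exists c^-1 => g Hg cg; apply: bdiff0 => p.
  by rewrite normfV lef_pV2 ?posrE// (lt_le_trans c0).
exists (Num.max c^-1 (2 ^+ N * (2 ^+ N * (C * D) * D))) => g Hg cg.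
apply/bdiffS; split=> [p|u].
  by rewrite le_max normfV lef_pV2 ?posrE ?cg// (lt_le_trans c0).
have g0 p : g p != 0 by rewrite -normr_gt0 (lt_le_trans c0).
have -> : fdiff u (fun p => (g p)^-1) =
    (fun p => (-1 * fdiff u g p * (g p)^-1) * (g (p + u))^-1).
  by apply/funext => p; rewrite /fdiff; field; rewrite !g0.
have [_ /(_ u) Hgu] := (bdiffS _ _ _).1 Hg.
have HV := IH g (bdiff_le (leqnSn N) (lexx C) Hg) cg.
apply: bdiff_le (leqnn N) _ (bdiffM (bdiffM (bdiffZ (-1) Hgu) HV) (bdiff_shift u HV)).
rewrite normrN1 mul1r.
rewrite [leLHS](_ : _ = (2 ^+ N * (2 ^+ N * (C * D) * D)) * enorm u); last by ring.
by rewrite ler_wpM2r ?enorm_ge0// le_max lexx orbT.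
Qed.

Lemma DB_le M N g : (M <= N)%N -> DB N g -> DB M g.
Proof. by move=> MN [C Hg]; exists C; exact: bdiff_le Hg. Qed.
Lemma DBD N g h : DB N g -> DB N h -> DB N (fun p => g p + h p).
Proof. by move=> [C Hg] [D Hh]; exists (C + D); exact: bdiffD. Qed.
Lemma DBZ N c g : DB N g -> DB N (fun p => c * g p).
Proof. by move=> [C Hg]; exists (`|c| * C); exact: bdiffZ. Qed.
Lemma DBN N g : DB N g -> DB N (fun p => - g p).
Proof.
move=> /(DBZ (-1)); congr DB; apply/funext => p; exact: mulN1r.
Qed.
Lemma DBB N g h : DB N g -> DB N h -> DB N (fun p => g p - h p).
Proof. by move=> Hg /DBN; exact: DBD. Qed.
Lemma DBM N g h : DB N g -> DB N h -> DB N (fun p => g p * h p).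
Proof. by move=> [C Hg] [D Hh]; exists (2 ^+ N * (C * D)); exact: bdiffM. Qed.
Lemma DB_cst N c : DB N (fun=> c).
Proof. by exists `|c|; exact: bdiff_cst. Qed.
Lemma DB_sum (I : Type) (r : seq I) (P : pred I) N (g : I -> 'rV[R]_n -> R) :
  (forall i, DB N (g i)) -> DB N (fun p => \sum_(i <- r | P i) g i p).
Proof.
move=> Hg; elim: r => [|i r IH].
  under eq_fun do rewrite big_nil; exact: DB_cst.
under eq_fun do rewrite big_cons; case: (P i) => //; exact: DBD.
Qed.
Lemma DB_shift N g q : DB N g -> DB N (fun p => g (p + q)).
Proof. by move=> [C Hg]; exists C; exact: bdiff_shift. Qed.
Lemma DBV N g c : 0 < c -> DB N g -> (forall p, c <= `|g p|) -> DB N (fun p => (g p)^-1).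
Proof. by move=> c0 [C Hg] cg; have [D HD] := bdiffV N C c0; exists D; exact: HD. Qed.

End Differences.

Section DifferencesDerivatives.
Context {R : realType} {n : nat}.
Implicit Types (g h : 'rV[R]_n -> R) (u v p : 'rV[R]_n).

Lemma bdiff1 N C g : bdiff N.+1 C g -> forall p u, `|g (p + u) - g p| <= C * enorm u.
Proof. by move=> /bdiffS[_ /(_ _)/bdiff_norm Hg] p u; exact: Hg. Qed.

Lemma bdiff2 N C g : bdiff N.+2 C g -> forall p u v,
  `|g (p + u + v) - g (p + u) - g (p + v) + g p| <= C * enorm u * enorm v.
Proof.
move=> /bdiffS[_ /(_ _)/bdiff1 Hg] p u v; have := Hg u p v.
by rewrite /fdiff (addrAC p v u); congr (`|_| <= _); ring.
Qed.

Let dq g p v (t : R) := t^-1 * (g (p + t *: v) - g p).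

(** Compare t with [m] steps of length s, [m] being the integer part of t/s. By the
    second-difference bound, the increment number i differs from the first one by at most i times a
    multiple of s^2, which sums to O(t^2); the leftover step, shorter than s, costs a first
    difference. *)
Lemma dq_close C g p v (s t : R) : bdiff 2 C g -> 0 < s -> 0 < t -> s <= t ->
  `|dq g p v t - dq g p v s| <= C * enorm v ^+ 2 * t + 2 * C * enorm v * (s / t).
Proof.
move=> Hg s0 t0 st; pose m := Num.truncn (t / s).
have /andP[mt tm] : m%:R <= t / s < m.+1%:R by apply: truncn_itv; rewrite divr_ge0 ?ltW.
pose phi (i : nat) := g (p + (i%:R * s) *: v).
have phi0 : phi 0%N = g p by rewrite /phi mul0r scale0r addr0.
have C0 := bdiff_ge0 Hg.
have e0 : 0 <= enorm v by exact: enorm_ge0.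
have step i : `|phi i.+1 - phi i - (phi 1%N - phi 0%N)| <= C * enorm v ^+ 2 * s ^+ 2 * i%:R.
  have := bdiff2 Hg p ((i%:R * s) *: v) (s *: v).
  have -> : p + (i%:R * s) *: v + s *: v = p + (i.+1%:R * s) *: v.
    by rewrite -addrA -scalerDl -natr1 mulrDl mul1r.
  rewrite !enormZ normrM normr_nat (gtr0_norm s0) phi0 /phi mul1r => H.
  rewrite [leRHS](_ : _ = C * (i%:R * s * enorm v) * (s * enorm v)); last by ring.
  by apply: le_trans H; rewrite le_eqVlt; apply/orP; left; apply/eqP; congr `|_|; ring.
have sum k : `|phi k - phi 0%N - k%:R * (phi 1%N - phi 0%N)| <= C * enorm v ^+ 2 * s ^+ 2 * k%:R ^+ 2.
  elim: k => [|k IH]; first by rewrite subrr mul0r subrr normr0 !mulr_ge0 ?exprn_ge0// ltW.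
  rewrite [X in `|X|](_ : _ = (phi k - phi 0%N - k%:R * (phi 1%N - phi 0%N)) +
     (phi k.+1 - phi k - (phi 1%N - phi 0%N))); last by rewrite -natr1; ring.
  apply: le_trans (ler_normD _ _) _; apply: le_trans (lerD IH (step k)) _.
  rewrite -mulrDr ler_wpM2l ?mulr_ge0 ?exprn_ge0 ?(ltW s0)// -natr1.
  have : 0 <= k%:R :> R by []. by nra.
have ms : m%:R * s <= t by rewrite -ler_pdivlMr.
have tms : t < m%:R * s + s.
  by move: tm; rewrite ltr_pdivrMr// -natr1 mulrDl mul1r.
have last : `|g (p + t *: v) - phi m| <= C * enorm v * s.
  have := bdiff1 Hg (p + (m%:R * s) *: v) ((t - m%:R * s) *: v).
  rewrite -addrA -scalerDl (addrC (m%:R * s)) subrK enormZ (ger0_norm (x:=t - m%:R * s)) ?subr_ge0//.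
  move=> /le_trans; apply.
  rewrite -[leRHS]mulrA ler_wpM2l// (mulrC _ (enorm v)) ler_wpM2l//; lra.
have one : `|phi 1%N - phi 0%N| <= C * enorm v * s.
  have := bdiff1 Hg p (s *: v); rewrite enormZ (gtr0_norm s0) phi0 /phi mul1r => /le_trans; apply.
  by rewrite mulrAC mulrA.
have main : `|g (p + t *: v) - g p - t / s * (phi 1%N - phi 0%N)| <=
    C * enorm v ^+ 2 * t ^+ 2 + 2 * (C * enorm v * s).
  rewrite [X in `|X|](_ : _ = (g (p + t *: v) - phi m) + (phi m - phi 0%N - m%:R * (phi 1%N - phi 0%N))
    - (t / s - m%:R) * (phi 1%N - phi 0%N)); last by rewrite phi0; ring.
  apply: le_trans (ler_normB _ _) _; apply: le_trans (lerD (ler_normD _ _) (lexx _)) _.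
  have A : `|(t / s - m%:R) * (phi 1%N - phi 0%N)| <= C * enorm v * s.
    rewrite normrM; apply: le_trans (ler_wpM2l _ one) _ => //.
    rewrite ler_piMl ?mulr_ge0// ?(ltW s0)// ger0_norm ?subr_ge0//.
    by move: tm; rewrite -natr1; lra.
  have B : C * enorm v ^+ 2 * s ^+ 2 * m%:R ^+ 2 <= C * enorm v ^+ 2 * t ^+ 2.
    rewrite -mulrA -exprMn ler_wpM2l ?mulr_ge0 ?exprn_ge0// ler_sqr ?nnegrE ?mulr_ge0 ?(ltW s0) ?(ltW t0)//.
    by rewrite mulrC.
  have := sum m; lra.
rewrite /dq [X in `|X|](_ : _ = t^-1 * (g (p + t *: v) - g p - t / s * (phi 1%N - phi 0%N))); last first.
  by rewrite phi0 /phi mul1r; field; rewrite !gt_eqF.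
rewrite normrM gtr0_norm ?invr_gt0//.
apply: le_trans (ler_wpM2l _ main) _; first by rewrite invr_ge0 ltW.
by rewrite le_eqVlt; apply/orP; left; apply/eqP; field; rewrite gt_eqF.
Qed.

Lemma dqN C g p v (s : R) : bdiff 2 C g -> 0 < s ->
  `|dq g p v (- s) - dq g p v s| <= C * enorm v ^+ 2 * s.
Proof.
move=> Hg s0; have := bdiff2 Hg (p - s *: v) (s *: v) (s *: v).
rewrite subrK enormZ (gtr0_norm s0) => H.
rewrite /dq [X in `|X|](_ : _ = - s^-1 * (g (p + s *: v) - g p - g p + g (p - s *: v))).
  rewrite normrM normrN (gtr0_norm (x:=s^-1)) ?invr_gt0//.
  apply: le_trans (ler_wpM2l _ H) _; first by rewrite invr_ge0 ltW.
  by rewrite le_eqVlt; apply/orP; left; apply/eqP; field; rewrite gt_eqF.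
by rewrite scaleNr; field; rewrite gt_eqF.
Qed.

Let dqE g p v : dq g p v = (fun t => t^-1 *: ((g \o shift p) (t *: v) - g p)).
Proof. by apply/funext => t; rewrite /dq /= (addrC p). Qed.

Lemma DB_derivable N g p v : DB N.+2 g -> derivable g p v.
Proof.
move=> /(@DB_le _ _ 2 N.+2 g isT)[C Hg]; rewrite /derivable -dqE.
have C0 := bdiff_ge0 Hg; have e0 := enorm_ge0 v.
pose A := C * enorm v ^+ 2 + 2 * C * enorm v + C * enorm v ^+ 2.
have A0 : 0 <= A by rewrite !addr_ge0 ?mulr_ge0 ?exprn_ge0.
apply: cauchy_cvg; apply: cauchy_exP => e e1.
pose t := Num.min 1 (e / (A + 1) / 2).
have t0 : 0 < t by rewrite lt_min ltr01 !divr_gt0// ltr_wpDl.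
have t1 : t <= 1 by rewrite ge_min lexx.
have tA : A * t < e.
  have : t <= e / (A + 1) / 2 by rewrite ge_min lexx orbT.
  rewrite ler_pdivlMr// ler_pdivlMr ?ltr_wpDl//; nra.
have pos (s : R) : 0 < s -> s < t ^+ 2 -> `|dq g p v t - dq g p v s| <= (C * enorm v ^+ 2 + 2 * C * enorm v) * t.
  move=> s0 st; have st' : s <= t by nra.
  apply: le_trans (dq_close p v Hg s0 t0 st') _; rewrite [leRHS]mulrDl lerD2l.
  rewrite ler_wpM2l ?mulr_ge0// ler_pdivrMr//; nra.
exists (dq g p v t); rewrite /= /nbhs /=.
near=> s; rewrite /= -ball_normE /=.
have s0 : s != 0 by near: s; exact: nbhs_dnbhs_neq.
(* At scale t^2 the term s/t of [dq_close] is at most t. *)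
have st : `|s| < t ^+ 2.
  near: s; apply: dnbhs0_lt; exact: exprn_gt0.
apply: le_lt_trans tA; rewrite /A.
have [sp|sn|/eqP] := ltgtP 0 s.
- rewrite gtr0_norm// in st; apply: le_trans (pos _ sp st) _.
  by rewrite [leRHS]mulrDl lerDl !mulr_ge0 ?exprn_ge0// ltW.
- rewrite ltr0_norm// in st; have sn' : 0 < - s by rewrite oppr_gt0.
  rewrite [X in `|X|](_ : _ = (dq g p v t - dq g p v (- s)) - (dq g p v (- - s) - dq g p v (- s))); last first.
    by rewrite opprK; ring.
  apply: le_trans (ler_normB _ _) _; rewrite [leRHS]mulrDl; apply: lerD; first exact: pos.
  apply: le_trans (dqN p v Hg sn') _; rewrite ler_wpM2l ?mulr_ge0 ?exprn_ge0//; nra.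
- by rewrite eq_sym (negbTE s0).
Unshelve. all: by end_near.
Qed.

(** A difference of ['D_v g] is the limit of t^-1 times a difference of [g] with the extra shift
    [t *: v], whose norm cancels t^-1. *)
Lemma bdiff_derive N C g v : bdiff N.+2 C g -> bdiff N.+1 (C * enorm v) ('D_v g).
Proof.
move=> Hg us p sus.
have dq_cvg q : dq g q v t @[t --> 0^'] --> 'D_v g q.
  by have := @DB_derivable N g q v (ex_intro _ C Hg); rewrite /derivable /derive -dqE.
have H : fdiffs us (fun q => dq g q v t) p @[t --> 0^'] --> fdiffs us ('D_v g) p.
  elim: us p {sus} => [|u us IH] p; first exact: dq_cvg.
  by rewrite /= /fdiff; apply: cvgB; exact: IH.
have HN : `|fdiffs us (fun q => dq g q v t) p| @[t --> 0^'] --> `|fdiffs us ('D_v g) p|.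
  exact: cvg_norm.
rewrite -(cvg_lim _ HN)//; apply: limr_le; first by apply/cvg_ex; eexists; exact: HN.
near=> t; have t0 : t != 0 by near: t; exact: nbhs_dnbhs_neq.
rewrite /dq fdiffsZ -/(fdiff _ _) normrM.
have := Hg ((t *: v) :: us) p; rewrite ltnS => /(_ sus).
rewrite shiftprod_cons enormZ /= -fdiffs_fdiff => /(ler_wpM2l (normr_ge0 t^-1)) /le_trans; apply.
rewrite normfV le_eqVlt; apply/orP; left; apply/eqP; field.
by rewrite normr_eq0.
Unshelve. all: by end_near.
Qed.

Lemma DB_derive N g v : DB N.+2 g -> DB N.+1 ('D_v g).
Proof. by move=> [C Hg]; exists (C * enorm v); exact: bdiff_derive. Qed.

Lemma is_derive_translate g q w u : derivable g (q + w) u ->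
  is_derive q u (fun p => g (p + w)) ('D_u g (q + w)).
Proof.
have E : (fun h : R => h^-1 *: (((fun p => g (p + w)) \o shift q) (h *: u) - g (q + w))) =
    (fun h : R => h^-1 *: ((g \o shift (q + w)) (h *: u) - g (q + w))).
  by apply/funext => h /=; rewrite addrA.
by move=> dg; apply: DeriveDef; rewrite /derivable /derive E.
Qed.

Lemma is_derive_line g p u (t : R) : derivable g (p + t *: u) u ->
  is_derive t 1 (fun s : R => g (p + s *: u)) ('D_u g (p + t *: u)).
Proof.
have E : (fun h : R => h^-1 *: (((fun s => g (p + s *: u)) \o shift t) (h *: 1) - g (p + t *: u))) =
    (fun h : R => h^-1 *: ((g \o shift (p + t *: u)) (h *: u) - g (p + t *: u))).
  by apply/funext => h /=; rewrite [h *: 1]mulr1 scalerDl (addrCA p).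
by move=> dg; apply: DeriveDef; rewrite /derivable /derive E.
Qed.

Lemma line_mvt g p u : (forall q, derivable g q u) ->
  exists t : R, g (p + u) - g p = 'D_u g (p + t *: u).
Proof.
move=> dg; have D t := is_derive_line (dg (p + t *: u)).
have [|t _] := MVT_segment (ler01 : 0 <= 1 :> R) (fun t _ => D t).
  by apply: derivable_within_continuous => t _; have [] := D t.
by rewrite subr0 mulr1 scale1r scale0r addr0 => H; exists t.
Qed.

Lemma is_derive_fdiffs g u q vs : (forall p, derivable g p u) ->
  is_derive q u (fdiffs vs g) (fdiffs vs ('D_u g) q).
Proof.
move=> dg; elim: vs q => [|v vs IH] q /=; first exact: derivableP.
rewrite /fdiff; apply: is_deriveB.
have [d e] := IH (q + v); rewrite -e; exact: is_derive_translate.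
Qed.

(** By the mean value theorem along u, one difference is a derivative in direction u, and this
    derivative commutes with the remaining differences. *)
Lemma DB_grad N C M g : (forall p, `|g p| <= M) -> (forall p u, derivable g p u) ->
  (forall u, bdiff N (C * enorm u) ('D_u g)) -> DB N.+1 g.
Proof.
move=> gM dg HD; exists (Num.max M C); apply/bdiffS; split=> [p|u us p sus].
  by rewrite le_max gM.
have DD q vs := is_derive_fdiffs q vs (dg ^~ u).
have [|t] := @line_mvt (fdiffs us g) p u; first by move=> q; have [] := DD q us.
have [_ ->] := DD (p + t *: u) us.
rewrite fdiffs_fdiff /fdiff => ->; apply: le_trans (HD u us _ sus) _.
by rewrite ler_wpM2r ?shiftprod_ge0// ler_wpM2r ?enorm_ge0// le_max lexx orbT.
Qed.
End DifferencesDerivatives.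

(** * Evaluation of forms on pointed chains *)

Section FormEval.
Context {R : realType} {n k : nat}.
Implicit Types (w : Defs.form R n k) (A B : 'rV[R]_n -> kvec R n k) (a b : kvec R n k).

Definition finsupp A := finite_set [set p | A p != 0].

Lemma finsupp_pchain (A : pchain R n k) : finsupp A.
Proof. by have /pointedP := valP A. Qed.

Lemma finsuppD A B : finsupp A -> finsupp B -> finsupp (fun p => A p + B p).
Proof.
move=> fA fB; apply: (@sub_finite_set _ _ ([set p | A p != 0] `|` [set p | B p != 0])).
  move=> p /=; have [->|] := eqVneq (A p) 0; last by left.
  have [->|] := eqVneq (B p) 0; last by right.
  by rewrite addr0 eqxx.
by rewrite finite_setU.
Qed.

Lemma finsuppN A : finsupp A -> finsupp (fun p => - A p).
Proof. by apply: sub_finite_set => p /=; rewrite oppr_eq0. Qed.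

Lemma finsuppB A B : finsupp A -> finsupp B -> finsupp (fun p => A p - B p).
Proof. by move=> fA fB; exact/finsuppD/finsuppN. Qed.

Lemma finsupp_shift A u : finsupp A -> finsupp (fun p => A (p - u)).
Proof.
move=> fA; apply: (@sub_finite_set _ _ ((fun p => p + u) @` [set p | A p != 0])).
  by move=> p /= Ap; exists (p - u) => //; rewrite subrK.
exact: finite_image.
Qed.

Lemma finsupp_ptchain p a : finsupp (ptchain p a).
Proof.
apply: (@sub_finite_set _ _ [set p]) => // q; rewrite /ptchain /=.
by have [->|] := eqVneq q p; rewrite ?eqxx.
Qed.

Lemma finsupp_dchain (c : dcell R n k) : finsupp (dchain c).
Proof.
case: c => us p a; rewrite /dchain /=; elim: us => [|u us IH] /=; first exact: finsupp_ptchain.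
exact/finsuppB/IH/finsupp_shift.
Qed.

Lemma pairingDr (v : kvec R n k) a b : pairing v (a + b) = pairing v a + pairing v b :> R.
Proof. by rewrite /pairing -big_split; apply: eq_bigr => s _; rewrite ffunE mulrDr. Qed.
Lemma pairing0r (v : kvec R n k) : pairing v (0 : kvec R n k) = 0 :> R.
Proof. by rewrite /pairing big1// => s _; rewrite ffunE mulr0. Qed.
Lemma pairingDl (v : kvec R n k) b a : pairing (v + b) a = pairing v a + pairing b a :> R.
Proof. by rewrite /pairing -big_split; apply: eq_bigr => s _; rewrite ffunE mulrDl. Qed.
Lemma pairingZl t (v : kvec R n k) a : pairing (t *: v) a = t * pairing v a :> R.
Proof. by rewrite /pairing mulr_sumr; apply: eq_bigr => s _; rewrite ffunE mulrA. Qed.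

Lemma form_eval_finite w A (X : set 'rV[R]_n) : finite_set X -> [set p | A p != 0] `<=` X ->
  form_eval w A = \sum_(p \in X) pairing (w p) (A p).
Proof.
move=> fX AX; rewrite /form_eval; apply/esym/fsbig_widen => //.
move=> p /= [_ nX]; have [->|A0] := eqVneq (A p) 0; first by rewrite pairing0r.
by case: nX; exact: AX.
Qed.

Lemma form_evalD w A B : finsupp A -> finsupp B ->
  form_eval w (fun p => A p + B p) = form_eval w A + form_eval w B.
Proof.
move=> fA fB; pose X := [set p | A p != 0] `|` [set p | B p != 0].
have fX : finite_set X by rewrite finite_setU.
rewrite !(@form_eval_finite _ _ X)//; first last.
- move=> p /=; apply: contraPP => /not_orP[/negP + /negP].
  by rewrite !negbK => /eqP -> /eqP ->; rewrite addr0 eqxx.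
- by move=> p; left.
- by move=> p; right.
rewrite !fsbig_finite//= -big_split/=; apply: eq_bigr => p _.
by rewrite pairingDr.
Qed.

Lemma form_eval0 w : form_eval w (fun=> 0) = 0.
Proof. by rewrite /form_eval fsbig1// => p _; rewrite pairing0r. Qed.

Lemma form_evalN w A : finsupp A -> form_eval w (fun p => - A p) = - form_eval w A.
Proof.
move=> fA; apply/eqP; rewrite -addr_eq0 -form_evalD//; last exact: finsuppN.
by under eq_fun do rewrite addNr; rewrite form_eval0.
Qed.

Lemma form_evalB w A B : finsupp A -> finsupp B ->
  form_eval w (fun p => A p - B p) = form_eval w A - form_eval w B.
Proof.
by move=> fA fB; rewrite form_evalD ?form_evalN//; exact: finsuppN.
Qed.

Lemma form_eval_sum w (T : Type) (s : seq T) (A : T -> 'rV[R]_n -> kvec R n k) :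
  (forall i, finsupp (A i)) ->
  form_eval w (fun p => \sum_(i <- s) A i p) = \sum_(i <- s) form_eval w (A i).
Proof.
move=> fA; have fs r : finsupp (fun p => \sum_(i <- r) A i p).
  elim: r => [|j r IH].
    apply: (@sub_finite_set _ _ set0) => // p /=; by rewrite big_nil eqxx.
  have -> : (fun p => \sum_(i <- j :: r) A i p) = (fun p => A j p + \sum_(i <- r) A i p).
    by apply/funext => p; rewrite big_cons.
  exact: finsuppD.
elim: s => [|i s IH].
  by rewrite big_nil; under eq_fun do rewrite big_nil; rewrite form_eval0.
rewrite big_cons -IH -form_evalD//; congr form_eval; apply/funext => p.
by rewrite big_cons.
Qed.

Lemma form_evalDw w1 w2 A : finsupp A ->
  form_eval (fun p => w1 p + w2 p) A = form_eval w1 A + form_eval w2 A.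
Proof.
move=> fA; rewrite !(@form_eval_finite _ _ [set p | A p != 0])//.
rewrite !fsbig_finite//= -big_split/=; apply: eq_bigr => p _.
by rewrite pairingDl.
Qed.

Lemma form_evalZw t w A : finsupp A ->
  form_eval (fun p => t *: w p) A = t * form_eval w A.
Proof.
move=> fA; rewrite !(@form_eval_finite _ _ [set p | A p != 0])//.
rewrite !fsbig_finite//= mulr_sumr; apply: eq_bigr => p _.
by rewrite pairingZl.
Qed.

Lemma form_eval_shift w A u : form_eval w (fun p => A (p - u)) = form_eval (fun p => w (p + u)) A.
Proof.
rewrite /form_eval (@reindex_fsbigT _ _ _ _ _ (fun p => p + u)).
  by apply: eq_fsbigr => p _; rewrite addrK.
by exists (fun p => p - u) => p; rewrite ?addrK ?subrK.
Qed.

Lemma form_eval_ptchain w p a : form_eval w (ptchain p a) = pairing (w p) a.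
Proof.
rewrite (@form_eval_finite _ _ [set p])//; first by rewrite fsbig_set1 /ptchain eqxx.
by move=> q /=; rewrite /ptchain; have [->|] := eqVneq q p; rewrite ?eqxx.
Qed.

(** Evaluation moves differences from the chain to the coefficients: translating the chain by [u]
    amounts to reading the form at [p + u], hence no sign appears. *)
Lemma form_eval_dchain w (c : dcell R n k) : form_eval w (dchain c) =
  \sum_s dc_vec c s * fdiffs (dc_shifts c) (fun p => w p s) (dc_point c).
Proof.
case: c => us p a; rewrite /dchain /=; elim: us w => [|u us IH] w /=.
  by rewrite form_eval_ptchain; apply: eq_bigr => s _; rewrite mulrC.
have fs := finsupp_dchain (DCell us p a).
rewrite form_evalB//; last exact: finsupp_shift.
rewrite form_eval_shift !IH -sumrB; apply: eq_bigr => s _.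
rewrite -mulrBr; congr (_ * _); rewrite -[RHS]/(fdiff u (fdiffs us (fun q => w q s)) p).
rewrite -fdiffs_fdiff; suff -> : fdiff u (fun q => w q s) = (fun q => w (q + u) s + -1 * w q s).
  by rewrite fdiffsD fdiffsZ mulN1r.
by apply/funext => q; rewrite /fdiff mulN1r.
Qed.
End FormEval.

(** * Multivectors and their mass in the plane *)

Section PlaneIndices.

Definition ix1 (j : 'I_2) : kidx 2 1 :=
  Sub [tuple j] (isT : sorted ltn [seq val i | i <- [tuple j]]).
Definition ix2 : kidx 2 2 :=
  Sub [tuple ord0; ord_max] (isT : sorted ltn [seq val i | i <- [tuple ord0; ord_max : 'I_2]]).

Lemma kidx1E (s : kidx 2 1) : s = ix1 (tnth (val s) ord0).
Proof.
apply/val_inj/eq_from_tnth => i; rewrite (ord1 i) /= (tnth_nth (tnth (val s) ord0))/=.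
by [].
Qed.

Lemma kidx2E (s : kidx 2 2) : s = ix2.
Proof.
apply/val_inj/val_inj => /=; case: s => -[[|x [|y [|//]]] //= st] /=.
rewrite /= andbT => xy; case: x y st xy => [[|[|//]] px] [[|[|//]] py] st //= _.
by congr [:: _; _]; exact/val_inj.
Qed.

Lemma sum_kidx1 (V : nmodType) (F : kidx 2 1 -> V) : \sum_s F s = F (ix1 0) + F (ix1 1).
Proof.
rewrite (reindex ix1); last first.
  by exists (fun s => tnth (val s) ord0) => s _ //; rewrite -kidx1E.
rewrite !big_ord_recl big_ord0 /= addr0; congr (F (ix1 _) + F (ix1 _)); exact/val_inj.
Qed.

Lemma sum_kidx2 (V : nmodType) (F : kidx 2 2 -> V) : \sum_s F s = F ix2.
Proof. by apply: big_pred1 => s /=; apply/esym/eqP; exact: kidx2E. Qed.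

Context {R : realType}.

Lemma wedge1E (v : 'M[R]_(1, 2)) s : wedge v s = v 0 (tnth (val s) ord0).
Proof. by rewrite /wedge ffunE det_mx11 mxE. Qed.

Lemma wedge2E (v : 'M[R]_2) s : wedge v s = \det v.
Proof.
rewrite /wedge ffunE; congr (\det _); apply/matrixP => i j; rewrite mxE [s]kidx2E.
congr (v _ _); rewrite (tnth_nth ord0) /=.
by case: j => [[|[|//]]] pj; exact/val_inj.
Qed.

Lemma kvol1E (v : 'M[R]_(1, 2)) : kvol v = enorm v.
Proof.
rewrite /kvol /enorm det_mx11 mxE; congr Num.sqrt; apply: eq_bigr => i _.
by rewrite mxE -expr2.
Qed.

Lemma kvol2E (v : 'M[R]_2) : kvol v = `|\det v|.
Proof. by rewrite /kvol det_mulmx det_tr -expr2 sqrtr_sqr. Qed.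

(** A coordinate has norm at most 1 on simple k-vectors, so it is dominated by every decomposition.
    That some decomposition exists has to be known because the infimum of the empty set is 0 by
    convention. *)
Lemma kmass_coord n k (a : kvec R n k) :
  (forall (v : 'M[R]_(k, n)) s, `|wedge v s| <= kvol v) ->
  (exists t : seq (R * 'M[R]_(k, n)), a = \sum_(x <- t) x.1 *: wedge x.2) ->
  forall s, `|a s| <= kmass a.
Proof.
move=> Hw [t0 at0] s; apply: lb_le_inf.
  by exists (\sum_(t <- t0) `|t.1| * kvol t.2), t0.
move=> x [t [-> ->]]; rewrite sum_ffunE; apply: le_trans (ler_norm_sum _ _ _) _.
by apply: ler_sum => i _; rewrite ffunE normrM ler_wpM2l.
Qed.

Lemma kmass1_coord (a : kvec R 2 1) s : `|a s| <= kmass a.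
Proof.
apply: kmass_coord => [v t|]; first by rewrite wedge1E kvol1E coord_le_enorm.
exists [:: (1, \row_j a (ix1 j))]; rewrite big_seq1 scale1r.
by apply/ffunP => t; rewrite wedge1E mxE {1}[t]kidx1E.
Qed.

Lemma kmass2_coord (a : kvec R 2 2) s : `|a s| <= kmass a.
Proof.
apply: kmass_coord => [v t|]; first by rewrite wedge2E kvol2E.
exists [:: (a ix2, 1%:M)]; rewrite big_seq1.
by apply/ffunP => t; rewrite ffunE wedge2E det1 [t]kidx2E [_ *: _]mulr1.
Qed.

Lemma enorm_delta (j : 'I_2) : enorm (delta_mx 0 j : 'rV[R]_2) = 1.
Proof.
rewrite /enorm (bigD1 j)//= big1 ?addr0 => [|i ij].
  by rewrite mxE !eqxx expr1n sqrtr1.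
by rewrite mxE eqxx (negbTE ij) expr0n.
Qed.

Lemma kmass_decomp n k (a : kvec R n k) (t : seq (R * 'M[R]_(k, n))) :
  a = \sum_(x <- t) x.1 *: wedge x.2 -> kmass a <= \sum_(x <- t) `|x.1| * kvol x.2.
Proof.
move=> at0; apply: ge_inf; last by exists t.
exists 0 => x [s [_ ->]]; apply: sumr_ge0 => i _.
by rewrite mulr_ge0 ?sqrtr_ge0.
Qed.

Definition ekvec n k (s : kidx n k) : kvec R n k := [ffun t => (t == s)%:R].

Lemma kmass_ekvec1 (s : kidx 2 1) : kmass (ekvec s) <= 1.
Proof.
apply: le_trans (kmass_decomp (t := [:: (1, delta_mx 0 (tnth (val s) ord0))]) _) _.
  rewrite big_seq1 scale1r; apply/ffunP => t; rewrite wedge1E ffunE mxE /=.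
  congr (_%:R); congr nat_of_bool; apply/eqP/eqP => [->//|E].
  by rewrite [t]kidx1E [s]kidx1E E.
by rewrite big_seq1 normr1 mul1r kvol1E enorm_delta.
Qed.
End PlaneIndices.
Arguments ix1 : simpl never.
Arguments ix2 : simpl never.

Lemma ltr_dist_le (R : realDomainType) (a b c d e : R) :
  b <= a + c -> a <= b + d -> c < e -> d < e -> `|b - a| < e.
Proof. by move=> *; rewrite ltr_norml; lra. Qed.

(** * Integrals over elements of the completion *)

Section Integral.
Context {R : realType} {n k : nat}.
Hypothesis Hk : forall (a : kvec R n k) s, `|a s| <= kmass a.
Implicit Types (w : Defs.form R n k) (r : nat).

Definition DBform r w := forall s, DB r (fun p => w p s).

Lemma DBform_dchain r w : DBform r w -> exists2 C : R, 0 <= C &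
  forall c : dcell R n k, (dorder c <= r)%N -> `|form_eval w (dchain c)| <= C * dsize c.
Proof.
move=> Hw; pose C s : R := xget 0 [set C | bdiff r C (fun p => w p s)].
have HC s : bdiff r (C s) (fun p => w p s) by exact: (xgetPex 0 (Hw s)).
have C0 s : 0 <= C s := bdiff_ge0 (HC s).
exists (\sum_s C s) => [|c cr]; first exact: sumr_ge0.
rewrite form_eval_dchain; apply: le_trans (ler_norm_sum _ _ _) _.
rewrite mulr_suml; apply: ler_sum => s _; rewrite normrM mulrC /dsize mulrA.
by apply: ler_pM => //; exact: HC.
Qed.

Lemma DBform_Bform r w : DBform r w -> Bform r w.
Proof.
move=> /DBform_dchain[C C0 HC]; exists C => _ [c [cr c1] <-].
by have := HC c cr; rewrite c1 mulr1.
Qed.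

Lemma DBform_Bnorm r w : DBform r w -> exists2 C : R, 0 <= C &
  forall A : pchain R n k, `|form_eval w A| <= C * Bnorm r A.
Proof.
move=> /DBform_dchain[C C0 HC]; exists C => // A.
have H x : Bnorm_set r A x -> `|form_eval w A| <= C * x.
  move=> [s [sr As ->]]; rewrite As.
  have -> : \sum_(c <- s) dchain c = (fun p => \sum_(c <- s) dchain c p).
    by apply/funext => p; rewrite fct_sumE.
  rewrite form_eval_sum; last by move=> c; exact: finsupp_dchain.
  apply: le_trans (ler_norm_sum _ _ _) _; rewrite mulr_sumr.
  elim: s sr {As} => [|c s IH] /=; first by rewrite !big_nil.
  by move=> /andP[cr /IH IHs]; rewrite !big_cons lerD ?HC.
have [x0 Hx0] := Bnorm_set_neq0 r A.
have [C00|Cn0] := eqVneq C 0; first by have := H _ Hx0; rewrite C00 !mul0r.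
have Cp : 0 < C by rewrite lt_neqAle eq_sym Cn0.
rewrite mulrC -ler_pdivrMr//; apply: lb_le_inf; first by exists x0.
by move=> x /H; rewrite ler_pdivrMr// mulrC.
Qed.

Lemma pchainB_form_eval w (A B : pchain R n k) :
  form_eval w (A - B) = form_eval w A - form_eval w B.
Proof. by rewrite -form_evalB//; exact: finsupp_pchain. Qed.

Context {r : nat}.
Implicit Type J : chain R n k r.

Lemma repr_cauchy J e : 0 < e -> exists N : nat, forall i j : nat,
  (N <= i)%N -> (N <= j)%N -> Bnorm r (repr J i - repr J j) < e.
Proof. by move: e; have /asboolP := valP (repr J). Qed.

Lemma integral_cvg J w : DBform r w -> form_eval w (repr J i) @[i --> \oo] --> Defs.integral J w.
Proof.
move=> /DBform_Bnorm[C C0 HC]; apply: cauchy_cvg; apply: cauchy_exP => e e0.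
have [|N HN] := @repr_cauchy J (e / (C + 1)); first by rewrite divr_gt0// ltr_wpDl.
exists (form_eval w (repr J N)); exists N => // i /= Ni.
rewrite -ball_normE /= -pchainB_form_eval; apply: le_lt_trans (HC _) _.
have := HN N i (leqnn _) Ni; rewrite ltr_pdivlMr ?ltr_wpDl// => H.
have := Bnorm_ge0 r (repr J N - repr J i); nra.
Qed.

Lemma chain_dist_cvg (A : pchain R n k) J :
  Bnorm r (A - repr J i) @[i --> \oo] --> chain_dist A J.
Proof.
apply: cauchy_cvg; apply: cauchy_exP => e e0.
have [N HN] := repr_cauchy J e0.
exists (Bnorm r (A - repr J N)); exists N => // i /= Ni.
rewrite -ball_normE /=.
have H1 := ler_BnormD r (A - repr J i) (repr J i - repr J N).
have H2 := ler_BnormD r (A - repr J N) (repr J N - repr J i).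
rewrite !addrA !subrK in H1 H2.
exact: ltr_dist_le H1 H2 (HN i N Ni (leqnn _)) (HN N i (leqnn _) Ni).
Qed.

Lemma integral_dist J w : DBform r w -> exists2 C : R, 0 <= C &
  forall A : pchain R n k, `|form_eval w A - Defs.integral J w| <= C * chain_dist A J.
Proof.
move=> Hw; have [C C0 HC] := DBform_Bnorm Hw; exists C => // A.
have H1 : C * Bnorm r (A - repr J i) @[i --> \oo] --> C * chain_dist A J.
  by apply: cvgMl_tmp; exact: chain_dist_cvg.
have H2 : `|form_eval w A - form_eval w (repr J i)| @[i --> \oo] -->
    `|form_eval w A - Defs.integral J w|.
  by apply: cvg_norm; apply: cvgB; [exact: cvg_cst|exact: integral_cvg].
apply: ler_cvg_to H2 H1 _; near=> i; rewrite -pchainB_form_eval; exact: HC.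
Unshelve. all: by end_near.
Qed.

Lemma integral_chain_cvg J w (A : nat -> pchain R n k) : DBform r w -> chain_cvg A J ->
  form_eval w (A i) @[i --> \oo] --> Defs.integral J w.
Proof.
move=> /(integral_dist J)[C C0 HC] AJ; apply/subr_cvg0.
apply: norm_cvg0; apply: (@squeeze_cvgr _ _ _ _ (fun=> 0) (fun i => C * chain_dist (A i) J)).
- by near=> i; rewrite normr_ge0 HC.
- exact: cvg_cst.
- by rewrite -(mulr0 C); apply: cvgMl_tmp.
Unshelve. all: by end_near.
Qed.

Lemma chain_integralD J w1 w2 : DBform r w1 -> DBform r w2 ->
  Defs.integral J (fun p => w1 p + w2 p) = Defs.integral J w1 + Defs.integral J w2.
Proof.
move=> H1 H2; apply: cvg_lim => //.
under eq_fun do rewrite (form_evalDw _ _ (finsupp_pchain _)).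
by apply: cvgD; exact: integral_cvg.
Qed.

Lemma chain_integralZ J t w : DBform r w ->
  Defs.integral J (fun p => t *: w p) = t * Defs.integral J w.
Proof.
move=> H1; apply: cvg_lim => //.
under eq_fun do rewrite (form_evalZw _ _ (finsupp_pchain _)).
by apply: cvgMl_tmp; exact: integral_cvg.
Qed.

End Integral.

(** * Forms in the plane by their coefficients *)

Section PlaneForms.
Context {R : realType}.
Implicit Types (g h : 'rV[R]_2 -> R).

Definition form1 g1 g2 : Defs.form R 2 1 :=
  fun p => [ffun s => if tnth (val s) ord0 == 0 then g1 p else g2 p].
Definition form2 h : Defs.form R 2 2 := fun p => [ffun=> h p].

Definition int1 r (J : chain R 2 1 r) g1 g2 := Defs.integral J (form1 g1 g2).
Definition int2 r (K : chain R 2 2 r) h := Defs.integral K (form2 h).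

Lemma form1D g1 g2 h1 h2 : form1 (fun p => g1 p + h1 p) (fun p => g2 p + h2 p) =
  (fun p => form1 g1 g2 p + form1 h1 h2 p).
Proof. by apply/funext => p; apply/ffunP => s; rewrite !ffunE; case: ifP. Qed.

Lemma form1Z t g1 g2 : form1 (fun p => t * g1 p) (fun p => t * g2 p) =
  (fun p => t *: form1 g1 g2 p).
Proof. by apply/funext => p; apply/ffunP => s; rewrite !ffunE; case: ifP. Qed.

Lemma form2D h1 h2 : form2 (fun p => h1 p + h2 p) = (fun p => form2 h1 p + form2 h2 p).
Proof. by apply/funext => p; apply/ffunP => s; rewrite !ffunE. Qed.

Lemma form2Z t h : form2 (fun p => t * h p) = (fun p => t *: form2 h p).
Proof. by apply/funext => p; apply/ffunP => s; rewrite !ffunE. Qed.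

Lemma DBform1 r g1 g2 : DB r g1 -> DB r g2 -> DBform r (form1 g1 g2).
Proof.
move=> H1 H2 s; rewrite /form1.
under eq_fun do rewrite ffunE.
by case: (tnth _ _ == 0).
Qed.

Lemma DBform2 r h : DB r h -> DBform r (form2 h).
Proof. by move=> H s; rewrite /form2; under eq_fun do rewrite ffunE. Qed.

Section Chain1.
Context {r : nat} (J : chain R 2 1 r).

Lemma int1D g1 g2 h1 h2 : DB r g1 -> DB r g2 -> DB r h1 -> DB r h2 ->
  int1 J (fun p => g1 p + h1 p) (fun p => g2 p + h2 p) = int1 J g1 g2 + int1 J h1 h2.
Proof.
by move=> *; rewrite /int1 form1D (chain_integralD kmass1_coord)//; exact: DBform1.
Qed.

Lemma int1Z t g1 g2 : DB r g1 -> DB r g2 ->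
  int1 J (fun p => t * g1 p) (fun p => t * g2 p) = t * int1 J g1 g2.
Proof.
by move=> *; rewrite /int1 form1Z (chain_integralZ kmass1_coord)//; exact: DBform1.
Qed.

Lemma int1_cvg g1 g2 (A : nat -> pchain R 2 1) : DB r g1 -> DB r g2 -> chain_cvg A J ->
  form_eval (form1 g1 g2) (A i) @[i --> \oo] --> int1 J g1 g2.
Proof. by move=> H1 H2; exact/(integral_chain_cvg kmass1_coord)/DBform1. Qed.

End Chain1.

Section Chain2.
Context {r : nat} (K : chain R 2 2 r).

Lemma int2D h1 h2 : DB r h1 -> DB r h2 ->
  int2 K (fun p => h1 p + h2 p) = int2 K h1 + int2 K h2.
Proof.
by move=> *; rewrite /int2 form2D (chain_integralD kmass2_coord)//; exact: DBform2.
Qed.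

Lemma int2Z t h : DB r h -> int2 K (fun p => t * h p) = t * int2 K h.
Proof.
by move=> *; rewrite /int2 form2Z (chain_integralZ kmass2_coord)//; exact: DBform2.
Qed.
End Chain2.

Definition e_ (j : 'I_2) : 'rV[R]_2 := delta_mx 0 j.

Lemma extd_form1 g1 g2 (p : 'rV[R]_2) :
  extd (form1 g1 g2) p = form2 (fun q => 'D_(e_ 0) g2 q - 'D_(e_ 1) g1 q) p.
Proof.
apply/ffunP => s; rewrite !ffunE [s]kidx2E.
set E := rowsub _ _.
have PE (v : 'M[R]_(1,2)) q : pairing (form1 g1 g2 q) (wedge v) = g1 q * v 0 0 + g2 q * v 0 1.
  by rewrite /pairing sum_kidx1 !wedge1E !ffunE.
have ER i j : E i j = (i == j)%:R.
  rewrite mxE mxE; congr (_%:R); congr nat_of_bool; apply/eqP/eqP => [<-|->].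
    by rewrite (tnth_nth ord0); case: i => [[|[|//]]] pi; exact/val_inj.
  by rewrite (tnth_nth ord0); case: j => [[|[|//]]] pi; exact/val_inj.
have RE j : row j E = e_ j.
  by apply/rowP => i; rewrite [LHS]mxE ER mxE eqxx /= eq_sym.
have rE i j : row' i E 0 j = (lift i 0 == j)%:R by rewrite mxE ER.
have W0 : (fun q => pairing (form1 g1 g2 q) (wedge (row' ord0 E))) = g2.
  apply/funext => q; rewrite PE !rE.
  by rewrite -!val_eqE /= mulr0 add0r mulr1.
have W1 : (fun q => pairing (form1 g1 g2 q) (wedge (row' 1 E))) = g1.
  apply/funext => q; rewrite PE !rE.
  by rewrite -!val_eqE /= mulr0 addr0 mulr1.
rewrite /= !big_ord_recl big_ord0 addr0 !RE expr0 mul1r.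
have -> : lift ord0 ord0 = 1 :> 'I_2 by exact/val_inj.
rewrite W0 W1; congr (_ + _); exact: mulN1r.
Qed.

(** (g1 + i g2)(dx + i dy) has real part g1 dx - g2 dy and imaginary part g2 dx + g1 dy. *)
Lemma form_dzE (g1 g2 : 'rV[R]_2 -> R) r (J : chain R 2 1 r) :
  cintegral J (form_dz (fun p => g1 p +i* g2 p)%C) =
  (int1 J g1 (fun p => - g2 p) +i* int1 J g2 g1)%C.
Proof.
congr (_ +i* _)%C; congr Defs.integral; apply/funext => p; apply/ffunP => s; rewrite !ffunE /toC !mxE !eqxx /=.
  case: (tnth _ _) => [[|[|//]]] ps /=; ring.
case: (tnth _ _) => [[|[|//]]] ps /=; ring.
Qed.
End PlaneForms.

(** * Smooth functions with compact support *)

Section FlatFunction.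
Context {R : realType}.
Implicit Types (t : R) (k : nat).

(** The exponent [k] makes the family stable under derivation, see [is_derive_flat]; the case
    [k = 0] is the usual flat function. *)
Definition flat k t : R := if 0 < t then t^-1 ^+ k * expR (- t^-1) else 0.

Lemma flat_ge0 k t : 0 <= flat k t.
Proof.
by rewrite /flat; case: ifP => // t0; rewrite mulr_ge0 ?expR_ge0// exprn_ge0// invr_ge0 ltW.
Qed.

Lemma flat_gt0 k t : 0 < t -> 0 < flat k t.
Proof.
by rewrite /flat => t0; rewrite t0 mulr_gt0 ?expR_gt0// exprn_gt0// invr_gt0.
Qed.

Lemma flat_le0 k t : t <= 0 -> flat k t = 0.
Proof. by rewrite /flat => t0; rewrite ltNge t0. Qed.

(** From e^x >= x^(k+2)/(k+2)! at x = 1/t. The quadratic decay gives the derivative 0 at the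
    origin. *)
Lemma flat_le_sqr k t : `|flat k t| <= k.+2`!%:R * t ^+ 2.
Proof.
rewrite ger0_norm ?flat_ge0//; have [t0|t0] := ltP 0 t; last first.
  by rewrite flat_le0// mulr_ge0// sqr_ge0.
have H : t^-1 ^+ k.+2 <= k.+2`!%:R * expR t^-1.
  rewrite mulrC -ler_pdivrMr ?ltr0n ?fact_gt0//.
  apply: le_trans (expR_ge1Dxn k.+1 _); first by rewrite lerDr.
  by rewrite invr_ge0 ltW.
rewrite /flat t0 expRN ler_pdivrMr ?expR_gt0//.
rewrite mulrAC -ler_pdivrMr ?exprn_gt0//; apply: le_trans H.
by rewrite le_eqVlt -exprVn -exprD addn2 eqxx.
Qed.

Lemma is_derive_flat k t :
  is_derive t 1 (flat k) (- k%:R * flat k.+1 t + flat k.+2 t).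
Proof.
have [t0|t0|<-] := ltgtP 0 t.
- have tn0 : t != 0 by rewrite gt_eqF.
  apply: (@near_eq_is_derive R R^o R^o (fun s => s^-1 ^+ k * expR (- s^-1))).
    by near=> s; rewrite /flat ifT//; near: s; exact: lt_nbhsr.
  have dV : is_derive t 1 (fun s : R => s^-1) (- t ^- 2).
    by apply: is_derive_eq; [exact: (is_deriveV (f := id))|rewrite [_ *: _]mulr1].
  have dX : is_derive t 1 (fun s : R => s^-1 ^+ k) (k%:R * t^-1 ^+ k.-1 * (- t ^- 2)).
    have := @is_deriveX _ _ (fun s : R => s^-1) k t 1 _ dV.
    by rewrite exprfctE.
  have dE : is_derive t 1 (fun s : R => expR (- s^-1)) (expR (- t^-1) * t ^- 2).
    apply: (@is_derive_eq _ _ _ _ _ _ _ _ (is_derive1_comp _ (is_deriveN dV))).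
    by rewrite opprK.
  apply: (@is_derive_eq _ _ _ _ _ _ _ _ (is_deriveM dX dE)).
  rewrite /flat t0 /GRing.scale /=.
  rewrite -exprVn; move: (t^-1) (expR _) => s e.
  by case: k {dX} => [|k] /=; rewrite ?exprS; ring.
- rewrite !flat_le0 ?ltW// mulr0 addr0.
  apply: (@near_eq_is_derive R R^o R^o (fun=> 0)).
  by near=> s; rewrite flat_le0// ltW//; near: s; exact: lt_nbhsl.
- rewrite !flat_le0 // mulr0 addr0.
  suff C : (fun h : R => h^-1 *: ((flat k \o shift 0) (h *: 1) - flat k 0)) @ 0^' --> (0 : R).
    by apply: DeriveDef; [apply/cvg_ex; exists 0|rewrite /derive; apply: cvg_lim].
  apply: norm_cvg0; apply: (@squeeze_cvgr _ _ _ _ (fun=> 0) (fun h : R => k.+2`!%:R * `|h|)).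
  + near=> h; rewrite normr_ge0 /= addr0 [h *: 1]mulr1 (@flat_le0 k 0)// subr0.
    have h0 : h != 0 by near: h; exact: nbhs_dnbhs_neq.
    rewrite normrM normfV mulrC ler_pdivrMr ?normr_gt0// -mulrA -expr2 real_normK ?num_real//.
    exact: flat_le_sqr.
  + exact: cvg_cst.
  + have H : `|h| @[h --> (0 : R)^'] --> (0 : R).
      rewrite -[X in _ --> X](@normr0 _ R); apply: cvg_norm; exact: nbhs_dnbhs.
    by rewrite -[X in _ --> X](mulr0 k.+2`!%:R); apply: cvgMl_tmp.
Unshelve. all: by end_near.
Qed.
End FlatFunction.

Section SmoothClass.
Context {R : realType} {n : nat}.
Implicit Types (f g : 'rV[R]_n -> R).

(** A syntactic class stable under derivation: smoothness becomes an induction on the list of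
    directions, without any calculus of iterated derivatives. *)
Inductive SM : ('rV[R]_n -> R) -> Prop :=
| SM_cst c : SM (fun=> c)
| SM_coord i : SM (fun p => p 0 i)
| SM_add f g : SM f -> SM g -> SM (fun p => f p + g p)
| SM_mul f g : SM f -> SM g -> SM (fun p => f p * g p)
| SM_flat k f : SM f -> SM (fun p => flat k (f p))
| SM_inv f : SM f -> (forall p, f p != 0) -> SM (fun p => (f p)^-1).

Lemma SM_opp f : SM f -> SM (fun p => - f p).
Proof.
move=> /(SM_mul (SM_cst (-1))); congr SM; apply/funext => p; exact: mulN1r.
Qed.

Lemma SM_sub f g : SM f -> SM g -> SM (fun p => f p - g p).
Proof. by move=> Hf /SM_opp; exact: SM_add. Qed.

Lemma SM_derive f : SM f -> (forall p, differentiable f p) /\ forall v, SM ('D_v f).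
Proof.
suff H : SM f -> (forall p, differentiable f p) /\
    exists2 D : 'rV[R]_n -> 'rV[R]_n -> R, forall v, SM (D v) & forall v p, 'D_v f p = D v p.
  move=> /H[df [D HD fD]]; split=> // v.
  by rewrite (_ : 'D_v f = D v)//; apply/funext => p.
elim=> {f} [c|i|f g _ [df [Df HDf fD]] _ [dg [Dg HDg gD]]|f g Sf [df [Df HDf fD]] Sg [dg [Dg HDg gD]]|
   k f Sf [df [Df HDf fD]]|f Sf [df [Df HDf fD]] f0].
- split=> [p|]; first exact: differentiable_cst.
  exists (fun _ _ => 0) => [v|v p]; first exact: SM_cst.
  exact: derive_cst.
- split=> [p|]; first exact: differentiable_coord.
  exists (fun v _ => v 0 i) => [v|v p]; first exact: SM_cst.
  rewrite /derive; apply: cvg_lim => //; apply: cvg_near_cst; near=> h.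
  have h0 : h != 0 by near: h; exact: nbhs_dnbhs_neq.
  by rewrite /= !mxE addrK /GRing.scale /= mulrA mulVf// mul1r.
- split=> [p|]; first exact: differentiableD.
  exists (fun v p => Df v p + Dg v p) => [v|v p]; first exact: SM_add.
  by rewrite -fD -gD -deriveD//; exact: diff_derivable.
- split=> [p|]; first exact: differentiableM.
  exists (fun v p => f p * Dg v p + g p * Df v p) => [v|v p].
    by apply: SM_add; exact: SM_mul.
  by rewrite -fD -gD -deriveM//; exact: diff_derivable.
- have dfl (t : R) : differentiable (flat k) t.
    by apply/derivable1_diffP; have [] := is_derive_flat k t.
  split=> [p|]; first exact: differentiable_comp.
  exists (fun v p => (- k%:R * flat k.+1 (f p) + flat k.+2 (f p)) * Df v p) => [v|v p].
    apply: SM_mul => //; apply: SM_add; last exact: SM_flat.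
    by apply: SM_mul; [exact: SM_cst|exact: SM_flat].
  rewrite deriveE; last exact: differentiable_comp.
  rewrite diff_comp//= diff1E// -deriveE// fD derive1E.
  by have [_ ->] := is_derive_flat k (f p); rewrite /GRing.scale /= mulrC.
- split=> [p|]; first exact: differentiableV.
  exists (fun v p => - ((f p)^-1 * (f p)^-1) * Df v p) => [v|v p].
    apply: SM_mul => //; apply: SM_opp; apply: SM_mul; exact: SM_inv.
  rewrite deriveV//; last exact: diff_derivable.
  by rewrite fD /GRing.scale /= -exprVn expr2.
Unshelve. all: by end_near.
Qed.

Lemma SM_smooth f : SM f -> smooth f.
Proof.
move=> Sf vs p; have : SM (foldr (fun v g => 'D_v g) f vs).
  by elim: vs => //= v vs /SM_derive[].
by move=> /SM_derive[].
Qed.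

Lemma SM_sum (I : Type) (r : seq I) (F : I -> 'rV[R]_n -> R) :
  (forall i, SM (F i)) -> SM (fun p => \sum_(i <- r) F i p).
Proof.
move=> HF; elim: r => [|i r IH]; first by under eq_fun do rewrite big_nil; exact: SM_cst.
by under eq_fun do rewrite big_cons; exact: SM_add.
Qed.

Lemma SM_prod (I : Type) (r : seq I) (F : I -> 'rV[R]_n -> R) :
  (forall i, SM (F i)) -> SM (fun p => \prod_(i <- r) F i p).
Proof.
move=> HF; elim: r => [|i r IH]; first by under eq_fun do rewrite big_nil; exact: SM_cst.
by under eq_fun do rewrite big_cons; exact: SM_mul.
Qed.

(* Kept polynomial so that it is smooth everywhere. *)
Definition sqdist (a p : 'rV[R]_n) : R := \sum_i (p 0 i - a 0 i) ^+ 2.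

Lemma SM_sqdist a : SM (sqdist a).
Proof.
apply: SM_sum => i; under eq_fun do rewrite expr2.
by apply: SM_mul; apply: SM_sub; (exact: SM_coord || exact: SM_cst).
Qed.

Lemma sqdistE a p : sqdist a p = enorm (p - a) ^+ 2.
Proof.
rewrite sqr_sqrtr; last by apply: sumr_ge0 => i _; exact: sqr_ge0.
by apply: eq_bigr => i _; rewrite !mxE.
Qed.

(** A smooth step from 1 on the disc of radius r/2 to 0 off the disc of radius r. The two terms of
    the denominator never vanish together because r/2 < r. *)
Definition bumpf (a : 'rV[R]_n) (r : R) (p : 'rV[R]_n) : R :=
  flat 0 (r ^+ 2 - sqdist a p) / (flat 0 (r ^+ 2 - sqdist a p) + flat 0 (sqdist a p - (r / 2) ^+ 2)).

Lemma bump_den a (r : R) p : 0 < r ->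
  0 < flat 0 (r ^+ 2 - sqdist a p) + flat 0 (sqdist a p - (r / 2) ^+ 2).
Proof.
move=> r0; have [lt|ge] := ltP (sqdist a p) (r ^+ 2).
  by rewrite ltr_pwDl ?flat_ge0// flat_gt0// subr_gt0.
rewrite ltr_wpDl ?flat_ge0// flat_gt0// subr_gt0 (lt_le_trans _ ge)//.
nra.
Qed.

Lemma SM_bump a (r : R) : 0 < r -> SM (bumpf a r).
Proof.
move=> r0; have S1 : SM (fun p => flat 0 (r ^+ 2 - sqdist a p)).
  by apply: SM_flat; apply: SM_sub; [exact: SM_cst|exact: SM_sqdist].
apply: SM_mul => //; apply: SM_inv => [|p]; last by rewrite gt_eqF ?bump_den.
apply: SM_add => //.
by apply: SM_flat; apply: SM_sub; [exact: SM_sqdist|exact: SM_cst].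
Qed.

Lemma bump1 a (r : R) p : 0 < r -> enorm (p - a) <= r / 2 -> bumpf a r p = 1.
Proof.
move=> r0 pr; rewrite /bumpf (@flat_le0 _ _ (_ - (r / 2) ^+ 2)) ?addr0; last first.
  by rewrite subr_le0 sqdistE ler_sqr ?nnegrE ?enorm_ge0// ltW// divr_gt0.
rewrite divff// gt_eqF// flat_gt0// subr_gt0 sqdistE ltr_sqr ?nnegrE ?enorm_ge0 ?(ltW r0)//.
by apply: le_lt_trans pr _; rewrite ltr_pdivrMr// ltr_pMr// ltr1n.
Qed.

Lemma bump0 a (r : R) p : 0 < r -> r <= enorm (p - a) -> bumpf a r p = 0.
Proof.
move=> r0 pr; rewrite /bumpf (@flat_le0 _ _ (r ^+ 2 - _)) ?mul0r//.
by rewrite subr_le0 sqdistE ler_sqr ?nnegrE ?enorm_ge0 ?(ltW r0).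
Qed.

Lemma bump_ge0 a (r : R) p : 0 < r -> 0 <= bumpf a r p.
Proof. by move=> r0; rewrite divr_ge0 ?flat_ge0// ltW// bump_den. Qed.

End SmoothClass.

Section SmoothDB.
Context {R : realType} {n : nat}.
Implicit Types (f g : 'rV[R]_n -> R).

Definition bsupp f := exists M : R, forall p, M < `|p| -> f p = 0.

Lemma cont_bsupp_bounded f : continuous f -> bsupp f -> exists M : R, forall p, `|f p| <= M.
Proof.
move=> cf [M fM].
have cK : compact [set p : 'rV[R]_n | `|p| <= M].
  apply: bounded_closed_compact; first by exists M; split; [exact: num_real|move=> x Mx p /= /le_trans; apply; exact: ltW].
  by apply: (@preimage_closed _ _ _ [set x : R | x <= M]); [move=> p _; exact: norm_continuous|exact: closed_le].
have /compact_bounded[N [_ HN]] : compact (f @` [set p : 'rV[R]_n | `|p| <= M]).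
  by apply: continuous_compact => //; exact: continuous_subspaceT.
exists (Num.max (N + 1) 0) => p; rewrite le_max.
have [pM|Mp] := leP `|p| M; last by rewrite fM// normr0 lexx orbT.
by rewrite (HN (N + 1)) ?ltrDl//; exists p.
Qed.

Lemma derive_bsupp f v : bsupp f -> bsupp ('D_v f).
Proof.
move=> [M fM]; exists M => p Mp.
rewrite -(@derive_cst R _ R^o 0 p v); apply: near_eq_derive.
near=> q; apply: fM; near: q.
have : open [set q : 'rV[R]_n | M < `|q|].
  by apply: (@open_comp _ _ _ [set x : R | M < x]); [move=> q _; exact: norm_continuous|exact: open_gt].
by rewrite openE => /(_ p Mp).
Unshelve. all: by end_near.
Qed.

Lemma derive_coords f u p : differentiable f p ->
  'D_u f p = \sum_i u 0 i * 'D_(delta_mx 0 i) f p.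
Proof.
move=> df; rewrite deriveE// {1}[u]row_sum_delta linear_sum.
by apply: eq_bigr => i _; rewrite linearZ /= deriveE.
Qed.

Lemma DB_grad_coords N f : (exists M, forall p, `|f p| <= M) -> (forall p, differentiable f p) ->
  (forall i, DB N ('D_(delta_mx 0 i) f)) -> DB N.+1 f.
Proof.
move=> [M fM] df HD; pose C i : R := xget 0 [set C | bdiff N C ('D_(delta_mx 0 i) f)].
have HC i : bdiff N (C i) ('D_(delta_mx 0 i) f) by exact: (xgetPex 0 (HD i)).
apply: (@DB_grad _ _ N (\sum_i C i) M) => // [p u|u us p sus]; first exact: diff_derivable.
have -> : 'D_u f = (fun q => \sum_i u 0 i * 'D_(delta_mx 0 i) f q).
  by apply/funext => q; exact: derive_coords.
have -> : fdiffs us (fun q => \sum_i u 0 i * 'D_(delta_mx 0 i) f q) p =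
    \sum_i u 0 i * fdiffs us ('D_(delta_mx 0 i) f) p.
  elim: us p {sus} => [//|v us IH] p /=.
  rewrite /fdiff !IH -sumrB; apply: eq_bigr => i _; by rewrite mulrBr.
apply: le_trans (ler_norm_sum _ _ _) _; rewrite -mulrA mulr_suml.
apply: ler_sum => i _; rewrite normrM mulrCA ler_pM ?coord_le_enorm//.
exact: HC.
Qed.

Lemma smooth_derive f v : smooth f -> smooth ('D_v f).
Proof.
move=> sf vs p; have := sf (rcons vs v) p.
by rewrite -cats1 foldr_cat.
Qed.

Lemma smooth_diff f : smooth f -> forall p, differentiable f p.
Proof. by move=> sf p; exact: (sf [::] p). Qed.

Lemma smooth_cont f : smooth f -> continuous f.
Proof. by move=> sf p; apply: differentiable_continuous; exact: smooth_diff. Qed.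

(** Derivatives keep the bounded support, so boundedness of continuous functions on compact sets can
    be iterated. *)
Lemma smooth_DB N f : smooth f -> bsupp f -> DB N f.
Proof.
elim: N f => [|N IH] f sf bf; have [M fM] := cont_bsupp_bounded (smooth_cont sf) bf.
  by exists M; exact: bdiff0.
apply: DB_grad_coords => [|p|i]; first by exists M.
  exact: smooth_diff.
by apply: IH; [exact: smooth_derive|exact: derive_bsupp].
Qed.
End SmoothDB.

(** * Partitions of unity and cutoff functions *)

Section Localization.
Context {R : realType} {n : nat}.
Implicit Types (f g : 'rV[R]_n -> R) (p q : 'rV[R]_n).

Lemma norm_le_enorm (u : 'rV[R]_n) : `|u| <= enorm u.
Proof.
rewrite /Num.norm /= mx_normrE; apply: bigmax_le; first exact: enorm_ge0.
by move=> [i j] _ /=; rewrite (ord1 i) coord_le_enorm.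
Qed.

Lemma open_enorm p (r : R) : open [set q | enorm (q - p) < r].
Proof.
have [r0|r0] := leP r 0.
  rewrite (_ : [set _ | _] = set0); first exact: open0.
  by apply/seteqP; split=> // q /= /lt_le_trans/(_ r0); rewrite ltNge enorm_ge0.
rewrite (_ : [set _ | _] = sqdist p @^-1` [set t | t < r ^+ 2]).
  apply: open_comp; last exact: open_lt.
  by move=> q _; apply: smooth_cont; apply: SM_smooth; exact: SM_sqdist.
by apply/seteqP; split=> q /=; rewrite sqdistE ltr_sqr ?nnegrE ?enorm_ge0 ?(ltW r0).
Qed.

Lemma near_enorm p (r : R) : 0 < r -> \forall q \near p, enorm (q - p) < r.
Proof.
move=> r0; have := @open_enorm p r; rewrite openE; apply.
by rewrite /= subrr enorm0.
Qed.

Lemma open_ball_enorm (V : set 'rV[R]_n) p : open V -> V p ->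
  exists2 r : R, 0 < r & forall q, enorm (q - p) <= r -> V q.
Proof.
rewrite openE => /(_ p) + Vp => /(_ Vp) /nbhs_ballP[e /= e0 HV].
exists (e / 2); first by rewrite divr_gt0.
move=> q qp; apply: HV; rewrite -ball_normE /= distrC (le_lt_trans (norm_le_enorm _))//.
by apply: le_lt_trans qp _; rewrite ltr_pdivrMr// ltr_pMr// ltr1n.
Qed.

(** [1 - cobump s] equals 1 where some bump equals 1 and vanishes where all bumps do. *)
Definition cobump (s : seq ('rV[R]_n * R)) (q : 'rV[R]_n) : R :=
  \prod_(x <- s) (1 - bumpf x.1 x.2 q).

Lemma SM_cobump s : all (fun x => 0 < x.2) s -> SM (cobump s).
Proof.
elim: s => [_|x s IH /= /andP[x0 s0]]; rewrite /cobump.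
  by under eq_fun do rewrite big_nil; exact: SM_cst.
under eq_fun do rewrite big_cons.
by apply: SM_mul; [apply: SM_sub; [exact: SM_cst|exact: SM_bump]|exact: IH].
Qed.

Lemma finite_bump_cover (C : set 'rV[R]_n) (Q : 'rV[R]_n -> R -> Prop) : compact C ->
  (forall p, C p -> exists2 r, 0 < r & Q p r) ->
  exists s : seq ('rV[R]_n * R), [/\ all (fun x => 0 < x.2) s,
    forall x, x \in s -> Q x.1 x.2 &
    forall q, C q -> exists2 x, x \in s & enorm (q - x.1) < x.2 / 2].
Proof.
move=> cC HQ; pose rr p : R := xget 1 [set r | 0 < r /\ Q p r].
have rrP p : C p -> 0 < rr p /\ Q p (rr p).
  move=> /HQ[r r0 Qr]; rewrite /rr; have : [set r | 0 < r /\ Q p r] r by [].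
  by move=> H; exact: (xgetPex 1 (ex_intro _ r H)).
move: cC; rewrite compact_cover => /(_ _ C (fun p => [set q | enorm (q - p) < rr p / 2])).
case=> [p _|q Cq|D' D'C D'cov]; first exact: open_enorm.
  by exists q => //=; rewrite subrr enorm0 divr_gt0//; case: (rrP q Cq).
exists [seq (p, rr p) | p <- finmap.enum_fset D']; split.
- by rewrite all_map; apply/allP => p /= /D'C; rewrite inE => /rrP[].
- by move=> x /mapP[p /D'C + ->]; rewrite inE => /rrP[].
- move=> q /D'cov[p /= pD' qp]; exists (p, rr p) => //.
  by apply/mapP; exists p.
Qed.

(** Telescoping partition of unity: 1 - prod (1 - b_i) is a sum of terms b_i times a product of
    other factors (1 - b_j). Such a product is the smooth [eta] over which the local hypothesis
    quantifies. *)
Lemma localize (C : set 'rV[R]_n) (P : ('rV[R]_n -> R) -> Prop) g : compact C ->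
  P (fun=> 0) -> (forall g h, P g -> P h -> P (fun q => g q + h q)) ->
  (forall q, ~ C q -> g q = 0) ->
  (forall p, C p -> exists2 r, 0 < r &
     forall eta, SM eta -> P (fun q => eta q * bumpf p r q * g q)) ->
  P g.
Proof.
move=> cC P0 PD gC HP; have [s [s0 sP sC]] := finite_bump_cover cC HP.
have -> : g = (fun q => (1 - cobump s q) * g q).
  apply/funext => q; have [Cq|/gC ->] := pselect (C q); last by rewrite mulr0.
  have [x xs xq] := sC q Cq.
  rewrite /cobump (big_rem x)//= bump1 ?subrr ?mul0r ?subr0 ?mul1r//; last exact: ltW.
  by move/allP : s0; apply.
elim: s s0 sP {sC} => [_ _|x s IH /= /andP[x0 s0] sP].
  by rewrite /cobump; under eq_fun do rewrite big_nil subrr mul0r.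
have -> : (fun q => (1 - cobump (x :: s) q) * g q) = (fun q => (1 - cobump s q) * g q +
    cobump s q * bumpf x.1 x.2 q * g q).
  by apply/funext => q; rewrite /cobump big_cons; ring.
apply: PD; last by apply: (sP x); [rewrite mem_head|exact: SM_cobump].
by apply: IH => // y ys; apply: sP; rewrite inE ys orbT.
Qed.

Lemma bsupp_ball f p (r : R) : (forall q, r < enorm (q - p) -> f q = 0) -> bsupp f.
Proof.
move=> H; exists (`|p| + r) => q Hq; apply: H; apply: lt_le_trans (norm_le_enorm _).
have := ler_normD (q - p) p; rewrite subrK; lra.
Qed.

Lemma bsuppM f g : bsupp f -> bsupp (fun q => g q * f q).
Proof. by move=> [M HM]; exists M => p /HM ->; rewrite mulr0. Qed.

Lemma bsupp_bump p (r : R) : 0 < r -> bsupp (bumpf p r).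
Proof. by move=> r0; apply: (@bsupp_ball _ p r) => q /ltW; exact: bump0. Qed.

Lemma DB_SM_bump N eta p (r : R) : SM eta -> 0 < r -> DB N (fun q => eta q * bumpf p r q).
Proof.
move=> Se r0; apply: smooth_DB; last exact/bsuppM/bsupp_bump.
by apply: SM_smooth; apply: SM_mul => //; exact: SM_bump.
Qed.

Lemma closure_sub (A B : set 'rV[R]_n) : closed B -> A `<=` B -> closure A `<=` B.
Proof. by move=> cB AB; rewrite closureE => q /(_ B); apply; split. Qed.

Lemma SM_cutoff (S V : set 'rV[R]_n) : compact S -> open V -> S `<=` V ->
  exists chi : 'rV[R]_n -> R, [/\ SM chi, compact (closure [set p | chi p != 0]),
    closure [set p | chi p != 0] `<=` V &
    exists O : set 'rV[R]_n, [/\ open O, S `<=` O & forall p, O p -> chi p = 1]].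
Proof.
move=> cS oV SV.
have [p Sp|s [s0 sP sC]] := @finite_bump_cover S (fun p r => forall q, enorm (q - p) <= r -> V q) cS.
  by have [r r0 Hr] := open_ball_enorm oV (SV p Sp); exists r.
pose F : set 'rV[R]_n := [set q | exists2 x, x \in s & enorm (q - x.1) <= x.2].
(* A finite union of closed discs as the zero set of a smooth function, which gives closedness. *)
have FE : F = (fun q => \prod_(x <- s) flat 0 (sqdist x.1 q - x.2 ^+ 2)) @^-1` [set 0].
  apply/seteqP; split=> q /=.
    move=> [x xs qx]; rewrite (big_rem x)//= flat_le0 ?mul0r//.
    have x0 : 0 < x.2 by move/allP : s0; apply.
    by rewrite subr_le0 sqdistE ler_sqr ?nnegrE ?enorm_ge0 ?(ltW x0).
  move=> /eqP; rewrite prodf_seq_eq0 => /hasP[x xs /= fx]; exists x => //.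
  have x0 : 0 < x.2 by move/allP : s0; apply.
  rewrite leNgt; apply/negP => lt; move: fx; rewrite gt_eqF// flat_gt0//.
  by rewrite subr_gt0 sqdistE ltr_sqr ?nnegrE ?enorm_ge0 ?(ltW x0).
have cF : closed F.
  rewrite FE; apply: preimage_closed; last exact: closed_eq.
  move=> q _; apply: smooth_cont; apply: SM_smooth; apply: SM_prod => x.
  by apply: SM_flat; apply: SM_sub; [exact: SM_sqdist|exact: SM_cst].
have HF : [set p | 1 - cobump s p != 0] `<=` F.
  move=> q /= H; apply: contrapT => nF; move/eqP : H; apply.
  rewrite /cobump big1_seq ?subrr// => x /andP[_ xs].
  rewrite bump0 ?subr0//; first by move/allP : s0; apply.
  by rewrite leNgt; apply/negP => /ltW lt; apply: nF; exists x.
have HcF := closure_sub cF HF.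
exists (fun q => 1 - cobump s q); split.
- by apply: SM_sub; [exact: SM_cst|exact: SM_cobump].
- apply: bounded_closed_compact; last exact: closed_closure.
  suff [M HM] : exists M : R, forall q, F q -> `|q| <= M.
    exists M; split; first exact: num_real.
    by move=> x Mx q /HcF /HM /le_trans; apply; exact: ltW.
  exists (\sum_(x <- s) (`|x.1| + `|x.2|)) => q [x xs qx].
  rewrite (big_rem x)//=; apply: (@le_trans _ _ (`|x.1| + `|x.2|)); last first.
    by rewrite lerDl sumr_ge0// => y _; rewrite addr_ge0.
  have H1 := ler_normD (q - x.1) x.1; rewrite subrK in H1.
  apply: le_trans H1 _; rewrite addrC lerD2l.
  by rewrite (le_trans (norm_le_enorm _))// (le_trans qx)// ler_norm.
- by move=> q /HcF [x xs]; exact: sP.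
- exists [set q | exists2 x, x \in s & enorm (q - x.1) < x.2 / 2]; split.
  + rewrite (_ : [set _ | _] = \bigcup_(x in [set` s]) [set q | enorm (q - x.1) < x.2 / 2]).
      by apply: bigcup_open => x _; exact: open_enorm.
    by apply/seteqP; split=> q /= [x xs qx]; exists x.
  + by move=> q /sC.
  + move=> q [x xs qx]; rewrite /cobump (big_rem x)//= bump1 ?subrr ?mul0r ?subr0//.
      by move/allP : s0; apply.
    exact: ltW.
Qed.

Lemma compact_bsupp f : compact (closure [set p | f p != 0]) -> bsupp f.
Proof.
move=> /compact_bounded[M [_ HM]]; exists (M + 1) => p Hp; apply: contrapT => /eqP fp.
have : `|p| <= M + 1 by apply: (HM (M + 1)); [rewrite ltrDl|exact: subset_closure].
by rewrite leNgt Hp.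
Qed.

End Localization.

(** * Integrals in one variable *)

Section Antiderivative.
Context {R : realType}.
Implicit Types (g h G : R -> R) (a b x : R).

Lemma is_derive_unique_diff g G H (a b : R) :
  (forall x, Num.min a b <= x <= Num.max a b -> is_derive x 1 G (g x)) ->
  (forall x, Num.min a b <= x <= Num.max a b -> is_derive x 1 H (g x)) ->
  G b - G a = H b - H a.
Proof.
move=> HG HH.
wlog ab : a b HG HH / a <= b => [W|].
  have [|/ltW ba] := leP a b; first exact: W.
  apply: oppr_inj; rewrite !opprB; apply: W => // x.
  - by rewrite minC maxC; exact: HG.
  - by rewrite minC maxC; exact: HH.
have D x : a <= x <= b -> is_derive x 1 (G - H) 0.
  move=> xab; rewrite -(subrr (g x)); apply: is_deriveB.
    by apply: HG; rewrite min_l// max_r.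
  by apply: HH; rewrite min_l// max_r.
have [x||c _] := @MVT_segment R (G - H) (fun=> 0) a b ab.
- by rewrite in_itv/= => /andP[xa xb]; apply: D; rewrite !ltW.
- apply: derivable_within_continuous => x; rewrite in_itv/= => /D[]//.
rewrite mul0r => /eqP; rewrite subr_eq0 => /eqP E.
have : (G - H) b = (G - H) a by [].
rewrite -![(G - H) _]/(G _ - H _) => E'; lra.
Qed.

Lemma continuous_integrable g a b : continuous g ->
  (@lebesgue_measure R).-integrable `[a, b] (EFin \o g).
Proof.
move=> cg; apply: continuous_compact_integrable; first exact: segment_compact.
exact: continuous_subspaceT.
Qed.

Lemma antiderivative_exists g : continuous g ->
  exists G, (forall x, is_derive x 1 G (g x)) /\ G 0 = 0.
Proof.
move=> cg; pose F a x := (\int[@lebesgue_measure R]_(t in `[a, x]) g t)%R.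
have HF a x : a < x -> is_derive x 1 (F a) (g x).
  move=> ax; have x1 : x < x + 1 by rewrite ltrDl.
  have [D E] := continuous_FTC1_closed x1 (continuous_integrable a (x + 1) cg) ax (cg x).
  by rewrite -E derive1E; exact: derivableP.
have HFF a a' x : a < Num.min x 0 -> a' < Num.min x 0 -> F a x - F a 0 = F a' x - F a' 0.
  move=> ax ax'; apply: (@is_derive_unique_diff g) => y /andP[+ _]; rewrite minC => yx; apply: HF.
    exact: lt_le_trans ax yx.
  exact: lt_le_trans ax' yx.
(* The base point lies to the left of both x and 0, whatever the sign of x; near a given x it may be
   replaced by the fixed [a] below. *)
pose G x := F (- `|x| - 1) x - F (- `|x| - 1) 0.
exists G; split=> [x|]; last by rewrite /G subrr.
have GE y a : a < Num.min y 0 -> G y = F a y - F a 0.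
  move=> ay; apply: HFF => //; rewrite lt_min.
  have := ler_norm (- y); rewrite normrN; have := normr_ge0 y; lra.
pose a := - `|x| - 2.
apply: (@near_eq_is_derive R R^o R^o (fun y => F a y - F a 0)); last first.
  rewrite -[g x]subr0; apply: is_deriveB; apply: HF; rewrite /a.
  have := ler_norm (- x); rewrite normrN; have := normr_ge0 x; lra.
near=> y; rewrite (GE _ a)// lt_min /a.
have : `|x - y| < 1 by near: y; exact: nbhsx_ballx.
rewrite ltr_norml; have := ler_norm (- x); rewrite normrN; have := normr_ge0 x; lra.
Unshelve. all: by end_near.
Qed.

Definition prim g : R -> R := xget (fun=> 0) [set G | (forall x, is_derive x 1 G (g x)) /\ G 0 = 0].

(** Oriented integral as the increment of a primitive: additivity in the bounds is immediate and no
    order between them is asked. [lebesgue_itg] relates it to the Lebesgue integral. *)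
Definition itg g a b : R := prim g b - prim g a.

Lemma is_derive_prim g x : continuous g -> is_derive x 1 (prim g) (g x).
Proof. by move=> /antiderivative_exists/(xgetPex (fun=> 0))[]. Qed.

Lemma itgE g G a b : continuous g -> (forall x, is_derive x 1 G (g x)) -> itg g a b = G b - G a.
Proof. by move=> cg dG; apply: (@is_derive_unique_diff g) => x _ //; exact: is_derive_prim. Qed.

Lemma itg_cst c a b : itg (fun=> c) a b = c * (b - a).
Proof.
have cc : continuous (fun _ : R => c) by move=> x; exact: cvg_cst.
have dc x : is_derive x 1 (fun x => c * x) c.
  have := @is_deriveZ R R^o R^o id c x 1 1 (is_derive_id _ _).
  by rewrite [c *: 1]mulr1.
by rewrite (itgE _ _ cc dc) mulrBr.
Qed.

Lemma itgD g h a b : continuous g -> continuous h ->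
  itg (fun x => g x + h x) a b = itg g a b + itg h a b.
Proof.
move=> cg ch; have cc : continuous (fun x => g x + h x).
  by move=> x; apply: cvgD; [exact: cg|exact: ch].
have dc x : is_derive x 1 (fun x => prim g x + prim h x) (g x + h x).
  by apply: is_deriveD; exact: is_derive_prim.
by rewrite (itgE _ _ cc dc) /itg; ring.
Qed.

Lemma itgZ c g a b : continuous g -> itg (fun x => c * g x) a b = c * itg g a b.
Proof.
move=> cg; have cc : continuous (fun x => c * g x).
  by move=> x; apply: cvgMl_tmp; exact: cg.
have dc x : is_derive x 1 (fun x => c * prim g x) (c * g x).
  exact: (@is_deriveZ R R^o R^o (prim g) c x 1 _ (is_derive_prim x cg)).
by rewrite (itgE _ _ cc dc) /itg; ring.
Qed.

Lemma itg_mvt g a b : continuous g -> a <= b ->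
  exists2 x, a <= x <= b & itg g a b = g x * (b - a).
Proof.
move=> cg ab; have [x||c] := @MVT_segment R (prim g) g a b ab.
- by move=> _; exact: is_derive_prim.
- by apply: derivable_within_continuous => x _; have [] := is_derive_prim x cg.
by rewrite in_itv/= => cab E; exists c.
Qed.

Lemma itg_bound g a b M : continuous g -> a <= b -> (forall x, a <= x <= b -> `|g x| <= M) ->
  `|itg g a b| <= M * (b - a).
Proof.
move=> cg ab HM; have [x xab ->] := itg_mvt cg ab.
by rewrite normrM (ger0_norm (x := b - a)) ?subr_ge0// ler_wpM2r ?subr_ge0// HM.
Qed.

Lemma itg_ge g a b m : continuous g -> a <= b -> (forall x, a <= x <= b -> m <= g x) ->
  m * (b - a) <= itg g a b.
Proof.
move=> cg ab HM; have [x xab ->] := itg_mvt cg ab.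
by rewrite ler_wpM2r ?subr_ge0// HM.
Qed.

Lemma eq_itg g h a b : continuous g -> continuous h -> a <= b ->
  (forall x, a <= x <= b -> g x = h x) -> itg g a b = itg h a b.
Proof.
move=> cg ch ab gh; apply/eqP; rewrite -subr_eq0 -mulN1r -itgZ// -itgD//; last first.
  by move=> x; apply: cvgMl_tmp; exact: ch.
rewrite -normr_le0; apply: (@le_trans _ _ (0 * (b - a))); last by rewrite mul0r.
apply: itg_bound => // [x|x xab]; last by rewrite gh// mulN1r subrr normr0.
by apply: cvgD; [exact: cg|apply: cvgMl_tmp; exact: ch].
Qed.

Lemma prim_continuous g : continuous g -> continuous (prim g).
Proof.
move=> cg x; apply/differentiable_continuous/derivable1_diffP.
by have [] := is_derive_prim x cg.
Qed.
End Antiderivative.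

(** * Cauchy's theorem on squares *)

Section Goursat.
Context {R : realType}.

Lemma nested_point (a W : nat -> R) : (forall n, 0 <= W n) ->
  (forall n, a n <= a n.+1) -> (forall n, a n.+1 + W n.+1 <= a n + W n) ->
  exists X, forall n, a n <= X <= a n + W n.
Proof.
move=> W0 a_nd b_ni.
have a_mono n m : (n <= m)%N -> a n <= a m.
  elim: m => [|m IH]; first by rewrite leqn0 => /eqP ->.
  by rewrite leq_eqVlt => /predU1P[->//|/IH/le_trans]; apply.
have b_mono n m : (n <= m)%N -> a m + W m <= a n + W n.
  elim: m => [|m IH]; first by rewrite leqn0 => /eqP ->.
  by rewrite leq_eqVlt => /predU1P[->//|/IH]; apply: le_trans.
have ub n m : a m <= a n + W n.
  have [mn|/ltnW nm] := leqP m n.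
    by apply: le_trans (a_mono _ _ mn) _; rewrite lerDl.
  by apply: le_trans (b_mono _ _ nm); rewrite lerDl.
exists (sup (range a)) => n; apply/andP; split.
  by apply: ub_le_sup; [exists (a 0%N + W 0%N) => _ [m _ <-]|exists n].
by apply: ge_sup; [exists (a 0%N), 0%N|move=> _ [m _ <-]].
Qed.

Lemma norm_quarter (a b c d : R) : `|a| < `|a + b + (c + d)| / 4 ->
  `|b| < `|a + b + (c + d)| / 4 -> `|c| < `|a + b + (c + d)| / 4 ->
  `|a + b + (c + d)| / 4 <= `|d|.
Proof.
have := ler_normD (a + b) (c + d); have := ler_normD a b; have := ler_normD c d; lra.
Qed.

(** Goursat's bisection for any additive function of rectangles. One keeps a quarter carrying at
    least 1/4 of the absolute value; after n steps the loss 4^-n matches the scaling of the local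
    bound at the common point. *)
Lemma bisection (Phi : R -> R -> R -> R -> R) (x0 y0 w h : R) : 0 <= w -> 0 <= h ->
  (forall x y w h, Phi x y w h =
     Phi x y (w / 2) (h / 2) + Phi (x + w / 2) y (w / 2) (h / 2) +
     (Phi x (y + h / 2) (w / 2) (h / 2) + Phi (x + w / 2) (y + h / 2) (w / 2) (h / 2))) ->
  (forall X Y e : R, x0 <= X <= x0 + w -> y0 <= Y <= y0 + h -> 0 < e ->
     exists2 d : R, 0 < d & forall x y w' h' : R, 0 <= w' < d -> 0 <= h' < d ->
       x <= X <= x + w' -> y <= Y <= y + h' -> `|Phi x y w' h'| <= e * (w' + h') ^+ 2) ->
  Phi x0 y0 w h = 0.
Proof.
move=> w0 h0 add loc.
pose W n := w / 2 ^+ n; pose H n := h / 2 ^+ n.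
have WS n : W n / 2 = W n.+1 by rewrite /W exprSr invfM mulrA.
have HS n : H n / 2 = H n.+1 by rewrite /H exprSr invfM mulrA.
pose step n (p : R * R) : R * R := let c := `|Phi p.1 p.2 (W n) (H n)| / 4 in
  if c <= `|Phi p.1 p.2 (W n.+1) (H n.+1)| then p else
  if c <= `|Phi (p.1 + W n.+1) p.2 (W n.+1) (H n.+1)| then (p.1 + W n.+1, p.2) else
  if c <= `|Phi p.1 (p.2 + H n.+1) (W n.+1) (H n.+1)| then (p.1, p.2 + H n.+1) else
  (p.1 + W n.+1, p.2 + H n.+1).
have stepP n p : `|Phi p.1 p.2 (W n) (H n)| / 4 <= `|Phi (step n p).1 (step n p).2 (W n.+1) (H n.+1)|.
  rewrite /step /=; case: ifP => // c1; case: ifP => // c2; case: ifP => // c3 /=.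
  move/negbT : c1; move/negbT : c2; move/negbT : c3; rewrite -!ltNge.
  rewrite (add p.1 p.2 (W n)) !WS !HS => c3 c2 c1; exact: norm_quarter c1 c2 c3.
have W0 n : 0 <= W n by rewrite divr_ge0 ?exprn_ge0.
have H0 n : 0 <= H n by rewrite divr_ge0 ?exprn_ge0.
pose s := fix s n := if n is m.+1 then step m (s m) else (x0, y0).
have W2 n : W n = W n.+1 + W n.+1 by rewrite -WS -splitr.
have H2 n : H n = H n.+1 + H n.+1 by rewrite -HS -splitr.
have stepB n p : (p.1 <= (step n p).1 /\ (step n p).1 + W n.+1 <= p.1 + W n) /\
    (p.2 <= (step n p).2 /\ (step n p).2 + H n.+1 <= p.2 + H n).
  have := W0 n.+1; have := W2 n; have := H0 n.+1; have := H2 n; rewrite /step.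
  by case: ifP => _ /=; [|case: ifP => _ /=; [|case: ifP => _ /=]]; lra.
have [X HX] : exists X, forall n, (s n).1 <= X <= (s n).1 + W n.
  by apply: nested_point => // n /=; have [[? ?] _] := stepB n (s n).
have [Y HY] : exists Y, forall n, (s n).2 <= Y <= (s n).2 + H n.
  by apply: nested_point => // n /=; have [_ [? ?]] := stepB n (s n).
have low n : `|Phi x0 y0 w h| / 4 ^+ n <= `|Phi (s n).1 (s n).2 (W n) (H n)|.
  elim: n => [|n IH]; first by rewrite /W /H !expr0 !divr1.
  apply: le_trans (stepP n (s n)); rewrite exprSr invfM mulrA ler_pM2r//.
have HX0 := HX 0%N; have HY0 := HY 0%N; rewrite /= /W /H expr0 !divr1 in HX0 HY0.
apply/eqP; rewrite -normr_le0; apply/ler_addgt0Pr => e e0; rewrite add0r.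
(* The added 1 covers the degenerate rectangle with w = h = 0. *)
have [|d d0 Hd] := loc X Y (e / ((w + h) ^+ 2 + 1)) HX0 HY0.
  by rewrite divr_gt0// ltr_wpDl// sqr_ge0.
have [n nd] : exists n, (w + h) / d < 2 ^+ n.
  have := archi_boundP (divr_ge0 (addr_ge0 w0 h0) (ltW d0)); set m := Num.bound _ => Hm.
  exists m; apply: lt_le_trans Hm _; rewrite -natrX ler_nat; exact/ltnW/ltn_expl.
have WHd : (w + h) / 2 ^+ n < d.
  by rewrite ltr_pdivrMr ?exprn_gt0// mulrC -ltr_pdivrMr.
have Wd : W n < d by apply: le_lt_trans WHd; rewrite /W ler_pM2r ?invr_gt0 ?exprn_gt0// lerDl.
have Hd' : H n < d by apply: le_lt_trans WHd; rewrite /H ler_pM2r ?invr_gt0 ?exprn_gt0// lerDr.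
have := Hd (s n).1 (s n).2 (W n) (H n); rewrite W0 H0 Wd Hd' => /(_ isT isT (HX n) (HY n)).
move=> /(le_trans (low n)); rewrite /W /H -mulrDl exprMn exprVn -exprM mulnC exprM.
rewrite (_ : 2 ^+ 2 = 4) ?mulrA; last by ring.
rewrite ler_pM2r ?invr_gt0 ?exprn_gt0// => /le_trans; apply.
by rewrite -mulrA -expr2 mulrAC ler_pdivrMr ?ltr_wpDl ?sqr_ge0// ler_wpM2l ?(ltW e0)// lerDl.
Qed.

(** The integral of P dx + Q dy, counterclockwise, along the boundary of [x, x + w] x [y, y + h]. *)
Definition RI (P Q : R -> R -> R) x y w h : R :=
  itg (P^~ y) x (x + w) - itg (P^~ (y + h)) x (x + w) +
  (itg (Q (x + w)) y (y + h) - itg (Q x) y (y + h)).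

(** Both functions are differentiable at the point, and the shared coefficient [p2] says that dP/dy
    = dQ/dx there. *)
Definition closed_at (P Q : R -> R -> R) X Y := exists p1 p2 q2 : R, forall e, 0 < e ->
  exists2 d : R, 0 < d & forall s t : R, `|s| < d -> `|t| < d ->
    `|P (X + s) (Y + t) - P X Y - (p1 * s + p2 * t)| <= e * (`|s| + `|t|) /\
    `|Q (X + s) (Y + t) - Q X Y - (p2 * s + q2 * t)| <= e * (`|s| + `|t|).

Lemma RI_splitx P Q x y w1 w2 h :
  RI P Q x y (w1 + w2) h = RI P Q x y w1 h + RI P Q (x + w1) y w2 h.
Proof. by rewrite /RI /itg !(addrA x); ring. Qed.

Lemma RI_splity P Q x y w h1 h2 :
  RI P Q x y w (h1 + h2) = RI P Q x y w h1 + RI P Q x (y + h1) w h2.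
Proof. by rewrite /RI /itg !(addrA y); ring. Qed.

Lemma goursat P Q x y w h : 0 <= w -> 0 <= h ->
  (forall y, continuous (P^~ y)) -> (forall x, continuous (Q x)) ->
  (forall X Y, x <= X <= x + w -> y <= Y <= y + h -> closed_at P Q X Y) ->
  RI P Q x y w h = 0.
Proof.
move=> w0 h0 cP cQ cl; apply: (@bisection (RI P Q)) => //.
  move=> {w0 h0 cl} {}x {}y {}w {}h; rewrite {1}(splitr w) {1}(splitr h).
  by rewrite RI_splity !RI_splitx.
move=> X Y e HX HY e0; have [p1 [p2 [q2 Hcl]]] := cl X Y HX HY.
have [|d d0 Hd] := Hcl (e / 2); first by rewrite divr_gt0.
move: Hd => {Hcl cl HX HY w0 h0 x y w h} Hd.
exists d => // x y w h /andP[w0 wd] /andP[h0 hd] /andP[xX Xx] /andP[yY Yy].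
have HP u v : x <= u <= x + w -> y <= v <= y + h ->
    `|P u v - P X Y - (p1 * (u - X) + p2 * (v - Y))| <= e / 2 * (w + h) /\
    `|Q u v - Q X Y - (p2 * (u - X) + q2 * (v - Y))| <= e / 2 * (w + h).
  move=> /andP[xu ux] /andP[yv vy].
  have au : `|u - X| <= w by rewrite ler_norml; lra.
  have av : `|v - Y| <= h by rewrite ler_norml; lra.
  have := Hd _ _ (le_lt_trans au wd) (le_lt_trans av hd); rewrite !subrKC.
  have B : e / 2 * (`|u - X| + `|v - Y|) <= e / 2 * (w + h).
    by apply: ler_wpM2l; [rewrite divr_ge0// ltW|exact: lerD].
  by case=> H1 H2; split; [exact: le_trans H1 B|exact: le_trans H2 B].
have yh : y <= y + h by rewrite lerDl.
have xw : x <= x + w by rewrite lerDl.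
have cc (c : R) : continuous (fun _ : R => c) by move=> z; exact: cvg_cst.
have cZ (c : R) g : continuous g -> continuous (fun z : R => c * g z).
  by move=> cg z; apply: cvgMl_tmp; exact: cg.
have cD (f g : R -> R) : continuous f -> continuous g -> continuous (fun z => f z + g z).
  by move=> cf cg z; apply: cvgD; [exact: cf|exact: cg].
(* Adding p2 h here and subtracting p2 w in [E2] removes the linear parts of the differences between
   opposite sides. The two corrections p2 h w cancel, which is where closedness enters. *)
have E1 : itg (P^~ y) x (x + w) - itg (P^~ (y + h)) x (x + w) =
    itg (fun u => P u y + -1 * P u (y + h) + p2 * h) x (x + w) - p2 * h * w.
  by rewrite !itgD ?itgZ ?itg_cst//; [ring|exact: cZ|apply: cD => //; exact: cZ].
have E2 : itg (Q (x + w)) y (y + h) - itg (Q x) y (y + h) =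
    itg (fun v => Q (x + w) v + -1 * Q x v + - (p2 * w)) y (y + h) + p2 * w * h.
  by rewrite !itgD ?itgZ ?itg_cst//; [ring|exact: cZ|apply: cD => //; exact: cZ].
have B1 : `|itg (fun u => P u y + -1 * P u (y + h) + p2 * h) x (x + w)| <= e * (w + h) * (x + w - x).
  apply: itg_bound => // [|u xu]; first exact: (cD _ _ (cD _ _ (cP _) (cZ _ _ (cP _))) (cc _)).
  have [|H1 _] := HP u y xu; first by rewrite lexx.
  have [|H2 _] := HP u (y + h) xu; first by rewrite yh lexx.
  rewrite [X in `|X|](_ : _ = (P u y - P X Y - (p1 * (u - X) + p2 * (y - Y))) -
    (P u (y + h) - P X Y - (p1 * (u - X) + p2 * (y + h - Y)))); last by ring.
  apply: le_trans (ler_normB _ _) _; lra.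
have B2 : `|itg (fun v => Q (x + w) v + -1 * Q x v + - (p2 * w)) y (y + h)| <= e * (w + h) * (y + h - y).
  apply: itg_bound => // [|v yv]; first exact: (cD _ _ (cD _ _ (cQ _) (cZ _ _ (cQ _))) (cc _)).
  have [|_ H1] := HP x v _ yv; first by rewrite lexx.
  have [|_ H2] := HP (x + w) v _ yv; first by rewrite xw lexx.
  rewrite [X in `|X|](_ : _ = (Q (x + w) v - Q X Y - (p2 * (x + w - X) + q2 * (v - Y))) -
    (Q x v - Q X Y - (p2 * (x - X) + q2 * (v - Y)))); last by ring.
  apply: le_trans (ler_normB _ _) _; lra.
rewrite /RI E1 E2; set A := itg _ _ _ in B1 *; set B := itg _ _ _ in B2 *.
rewrite (_ : _ + _ = A + B); last by ring.
apply: le_trans (ler_normD _ _) _; apply: le_trans (lerD B1 B2) _.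
by rewrite le_eqVlt; apply/orP; left; apply/eqP; ring.
Qed.
End Goursat.

(** * The smoothed Cauchy kernel *)

Section CauchyKernel.
Context {R : realType}.
Implicit Types (p q v : 'rV[R]_2).

Lemma is_derive_coord n (q v : 'rV[R]_n) i : is_derive q v (fun p : 'rV[R]_n => p 0 i) (v 0 i).
Proof.
apply: DeriveDef; first exact/diff_derivable/differentiable_coord.
rewrite /derive; apply: cvg_lim => //; apply: cvg_near_cst; near=> h.
have h0 : h != 0 by near: h; exact: nbhs_dnbhs_neq.
by rewrite /= !mxE addrK /GRing.scale /= mulrA mulVf// mul1r.
Unshelve. all: by end_near.
Qed.

Lemma sqdist2E q : sqdist 0 q = q 0 0 * q 0 0 + q 0 1 * q 0 1.
Proof.
rewrite /sqdist !big_ord_recl big_ord0 addr0 !mxE !subr0 -!expr2.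
by rewrite (_ : lift ord0 ord0 = 1)//; exact: val_inj.
Qed.

Lemma near_far n (a p : 'rV[R]_n) (r : R) : 0 <= r -> r < enorm (p - a) ->
  \forall q \near p, r < enorm (q - a).
Proof.
move=> r0 rp; have cs : continuous (sqdist a) by apply/smooth_cont/SM_smooth/SM_sqdist.
have H : r ^+ 2 < sqdist a p by rewrite sqdistE ltr_sqr ?nnegrE ?enorm_ge0.
near=> q; rewrite -ltr_sqr ?nnegrE ?enorm_ge0// -sqdistE; near: q.
by apply: (cvgr_gt (sqdist a p)) => //; exact: cs.
Unshelve. all: by end_near.
Qed.

Lemma bump_le1 n (a q : 'rV[R]_n) (r : R) : 0 < r -> bumpf a r q <= 1.
Proof.
by move=> r0; rewrite /bumpf ler_pdivrMr ?bump_den// mul1r lerDl flat_ge0.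
Qed.

Variable rho : R.
Hypothesis rho0 : 0 < rho.

Let den q := sqdist 0 q + bumpf 0 rho q.

Let den_gt0 q : 0 < den q.
Proof.
rewrite /den; have [q0|q0] := leP (enorm q) (rho / 2).
  rewrite bump1 ?subr0// ltr_wpDl//.
  by rewrite sqdistE sqr_ge0.
rewrite ltr_pwDl ?bump_ge0// sqdistE subr0 exprn_gt0//.
by apply: le_lt_trans q0; rewrite ltW// divr_gt0.
Qed.

(* [(cker 0, - cker 1)] is a globally smooth version of the Cauchy kernel [1/z]. *)
Definition cker (j : 'I_2) q : R :=
  q 0 j * (1 - bumpf 0 rho q) * (sqdist 0 q + bumpf 0 rho q)^-1.

Lemma ckerE j q : rho <= enorm q -> cker j q = q 0 j / sqdist 0 q.
Proof. by move=> rq; rewrite /cker bump0 ?subr0// mulr1 addr0. Qed.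

Lemma SM_cker j : SM (cker j).
Proof.
apply: SM_mul; first apply: SM_mul; first exact: SM_coord.
  by apply: SM_sub; [exact: SM_cst|exact: SM_bump].
apply: SM_inv => [|q]; last by rewrite gt_eqF ?den_gt0.
by apply: SM_add; [exact: SM_sqdist|exact: SM_bump].
Qed.

(** The real form of (1/z)' = - (1/z)^2: off the disc the derivatives are quadratic in the kernels
    themselves, which allows the induction of [DB_cker]. *)
Lemma derive_cker i j q : rho < enorm q -> 'D_(delta_mx 0 i) (cker j) q =
  (i == j)%:R * (cker 0 q * cker 0 q + cker 1 q * cker 1 q) - 2 * (cker i q * cker j q).
Proof.
move=> rq; pose s q := q 0 0 * q 0 0 + q 0 1 * q 0 1 : R.
have sE p : rho < enorm p -> sqdist 0 p = s p by rewrite sqdist2E.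
have s0 : s q != 0.
  by rewrite /s -sqdist2E sqdistE subr0 gt_eqF// exprn_gt0// (lt_trans rho0).
have -> : 'D_(delta_mx 0 i) (cker j) q = 'D_(delta_mx 0 i) (fun p => p 0 j * (s p)^-1) q.
  have H : rho < enorm (q - 0) by rewrite subr0.
  apply: near_eq_derive; near=> p.
  have rp : rho < enorm p by rewrite -(subr0 p); near: p; exact: near_far (ltW rho0) H.
  by rewrite ckerE ?sE// ltW.
set v := delta_mx 0 i.
have ds : is_derive q v s (2 * (q 0 0 * v 0 0 + q 0 1 * v 0 1)).
  have d j' := is_derive_coord q v j'.
  apply: (@is_derive_eq _ _ _ _ _ _ _ _ (is_deriveD (is_deriveM (d 0) (d 0)) (is_deriveM (d 1) (d 1)))).
  by rewrite /GRing.scale /=; ring.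
have [dsi dsE] := ds.
have dV : is_derive q v (fun p => (s p)^-1) (- (s q) ^- 2 * (2 * (q 0 0 * v 0 0 + q 0 1 * v 0 1))).
  by apply: DeriveDef; [exact: derivableV|rewrite deriveV// dsE].
have [_ ->] := is_deriveM (is_derive_coord q v j) dV.
rewrite !ckerE ?ltW// !sqdist2E -/(s q) /GRing.scale /= /v !mxE !eqxx /=.
have : i = 0 \/ i = 1 by case: i {v ds dV dsi dsE} => [[|[|//]]] pi; [left|right]; exact: val_inj.
have : j = 0 \/ j = 1 by case: j => [[|[|//]]] pj; [left|right]; exact: val_inj.
move: s0; rewrite /s; by move=> s0 [->|->] [->|->] /=; field.
Unshelve. all: by end_near.
Qed.

Lemma cker_bounded j : exists M : R, forall q, `|cker j q| <= M.
Proof.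
have r2 : 0 < 2 * rho by rewrite mulr_gt0.
have r4 : 0 < 2 * (2 * rho) by rewrite mulr_gt0.
have [] := @cont_bsupp_bounded _ _ (fun q => cker j q * bumpf 0 (2 * (2 * rho)) q).
- by apply/smooth_cont/SM_smooth/SM_mul; [exact: SM_cker|exact: SM_bump].
- exact/bsuppM/bsupp_bump.
move=> M HM; exists (M + rho^-1) => q.
have M0 : 0 <= M by apply: le_trans (HM 0).
have [q2|q2] := leP (enorm q) (2 * rho).
  have := HM q; rewrite bump1 ?subr0 ?mulr1//; last by rewrite mulrAC divff// mul1r.
  by move/le_trans; apply; rewrite lerDl invr_ge0 ltW.
have rq : rho < enorm q by lra.
have q0 : 0 < enorm q by lra.
rewrite ckerE ?(ltW rq)// sqdistE subr0 normrM normfV (ger0_norm (x := _ ^+ 2)) ?sqr_ge0//.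
apply: (@le_trans _ _ (enorm q)^-1); last first.
  by rewrite ler_wpDl// lef_pV2 ?posrE// ltW.
rewrite expr2 invfM mulrA ler_piMl ?invr_ge0 ?(ltW q0)// ler_pdivrMr// mul1r.
exact: coord_le_enorm.
Qed.

Lemma DB_cker N j : DB N (cker j).
Proof.
elim: N j => [|N IH] j.
  by have [M HM] := cker_bounded j; exists M; exact: bdiff0.
apply: DB_grad_coords => [|p|i]; first exact: cker_bounded.
  by have [] := SM_derive (SM_cker j).
(* The derivative differs from this expression by a smooth function supported in the disc, and the
   expression itself is controlled by the induction hypothesis. *)
pose rhs q := (i == j)%:R * (cker 0 q * cker 0 q + cker 1 q * cker 1 q) - 2 * (cker i q * cker j q).
have -> : 'D_(delta_mx 0 i) (cker j) = (fun q => ('D_(delta_mx 0 i) (cker j) q - rhs q) + rhs q).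
  by apply/funext => q; rewrite subrK.
have Drhs : DB N rhs.
  by apply: DBB; apply: DBZ; [apply: DBD; exact: DBM|exact: DBM].
apply: DBD => //; apply: smooth_DB; last first.
  by apply: (@bsupp_ball _ _ _ 0 rho) => q; rewrite subr0 => /derive_cker ->; rewrite subrr.
apply/SM_smooth/SM_sub; first by have [_] := SM_derive (SM_cker j).
apply: SM_sub; apply: SM_mul; rewrite ?SM_cst//; try exact: SM_cst.
  by apply: SM_add; apply: SM_mul; exact: SM_cker.
by apply: SM_mul; exact: SM_cker.
Qed.
End CauchyKernel.

(** * Complex differentiability in real coordinates *)

Section HolomorphicReal.
Context {R : realType}.
Implicit Types (u v : R -> R -> R) (X Y : R).

(** Total differentiability at one point, with the gradient (p, q) named. *)
Definition lin_at u X Y (p q : R) := forall e : R, 0 < e ->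
  exists2 d : R, 0 < d & forall s t : R, `|s| < d -> `|t| < d ->
    `|u (X + s) (Y + t) - u X Y - (p * s + q * t)| <= e * (`|s| + `|t|).

(* [u + i v] is complex differentiable at [X + i Y], with derivative [a + i b]. *)
Definition hol_at u v X Y :=
  exists a b : R, lin_at u X Y a (- b) /\ lin_at v X Y b a.

Lemma lin_at_local u u' X Y p q : (exists2 d : R, 0 < d & forall s t, `|s| < d -> `|t| < d ->
    u' (X + s) (Y + t) = u (X + s) (Y + t)) ->
  lin_at u X Y p q -> lin_at u' X Y p q.
Proof.
move=> [d d0 E] H e e0; have [d' d'0 H'] := H e e0.
exists (Num.min d d') => [|s t]; first by rewrite lt_min d0.
rewrite !lt_min => /andP[s1 s2] /andP[t1 t2].
have := E 0 0; rewrite normr0 !addr0 => ->//; rewrite E//; exact: H'.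
Qed.

Lemma lin_at_lip u X Y p q : lin_at u X Y p q ->
  exists2 d : R, 0 < d & forall s t : R, `|s| < d -> `|t| < d ->
    `|u (X + s) (Y + t) - u X Y| <= (1 + `|p| + `|q|) * (`|s| + `|t|).
Proof.
move=> H; have [d d0 Hd] := H 1 ltr01; exists d => // s t sd td.
have := Hd s t sd td; set w := u (X + s) _ - _ => Hw.
rewrite -[w](subrK (p * s + q * t)); apply: le_trans (ler_normD _ _) _.
apply: le_trans (lerD Hw (ler_normD _ _)) _; rewrite !normrM.
have := mulr_ge0 (normr_ge0 p) (normr_ge0 t); have := mulr_ge0 (normr_ge0 q) (normr_ge0 s).
lra.
Qed.

Lemma lin_at_cont u X Y p q : lin_at u X Y p q -> forall e, 0 < e ->
  exists2 d : R, 0 < d & forall s t : R, `|s| < d -> `|t| < d ->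
    `|u (X + s) (Y + t) - u X Y| < e.
Proof.
move=> /lin_at_lip[d d0 Hd] e e0.
have M0 : 0 < 1 + `|p| + `|q| by have := normr_ge0 p; have := normr_ge0 q; lra.
exists (Num.min d (e / (1 + `|p| + `|q|) / 2)) => [|s t]; first by rewrite lt_min d0 !divr_gt0.
rewrite !lt_min => /andP[s1 s2] /andP[t1 t2]; apply: le_lt_trans (Hd s t s1 t1) _.
by rewrite mulrC -ltr_pdivlMr// [ltRHS]splitr ltrD.
Qed.

Lemma lin_atD u k X Y p q p' q' : lin_at u X Y p q -> lin_at k X Y p' q' ->
  lin_at (fun x y => u x y + k x y) X Y (p + p') (q + q').
Proof.
move=> Hu Hk e e0; have [|d d0 Hd] := Hu (e / 2); first by rewrite divr_gt0.
have [|d' d'0 Hd'] := Hk (e / 2); first by rewrite divr_gt0.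
exists (Num.min d d') => [|s t]; first by rewrite lt_min d0.
rewrite !lt_min => /andP[s1 s2] /andP[t1 t2].
rewrite [X in `|X|](_ : _ = (u (X + s) (Y + t) - u X Y - (p * s + q * t)) +
  (k (X + s) (Y + t) - k X Y - (p' * s + q' * t))); last by ring.
apply: le_trans (ler_normD _ _) _; rewrite [e]splitr mulrDl.
by rewrite lerD ?Hd ?Hd'.
Qed.

Lemma lin_at_cst c X Y : lin_at (fun _ _ => c) X Y 0 0.
Proof.
move=> e e0; exists 1 => // s t _ _; rewrite subrr !mul0r addr0 subr0 normr0.
by rewrite mulr_ge0 ?(ltW e0) ?addr_ge0.
Qed.

Lemma lin_atM u k X Y p q p' q' : lin_at u X Y p q -> lin_at k X Y p' q' ->
  lin_at (fun x y => u x y * k x y) X Y (u X Y * p' + k X Y * p) (u X Y * q' + k X Y * q).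
Proof.
move=> Hu Hk e e0.
pose A := 1 + `|p| + `|q|; pose B := 1 + `|p'| + `|q'|; pose C := `|u X Y| + `|k X Y| + 1.
have A0 : 0 < A by rewrite /A; have := normr_ge0 p; have := normr_ge0 q; lra.
have B0 : 0 < B by rewrite /B; have := normr_ge0 p'; have := normr_ge0 q'; lra.
have C0 : 0 < C by rewrite /C; have := normr_ge0 (u X Y); have := normr_ge0 (k X Y); lra.
have e1 : 0 < e / 2 / C by rewrite !divr_gt0.
have [d1 d10 H1] := Hu _ e1; have [d2 d20 H2] := Hk _ e1.
have [d3 d30 H3] := lin_at_lip Hu; have [d4 d40 H4] := lin_at_lip Hk.
pose d5 := e / 4 / (A * B).
have d50 : 0 < d5 by rewrite !divr_gt0 ?mulr_gt0.
exists (Num.min (Num.min (Num.min d1 d2) (Num.min d3 d4)) d5) => [|s t].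
  by rewrite !lt_min d10 d20 d30 d40.
rewrite !lt_min => /andP[/andP[/andP[s1 s2] /andP[s3 s4]] s5] /andP[/andP[/andP[t1 t2] /andP[t3 t4]] t5].
have := H1 _ _ s1 t1; have := H2 _ _ s2 t2; have := H3 _ _ s3 t3; have := H4 _ _ s4 t4.
rewrite -/A -/B; have n0 : 0 <= `|s| + `|t| by rewrite addr_ge0.
have n5 : A * B * (`|s| + `|t|) <= e / 2.
  rewrite mulrC -ler_pdivlMr ?mulr_gt0//.
  by rewrite (_ : e / 2 / (A * B) = d5 + d5) ?lerD ?ltW// /d5; field; rewrite !gt_eqF.
move: (`|s| + `|t|) n0 n5 => n n0 n5.
set du := u (X + s) (Y + t) - u X Y; set dk := k (X + s) (Y + t) - k X Y => K4 K3 K2 K1.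
rewrite [X in `|X|](_ : _ = (u X Y * (dk - (p' * s + q' * t)) + k X Y * (du - (p * s + q * t))) + du * dk); last first.
  by rewrite /du /dk; ring.
apply: le_trans (ler_normD _ _) _; apply: le_trans (lerD (ler_normD _ _) (lexx _)) _.
rewrite !normrM; have := ler_wpM2l (normr_ge0 (u X Y)) K2.
have := ler_wpM2l (normr_ge0 (k X Y)) K1.
have D : `|du| * `|dk| <= e / 2 * n.
  apply: (@le_trans _ _ ((A * n) * (B * n))); first exact: ler_pM.
  by rewrite [leLHS](_ : _ = A * B * n * n) ?ler_wpM2r//; ring.
have E : (`|u X Y| + `|k X Y|) * (e / 2 / C * n) <= e / 2 * n.
  rewrite mulrA ler_wpM2r// mulrCA ler_piMr ?divr_ge0 ?ltW// ?ltr_pdivrMr//.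
  by rewrite mul1r /C ltrDl.
lra.
Qed.

Lemma normc_le (w : R[i]) (e : R) : `|w| <= e%:C%C ->
  `|complex.Re w| <= e /\ `|complex.Im w| <= e.
Proof.
rewrite normc_def lecR => H; split; apply: le_trans H; rewrite -sqrtr_sqr ler_sqrt ?addr_ge0 ?sqr_ge0//.
  by rewrite lerDl sqr_ge0.
by rewrite lerDr sqr_ge0.
Qed.

Lemma le_normc (s t : R) : `|(s +i* t)%C| <= (`|s| + `|t|)%:C%C.
Proof.
rewrite normc_def lecR /= -[leRHS]ger0_norm ?addr_ge0// -sqrtr_sqr ler_sqrt ?sqr_ge0//.
rewrite sqrrD !real_normK ?num_real// lerD2r lerDl mulrn_wge0// mulr_ge0//.
Qed.

Lemma derivable_hol_at (f : R[i] -> R[i]) X Y :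
  derivable (f : R[i]^o -> R[i]^o) (X +i* Y)%C 1 ->
  hol_at (fun x y => complex.Re (f (x +i* y)%C)) (fun x y => complex.Im (f (x +i* y)%C)) X Y.
Proof.
rewrite /derivable => /cvg_ex[/= L] /cvgrPdist_lt HL.
exists (complex.Re L), (complex.Im L).
suff H (e : R) : 0 < e -> exists2 d : R, 0 < d & forall s t : R, `|s| < d -> `|t| < d ->
  `|complex.Re (f ((X + s) +i* (Y + t))%C) - complex.Re (f (X +i* Y)%C) -
    (complex.Re L * s + - complex.Im L * t)| <= e * (`|s| + `|t|) /\
  `|complex.Im (f ((X + s) +i* (Y + t))%C) - complex.Im (f (X +i* Y)%C) -
    (complex.Im L * s + complex.Re L * t)| <= e * (`|s| + `|t|).
  by split=> e /H[d d0 Hd]; exists d => // s t sd td; have [] := Hd s t sd td.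
move=> e0; have := HL e%:C%C; rewrite ltcR => /(_ e0).
rewrite /dnbhs /within /= => /nbhs_ballP[d /= d0 Hd].
(* Radii of balls in [R[i]] are complex numbers; being positive, [d] is real. *)
have [d1 dE] : exists d1, d = d1%:C%C.
  exists (complex.Re d); move: d0; rewrite ltcE /= => /andP[/eqP Im0 _].
  by case: d Im0 {Hd} => a b /= ->.
move: d0; rewrite dE ltcR => d0.
exists (d1 / 2) => [|s t sd td]; first by rewrite divr_gt0.
have [/andP[/eqP -> /eqP ->]|st0] := boolP ((s == 0) && (t == 0)).
  by rewrite !addr0 !mulr0 !addr0 !subr0 !subrr !normr0 addr0 mulr0.
pose h := (s +i* t)%C.
have h0 : h != 0 by rewrite eq_complex.
have hd : `|h| < d1%:C%C.
  by apply: le_lt_trans (le_normc _ _) _; rewrite ltcR; lra.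
have := Hd h; rewrite /= dE sub0r normrN => /(_ hd h0).
rewrite -(ltr_pM2r (x := `|h|)) ?normr_gt0// -normrM.
set w := _ * h => /ltW Hw.
have Hw' : `|w| <= (e * (`|s| + `|t|))%:C%C.
  have -> : (e * (`|s| + `|t|))%:C%C = e%:C%C * (`|s| + `|t|)%:C%C.
    by apply/eqP; rewrite eq_complex /= !mul0r !mulr0 subr0 addr0 !eqxx.
  apply: le_trans Hw _; apply: ler_wpM2l; first by rewrite lecR ltW.
  exact: le_normc.
have [H1 H2] := normc_le Hw'.
have wE : w = L * h - (f ((X + s) +i* (Y + t))%C - f (X +i* Y)%C).
  rewrite /w mulrBl; congr (_ - _).
  rewrite [h%:A]mulr1 /GRing.scale /= mulrAC mulVf// mul1r; congr (f _ - _).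
  by rewrite /h addrC; apply/eqP; rewrite eq_complex /= !eqxx.
move: H1 H2; rewrite wE /h; case: (f _) => F1 F2; case: (f _) => G1 G2; case: (L) => a b /= H1 H2.
by split; rewrite -normrN; [move: H1|move: H2]; congr (`|_| <= _); ring.
Qed.

Lemma hol_at_mul u v k l X Y : hol_at u v X Y -> hol_at k l X Y ->
  hol_at (fun x y => u x y * k x y - v x y * l x y) (fun x y => u x y * l x y + v x y * k x y) X Y.
Proof.
move=> [a [b [Hu Hv]]] [c [d [Hk Hl]]].
exists (u X Y * c + k X Y * a - (v X Y * d + l X Y * b)), (u X Y * d + l X Y * a + (v X Y * c + k X Y * b)).
have LE g p q p' q' : p = p' -> q = q' -> lin_at g X Y p q -> lin_at g X Y p' q' by move=> -> ->.
split; last by apply: LE (lin_atD (lin_atM Hu Hl) (lin_atM Hv Hk)); ring.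
have := lin_atD (lin_atM Hu Hk) (lin_atM (lin_at_cst (-1) X Y) (lin_atM Hv Hl)).
have -> : (fun x y => u x y * k x y + -1 * (v x y * l x y)) = (fun x y => u x y * k x y - v x y * l x y).
  by apply/funext => x; apply/funext => y; ring.
by apply: LE; ring.
Qed.

(** The Cauchy-Riemann equations, read on the real and imaginary parts of (u + i v)(dx + i dy). *)
Lemma hol_at_closed u v X Y : hol_at u v X Y ->
  closed_at u (fun x y => - v x y) X Y /\ closed_at v u X Y.
Proof.
move=> [a [b [Hu Hv]]].
have C P Q p1 p2 q2 : lin_at P X Y p1 p2 -> lin_at Q X Y p2 q2 -> closed_at P Q X Y.
  move=> HP HQ; exists p1, p2, q2 => e e0; have [d d0 Hd] := HP e e0; have [d' d'0 Hd'] := HQ e e0.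
  exists (Num.min d d') => [|s t]; first by rewrite lt_min d0.
  by rewrite !lt_min => /andP[s1 s2] /andP[t1 t2]; split; [exact: Hd|exact: Hd'].
split; last exact: C Hv Hu.
apply: (C _ _ a (- b) (- a)) => // e /Hv[d d0 Hd]; exists d => // s t sd td.
by rewrite -normrN; have := Hd s t sd td; congr (`|_| <= _); ring.
Qed.

Lemma differentiable_lin_at (g : 'rV[R]_2 -> R) X Y : differentiable g (pt2 (X, Y)) ->
  lin_at (fun x y => g (pt2 (x, y))) X Y ('D_(e_ 0) g (pt2 (X, Y))) ('D_(e_ 1) g (pt2 (X, Y))).
Proof.
move=> dg e e0; have /eqaddoP/(_ e e0) := diff_locally dg.
move=> /nbhs_ballP[d /= d0 Hd]; exists d => // s t sd td.
have hE : pt2 (X + s, Y + t) = pt2 (s, t) + pt2 (X, Y).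
  by apply/rowP => i; rewrite !mxE /=; case: ifP => _; rewrite addrC.
have cE i : pt2 (s, t) 0 i = if i == 0 then s else t by rewrite mxE.
have nE : `|pt2 (s, t)| <= `|s| + `|t|.
  rewrite -[X in X <= _]/(mx_norm _) mx_normrE; apply: bigmax_le; first exact: addr_ge0.
  by move=> [i j] _ /=; rewrite (ord1 i) cE; case: ifP => _; rewrite ?lerDl ?lerDr.
have hd : `|pt2 (s, t)| < d.
  rewrite -[X in X < _]/(mx_norm _) mx_normrE; apply: bigmax_lt => // -[i j] _ /=.
  by rewrite (ord1 i) cE; case: ifP.
have := Hd (pt2 (s, t)); rewrite -ball_normE /= sub0r normrN => /(_ hd).
rewrite -[X in `|X| <= _ * _ -> _]/(g (pt2 (s, t) + pt2 (X, Y)) -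
  (g (pt2 (X, Y)) + 'd g (pt2 (X, Y)) (pt2 (s, t)))).
rewrite -hE -deriveE// derive_coords// !big_ord_recl big_ord0 addr0 !cE /=.
rewrite (_ : lift ord0 ord0 = 1 :> 'I_2); last exact: val_inj.
move=> H; apply: le_trans (ler_wpM2l (ltW e0) nE); apply: le_trans H.
by rewrite le_eqVlt; apply/orP; left; apply/eqP; congr `|_|; rewrite /e_; ring.
Qed.
End HolomorphicReal.

(** * Line integrals around rectangles with a hole *)

Section CauchyRepresentation.
Context {R : realType}.
Implicit Types (u v k l : R -> R -> R) (P Q : R -> R -> R).

(** Integrals along sides parallel to the axes only require separate continuity. *)
Definition lcont u := (forall y, continuous (u^~ y)) /\ (forall x, continuous (u x)).

Lemma lcontD u v : lcont u -> lcont v -> lcont (fun x y => u x y + v x y).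
Proof.
move=> [u1 u2] [v1 v2]; split=> z t; apply: cvgD; [exact: u1|exact: v1|exact: u2|exact: v2].
Qed.

Lemma lcontM u v : lcont u -> lcont v -> lcont (fun x y => u x y * v x y).
Proof.
move=> [u1 u2] [v1 v2]; split=> z t; apply: cvgM; [exact: u1|exact: v1|exact: u2|exact: v2].
Qed.

Lemma lcont_cst c : lcont (fun _ _ => c).
Proof. by split=> z t; exact: cvg_cst. Qed.

Lemma lcontN u : lcont u -> lcont (fun x y => - u x y).
Proof. by move=> [u1 u2]; split=> z t; apply: cvgN; [exact: u1|exact: u2]. Qed.

Lemma eps_lcont u : (forall X Y e : R, 0 < e -> exists2 d : R, 0 < d &
    forall s t, `|s| < d -> `|t| < d -> `|u (X + s) (Y + t) - u X Y| < e) -> lcont u.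
Proof.
move=> H; split=> [y x|x y]; apply/cvgrPdist_lt => e e0; have [d d0 Hd] := H x y e e0.
  apply/nbhs_ballP; exists d => // z; rewrite /= distrC => zd; rewrite distrC.
  by have := Hd (z - x) 0; rewrite addr0 subrKC normr0; exact.
apply/nbhs_ballP; exists d => // z; rewrite /= distrC => zd; rewrite distrC.
by have := Hd 0 (z - y); rewrite addr0 subrKC normr0; exact.
Qed.

Lemma differentiable_lcont (g : 'rV[R]_2 -> R) : (forall p, differentiable g p) ->
  lcont (fun x y => g (pt2 (x, y))).
Proof.
by move=> dg; apply: eps_lcont => X Y; exact: lin_at_cont (differentiable_lin_at (dg _)).
Qed.

Lemma RID P Q P' Q' x y w h : lcont P -> lcont Q -> lcont P' -> lcont Q' ->
  RI (fun a b => P a b + P' a b) (fun a b => Q a b + Q' a b) x y w h =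
  RI P Q x y w h + RI P' Q' x y w h.
Proof.
move=> [P1 P2] [Q1 Q2] [P1' P2'] [Q1' Q2'].
by rewrite /RI !itgD//; ring.
Qed.

Lemma RIZ c P Q x y w h : lcont P -> lcont Q ->
  RI (fun a b => c * P a b) (fun a b => c * Q a b) x y w h = c * RI P Q x y w h.
Proof. by move=> [P1 P2] [Q1 Q2]; rewrite /RI !itgZ//; ring. Qed.

Lemma RI_bound P Q (x y s M : R) : 0 <= s -> lcont P -> lcont Q ->
  (forall a, x <= a <= x + s -> `|P a y| <= M /\ `|P a (y + s)| <= M) ->
  (forall b, y <= b <= y + s -> `|Q (x + s) b| <= M /\ `|Q x b| <= M) ->
  `|RI P Q x y s s| <= 4 * M * s.
Proof.
move=> s0 [P1 P2] [Q1 Q2] HP HQ; rewrite /RI.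
have xs : x <= x + s by rewrite lerDl.
have ys : y <= y + s by rewrite lerDl.
have B1 := itg_bound (P1 y) xs (fun a xa => (HP a xa).1).
have B2 := itg_bound (P1 (y + s)) xs (fun a xa => (HP a xa).2).
have B3 := itg_bound (Q2 (x + s)) ys (fun a xa => (HQ a xa).1).
have B4 := itg_bound (Q2 x) ys (fun a xa => (HQ a xa).2).
have E (c : R) : c + s - c = s by ring.
rewrite !E in B1 B2 B3 B4.
apply: le_trans (ler_normD _ _) _; apply: le_trans (lerD (ler_normB _ _) (ler_normB _ _)) _.
lra.
Qed.

Lemma eq_RI P Q P' Q' (x y w h : R) : 0 <= w -> 0 <= h -> lcont P -> lcont Q -> lcont P' -> lcont Q' ->
  (forall a, x <= a <= x + w -> P a y = P' a y /\ P a (y + h) = P' a (y + h)) ->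
  (forall b, y <= b <= y + h -> Q (x + w) b = Q' (x + w) b /\ Q x b = Q' x b) ->
  RI P Q x y w h = RI P' Q' x y w h.
Proof.
move=> w0 h0 [P1 P2] [Q1 Q2] [P1' P2'] [Q1' Q2'] HP HQ; rewrite /RI.
have xw : x <= x + w by rewrite lerDl.
have yh : y <= y + h by rewrite lerDl.
rewrite (eq_itg (P1 y) (P1' y) xw (fun a xa => (HP a xa).1)).
rewrite (eq_itg (P1 (y + h)) (P1' (y + h)) xw (fun a xa => (HP a xa).2)).
rewrite (eq_itg (Q2 (x + w)) (Q2' (x + w)) yh (fun a xa => (HQ a xa).1)).
by rewrite (eq_itg (Q2 x) (Q2' x) yh (fun a xa => (HQ a xa).2)).
Qed.

(** Cut off full-width strips below and above the hole and one block on each side of it; [goursat]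
    annihilates these four rectangles. *)
Lemma RI_hole P Q (x y w h a b t : R) : 0 < t -> x <= a - t -> a + t <= x + w ->
  y <= b - t -> b + t <= y + h -> lcont P -> lcont Q ->
  (forall X Y, x <= X <= x + w -> y <= Y <= y + h -> t <= `|X - a| \/ t <= `|Y - b| ->
     closed_at P Q X Y) ->
  RI P Q x y w h = RI P Q (a - t) (b - t) (t + t) (t + t).
Proof.
move=> t0 xa ax yb bY [P1 P2] [Q1 Q2] cl.
have G x' y' w' h' : 0 <= w' -> 0 <= h' -> x <= x' -> x' + w' <= x + w -> y <= y' -> y' + h' <= y + h ->
    (forall X Y, x' <= X <= x' + w' -> y' <= Y <= y' + h' -> t <= `|X - a| \/ t <= `|Y - b|) ->
    RI P Q x' y' w' h' = 0.
  move=> w'0 h'0 xx xw yy yh H; apply: goursat => // X Y HX HY; apply: cl; last exact: H HX HY.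
    by move: HX => /andP[? ?]; apply/andP; split; lra.
  by move: HY => /andP[? ?]; apply/andP; split; lra.
have absl (c d : R) : d <= c - t -> t <= `|d - c| by move=> H; rewrite distrC; apply: le_trans (ler_norm _); lra.
have absr (c d : R) : c + t <= d -> t <= `|d - c| by move=> H; apply: le_trans (ler_norm _); lra.
have Z1 : RI P Q x y w (b - t - y) = 0.
  apply: G; rewrite ?lexx//; [lra|lra|lra|].
  by move=> X Y _ /andP[_ H]; right; apply: absl; lra.
have Z2 : RI P Q x (b + t) w (y + h - (b + t)) = 0.
  apply: G; rewrite ?lexx//; [lra|lra|lra|lra|].
  by move=> X Y _ /andP[H _]; right; exact: absr.
have Z3 : RI P Q x (b - t) (a - t - x) (t + t) = 0.
  apply: G; rewrite ?lexx//; [lra|lra|lra|lra|].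
  by move=> X Y /andP[_ H] _; left; apply: absl; lra.
have Z4 : RI P Q (a + t) (b - t) (x + w - (a + t)) (t + t) = 0.
  apply: G; rewrite ?lexx//; [lra|lra|lra|lra|lra|].
  by move=> X Y /andP[H _] _; left; exact: absr.
have -> : RI P Q x y w h = RI P Q x y w ((b - t - y) + ((t + t) + (y + h - (b + t)))).
  by congr RI; ring.
rewrite RI_splity Z1 add0r (_ : y + (b - t - y) = b - t); last by ring.
rewrite RI_splity (_ : b - t + (t + t) = b + t) ?Z2 ?addr0; last by ring.
have -> : RI P Q x (b - t) w (t + t) =
    RI P Q x (b - t) ((a - t - x) + ((t + t) + (x + w - (a + t)))) (t + t).
  by congr RI; ring.
rewrite RI_splitx Z3 add0r (_ : x + (a - t - x) = a - t); last by ring.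
by rewrite RI_splitx (_ : a - t + (t + t) = a + t) ?Z4 ?addr0//; ring.
Qed.
End CauchyRepresentation.

Section CauchySquare.
Context {R : realType}.
Implicit Types (u v : R -> R -> R) (P Q : R -> R -> R -> R).

(** Composing with this projection extends a function controlled only on a square to a globally
    continuous one, as the line integrals require. *)
Definition clamp (c r x : R) : R := Num.max (c - r) (Num.min (c + r) x).

Variant clamp_spec (c r x : R) : R -> Prop :=
| ClampLow of x <= c - r : clamp_spec c r x (c - r)
| ClampMid of c - r <= x <= c + r : clamp_spec c r x x
| ClampHigh of c + r <= x : clamp_spec c r x (c + r).

Lemma clampP (c r x : R) : 0 <= r -> clamp_spec c r x (clamp c r x).
Proof.
move=> r0; rewrite /clamp; case: (leP (c + r) x) => h; case: (leP (c - r)) => h'.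
- by constructor.
- by exfalso; lra.
- by constructor; rewrite h' ltW.
- by constructor; rewrite ltW.
Qed.

Lemma clamp_in (c r x : R) : 0 <= r -> `|clamp c r x - c| <= r.
Proof. by move=> r0; rewrite ler_norml; case: (clampP c x r0); lra. Qed.

Lemma clamp_id (c r x : R) : `|x - c| <= r -> clamp c r x = x.
Proof.
move=> xr; have r0 : 0 <= r by exact: le_trans xr.
by move: xr; rewrite ler_norml; case: (clampP c x r0); lra.
Qed.

Lemma clamp_lip (c r x y : R) : 0 <= r -> `|clamp c r x - clamp c r y| <= `|x - y|.
Proof.
move=> r0; have := ler_norm (x - y); have := ler_norm (y - x); rewrite (distrC y) => h1 h2.
by rewrite ler_norml; case: (clampP c x r0); case: (clampP c y r0); lra.
Qed.

Lemma pt2E0 (x y : R) : pt2 (x, y) 0 0 = x.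
Proof. by rewrite mxE. Qed.

Lemma pt2E1 (x y : R) : pt2 (x, y) 0 1 = y.
Proof. by rewrite mxE. Qed.

Lemma coord_pt2_0 (x y : R) (z : 'rV[R]_2) : `|x - z 0 0| <= enorm (pt2 (x, y) - z).
Proof. by have := coord_le_enorm (pt2 (x, y) - z) 0; rewrite !mxE. Qed.

Lemma coord_pt2_1 (x y : R) (z : 'rV[R]_2) : `|y - z 0 1| <= enorm (pt2 (x, y) - z).
Proof. by have := coord_le_enorm (pt2 (x, y) - z) 1; rewrite !mxE. Qed.

Lemma pt2_eta (z : 'rV[R]_2) : pt2 (z 0 0, z 0 1) = z.
Proof.
apply/rowP => i; rewrite mxE /=; case: eqP => [->//|/eqP i0]; congr (z 0 _).
by case: i i0 => [[|[|//]]] pi i0; exact: val_inj.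
Qed.

Lemma cker_shift_diff (rho : R) j (z p : 'rV[R]_2) : 0 < rho ->
  differentiable (fun q => cker rho j (q - z)) p.
Proof.
move=> r0; apply: (@differentiable_comp _ _ _ _ (fun q => q - z) (cker rho j)).
  by apply: differentiableB; [exact: ex_diff|exact: differentiable_cst].
by have [] := SM_derive (SM_cker r0 j).
Qed.

Lemma lcont_cker (rho : R) j (z : 'rV[R]_2) : 0 < rho -> lcont (fun x y => cker rho j (pt2 (x, y) - z)).
Proof.
by move=> r0; apply: (@differentiable_lcont _ (fun q => cker rho j (q - z))) => p; exact: cker_shift_diff.
Qed.

Lemma hol_at_cker (rho : R) (z : 'rV[R]_2) X Y : 0 < rho -> rho < enorm (pt2 (X, Y) - z) ->
  hol_at (fun x y => cker rho 0 (pt2 (x, y) - z)) (fun x y => - cker rho 1 (pt2 (x, y) - z)) X Y.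
Proof.
move=> r0 rz; set q := pt2 (X, Y) - z in rz *.
have L j := differentiable_lin_at (@cker_shift_diff rho j z (pt2 (X, Y)) r0).
have D i j : 'D_(e_ i) (fun q => cker rho j (q - z)) (pt2 (X, Y)) =
    (i == j)%:R * (cker rho 0 q * cker rho 0 q + cker rho 1 q * cker rho 1 q) - 2 * (cker rho i q * cker rho j q).
  have dk : derivable (cker rho j) q (e_ i).
    by apply: diff_derivable; have [] := SM_derive (SM_cker r0 j).
  have [_ E] := @is_derive_translate R 2 (cker rho j) (pt2 (X, Y)) (- z) (e_ i) dk.
  rewrite -[RHS](derive_cker r0 i j rz); exact: E.
have LE g p p' s s' : p = p' -> s = s' -> lin_at g X Y p s -> lin_at g X Y p' s' by move=> -> ->.
exists (cker rho 1 q * cker rho 1 q - cker rho 0 q * cker rho 0 q), (2 * (cker rho 0 q * cker rho 1 q)).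
split; first by apply: LE (L 0); rewrite D /=; ring.
have := lin_atM (lin_at_cst (-1) X Y) (L 1).
have -> : (fun x y => -1 * cker rho 1 (pt2 (x, y) - z)) = (fun x y => - cker rho 1 (pt2 (x, y) - z)).
  by apply/funext => x; apply/funext => y; rewrite mulN1r.
by apply: LE; rewrite D /=; ring.
Qed.

Lemma cker_le (t rho : R) j (q : 'rV[R]_2) : 0 < t -> rho <= t -> t <= enorm q -> 0 < rho ->
  `|cker rho j q| <= t^-1.
Proof.
move=> t0 rt tq r0; have q0 : 0 < enorm q by exact: lt_le_trans tq.
rewrite ckerE ?(le_trans rt)// sqdistE subr0 normrM normfV (ger0_norm (x := _ ^+ 2)) ?sqr_ge0//.
apply: (@le_trans _ _ (enorm q)^-1); last by rewrite lef_pV2 ?posrE.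
rewrite expr2 invfM mulrA ler_piMl ?invr_ge0 ?(ltW q0)// ler_pdivrMr// mul1r.
exact: coord_le_enorm.
Qed.

Variables (X0 Y0 L : R) (z : 'rV[R]_2).
Hypotheses (L0 : 0 < L) (zX : `|z 0 0 - X0| <= L / 2) (zY : `|z 0 1 - Y0| <= L / 2).

Lemma outer_far0 (x y : R) : x = X0 - L \/ x = X0 + L -> L / 2 <= enorm (pt2 (x, y) - z).
Proof.
move=> H; apply: le_trans (coord_pt2_0 x y z).
move: zX; rewrite ler_norml => /andP[h1 h2]; rewrite ler_normr.
by case: H => ->; apply/orP; [right|left]; lra.
Qed.

Lemma outer_far1 (x y : R) : y = Y0 - L \/ y = Y0 + L -> L / 2 <= enorm (pt2 (x, y) - z).
Proof.
move=> H; apply: le_trans (coord_pt2_1 x y z).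
move: zY; rewrite ler_norml => /andP[h1 h2]; rewrite ler_normr.
by case: H => ->; apply/orP; [right|left]; lra.
Qed.

(** [rho] is the radius inside which the kernel is smoothed; forms for two radii agree outside both
    discs. On the outer contour L/4 may thus be replaced by t/2, after which the contour shrinks to
    a square of half side t. There the integrand stays below M while the length tends to 0. *)
Lemma cauchy_hole P Q (M d : R) : 0 < d ->
  (forall rho : R, 0 < rho -> lcont (P rho) /\ lcont (Q rho)) ->
  (forall rho X Y : R, 0 < rho -> rho < enorm (pt2 (X, Y) - z) ->
     `|X - X0| <= L -> `|Y - Y0| <= L -> closed_at (P rho) (Q rho) X Y) ->
  (forall rho rho' x y : R, 0 < rho -> 0 < rho' -> rho <= enorm (pt2 (x, y) - z) ->
     rho' <= enorm (pt2 (x, y) - z) -> P rho x y = P rho' x y /\ Q rho x y = Q rho' x y) ->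
  (forall t x y : R, 0 < t < d -> `|x - z 0 0| <= t -> `|y - z 0 1| <= t ->
     t <= enorm (pt2 (x, y) - z) -> `|P (t / 2) x y| <= M /\ `|Q (t / 2) x y| <= M) ->
  RI (P (L / 4)) (Q (L / 4)) (X0 - L) (Y0 - L) (L + L) (L + L) = 0.
Proof.
move=> d0 PQc PQcl PQe PQb.
have bound (t : R) : 0 < t < Num.min d (L / 2) ->
    `|RI (P (L / 4)) (Q (L / 4)) (X0 - L) (Y0 - L) (L + L) (L + L)| <= 4 * M * (t + t).
  rewrite lt_min => /andP[t0 /andP[td tL]].
  have t2 : 0 < t / 2 by rewrite divr_gt0.
  have L4 : 0 < L / 4 by rewrite divr_gt0.
  have LL : 0 <= L + L by lra.
  have [P1 Q1] := PQc _ L4; have [P2 Q2] := PQc _ t2.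
  have E1 : X0 - L + (L + L) = X0 + L by ring.
  have E2 : Y0 - L + (L + L) = Y0 + L by ring.
  have O0 (x y : R) : x = X0 - L \/ x = X0 + L -> P (L / 4) x y = P (t / 2) x y /\ Q (L / 4) x y = Q (t / 2) x y.
    by move=> /(@outer_far0 x y) H; apply: PQe => //; apply: le_trans H; lra.
  have O1 (x y : R) : y = Y0 - L \/ y = Y0 + L -> P (L / 4) x y = P (t / 2) x y /\ Q (L / 4) x y = Q (t / 2) x y.
    by move=> /(@outer_far1 x y) H; apply: PQe => //; apply: le_trans H; lra.
  rewrite (@eq_RI _ (P (L / 4)) (Q (L / 4)) (P (t / 2)) (Q (t / 2)))//; first last.
  - move=> b _; rewrite E1; split; first by have [_] := O0 (X0 + L) b (or_intror erefl).
    by have [_] := O0 (X0 - L) b (or_introl erefl).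
  - move=> a _; rewrite E2; split; first by have [] := O1 a (Y0 - L) (or_introl erefl).
    by have [] := O1 a (Y0 + L) (or_intror erefl).
  move: (zX); rewrite ler_norml => /andP[x1 x2]; move: (zY); rewrite ler_norml => /andP[y1 y2].
  rewrite (@RI_hole _ _ _ _ _ _ _ (z 0 0) (z 0 1) t)//; [|lra|lra|lra|lra|].
    have I0 (x y : R) : `|x - z 0 0| = t -> `|y - z 0 1| <= t ->
        `|P (t / 2) x y| <= M /\ `|Q (t / 2) x y| <= M.
      move=> xt yt; apply: PQb => //; rewrite ?t0 ?xt//.
      by rewrite -xt; exact: coord_pt2_0.
    have I1 (x y : R) : `|x - z 0 0| <= t -> `|y - z 0 1| = t ->
        `|P (t / 2) x y| <= M /\ `|Q (t / 2) x y| <= M.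
      move=> xt yt; apply: PQb => //; rewrite ?t0 ?yt//.
      by rewrite -yt; exact: coord_pt2_1.
    have A1 (c : R) : `|c - t - c| = t by rewrite addrAC subrr add0r normrN gtr0_norm.
    have A2 (c : R) : `|c - t + (t + t) - c| = t.
      by rewrite (_ : _ - c = t) ?gtr0_norm//; ring.
    have A3 (a c : R) : c - t <= a <= c - t + (t + t) -> `|a - c| <= t.
      by move=> /andP[? ?]; rewrite ler_norml; apply/andP; split; lra.
    apply: RI_bound => //; first lra.
      by move=> a /A3 Ha; split; [have [] := I1 a _ Ha (A1 _)|have [] := I1 a _ Ha (A2 _)].
    by move=> b /A3 Hb; split; [have [] := I0 _ b (A2 _) Hb|have [] := I0 _ b (A1 _) Hb].
  move=> X Y; rewrite E1 E2 => /andP[? ?] /andP[? ?] H.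
  apply: PQcl => //; last 2 first.
  - by rewrite ler_norml; apply/andP; split; lra.
  - by rewrite ler_norml; apply/andP; split; lra.
  have t2t : t / 2 < t by lra.
  case: H => /(lt_le_trans t2t) H; apply: lt_le_trans H _; [exact: coord_pt2_0|exact: coord_pt2_1].
apply/eqP; rewrite -normr_le0; apply/ler_addgt0Pr => e e0; rewrite add0r.
have M1 : 0 < 8 * (`|M| + 1) by rewrite mulr_gt0// ltr_wpDl.
pose t := Num.min (Num.min d (L / 2)) (e / (8 * (`|M| + 1))) / 2.
have m0 : 0 < Num.min (Num.min d (L / 2)) (e / (8 * (`|M| + 1))).
  by rewrite !lt_min d0 !divr_gt0.
have t0 : 0 < t by rewrite divr_gt0.
have tm : t < Num.min (Num.min d (L / 2)) (e / (8 * (`|M| + 1))).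
  by rewrite /t ltr_pdivrMr// ltr_pMr// ltr1n.
have /bound/le_trans : 0 < t < Num.min d (L / 2).
  by rewrite t0 (lt_le_trans tm)// ge_min lexx.
apply; apply: (@le_trans _ _ (t * (8 * (`|M| + 1)))).
  by have := ler_norm M; have := t0; nra.
by rewrite -ler_pdivlMr// (le_trans (ltW tm))// ge_min lexx orbT.
Qed.
End CauchySquare.

(** * Cauchy's formula and bounds of all orders *)

Section CauchyDB.
Context {R : realType}.

Lemma itgB (g h : R -> R) a b : continuous g -> continuous h ->
  itg (fun x => g x - h x) a b = itg g a b - itg h a b.
Proof.
move=> cg ch; have ch' : continuous (fun x => -1 * h x).
  by move=> x; apply: cvgMl_tmp; exact: ch.
have := itgD a b cg ch'; rewrite itgZ// mulN1r => <-.
by congr itg; apply/funext => x; rewrite mulN1r.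
Qed.

(** Differences in the parameter commute with the integral by linearity; nothing is differentiated
    under the integral sign. *)
Lemma bdiff_itg n N C (K : R -> 'rV[R]_n -> R) (a b : R) : a <= b ->
  (forall z, continuous (K^~ z)) -> (forall x, a <= x <= b -> bdiff N C (K x)) ->
  bdiff N (C * (b - a)) (fun z => itg (K^~ z) a b).
Proof.
move=> ab cK HK us p sus.
have cD : forall vs q, continuous (fun x => fdiffs vs (K x) q).
  elim=> [|v vs IH] q; first exact: cK.
  by move=> x; apply: cvgB; exact: IH.
have -> : fdiffs us (fun z => itg (K^~ z) a b) p = itg (fun x => fdiffs us (K x) p) a b.
  elim: us p {sus} => [//|v vs IH] p /=.
  by rewrite /fdiff !IH -itgB.
rewrite mulrAC; apply: itg_bound => // x xab; exact: HK.
Qed.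

Lemma continuous_bounded_itv (g : R -> R) (a b : R) : a <= b -> continuous g ->
  exists M : R, forall x, a <= x <= b -> `|g x| <= M.
Proof.
move=> ab cg; have cn : {within `[a, b], continuous (fun x => `|g x|)}.
  by apply: continuous_subspaceT => x; apply: cvg_norm; exact: cg.
have [c _ Hc] := EVT_max ab cn; exists `|g c| => x xab; apply: Hc.
by rewrite in_itv.
Qed.

(** The parameter z enters through the smoothed kernel alone, so merely continuous densities [al]
    and [be] yield bounds of every order. *)
Lemma DB_itg_cker N (a b rho : R) (al be : R -> R) (q : R -> 'rV[R]_2) : 0 < rho -> a <= b ->
  continuous al -> continuous be ->
  (forall j z, continuous (fun x => cker rho j (q x - z))) ->
  DB N (fun z => itg (fun x => al x * cker rho 0 (q x - z) + be x * cker rho 1 (q x - z)) a b).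
Proof.
move=> r0 ab ca cb cq.
have [M HM] := continuous_bounded_itv ab ca; have [M' HM'] := continuous_bounded_itv ab cb.
have [C0 H0] := DB_cker r0 N 0; have [C1 H1] := DB_cker r0 N 1.
exists ((M * C0 + M' * C1) * (b - a)).
apply: (@bdiff_itg _ _ _ (fun x z => al x * cker rho 0 (q x - z) + be x * cker rho 1 (q x - z))) => //.
  by move=> z x; apply: cvgD; apply: cvgM; (exact: ca || exact: cb || exact: cq).
move=> x xab; apply: bdiff_le (leqnn N) _ (bdiffD (bdiffZ (al x) (bdiff_reflect (q x) H0))
  (bdiffZ (be x) (bdiff_reflect (q x) H1))).
by apply: lerD; apply: ler_wpM2r; rewrite ?HM ?HM' ?(bdiff_ge0 H0) ?(bdiff_ge0 H1).
Qed.

Lemma RI_comb (P Q P1 Q1 P2 Q2 : R -> R -> R) (c d x y w h : R) :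
  lcont P -> lcont Q -> lcont P1 -> lcont Q1 -> lcont P2 -> lcont Q2 ->
  RI P Q x y w h + (c * RI P1 Q1 x y w h + d * RI P2 Q2 x y w h) =
  RI (fun a b => P a b + (c * P1 a b + d * P2 a b)) (fun a b => Q a b + (c * Q1 a b + d * Q2 a b)) x y w h.
Proof.
move=> *; have lZ e w' : lcont w' -> lcont (fun x y => e * w' x y).
  by apply: lcontM; exact: lcont_cst.
by rewrite RID ?RID ?RIZ//; try exact: lZ; apply: lcontD; exact: lZ.
Qed.

Lemma half_convex (t s : R) : 0 <= t -> t <= 1 -> 1 / 2 <= s -> 1 / 2 <= t * s + (1 - t).
Proof. by move=> *; nra. Qed.

Lemma four_sides (a b c d : R) : 2 / 9 <= a -> 2 / 9 <= -1 * b -> 2 / 9 <= c -> 2 / 9 <= -1 * d ->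
  8 / 9 <= a - b + (c - d).
Proof. by move=> *; lra. Qed.

Section SideBounds.
Variables (X0 Y0 L : R) (z : 'rV[R]_2).
Hypotheses (L0 : 0 < L) (zX : `|z 0 0 - X0| <= L / 2) (zY : `|z 0 1 - Y0| <= L / 2).

(** The numerator is at least L/2, and both coordinates are at most 3L/2, so the squared distance is
    at most 9L^2/2; the quotient is at least 1/(9L). *)
Lemma cker_side j (x y : R) : L / 2 <= enorm (pt2 (x, y) - z) -> `|x - X0| <= L -> `|y - Y0| <= L ->
  L / 2 <= (pt2 (x, y) - z) 0 j -> (9 * L)^-1 <= cker (L / 4) j (pt2 (x, y) - z).
Proof.
move=> far xX yY; move: (zX) (zY) (L0) xX yY; rewrite !ler_norml.
move=> /andP[x1 x2] /andP[y1 y2] Lp /andP[x3 x4] /andP[y3 y4] jL.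
have s0 : 0 < sqdist 0 (pt2 (x, y) - z) by rewrite sqdistE subr0 exprn_gt0//; lra.
rewrite ckerE; [|by rewrite divr_gt0|by lra].
rewrite ler_pdivlMr//; apply: le_trans jL; rewrite mulrC ler_pdivrMr; last by rewrite mulr_gt0.
rewrite sqdist2E !mxE /=.
have A : (x - z 0 0) * (x - z 0 0) <= (3 / 2 * L) * (3 / 2 * L) by clear -x1 x2 x3 x4 Lp; nra.
have B : (y - z 0 1) * (y - z 0 1) <= (3 / 2 * L) * (3 / 2 * L) by clear -y1 y2 y3 y4 Lp; nra.
clear -A B; lra.
Qed.

Lemma cker_sideN j (x y : R) : L / 2 <= enorm (pt2 (x, y) - z) -> `|x - X0| <= L -> `|y - Y0| <= L ->
  L / 2 <= - (pt2 (x, y) - z) 0 j -> (9 * L)^-1 <= -1 * cker (L / 4) j (pt2 (x, y) - z).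
Proof.
move=> far xX yY; move: (zX) (zY) (L0) xX yY; rewrite !ler_norml.
move=> /andP[x1 x2] /andP[y1 y2] Lp /andP[x3 x4] /andP[y3 y4] jL.
have s0 : 0 < sqdist 0 (pt2 (x, y) - z) by rewrite sqdistE subr0 exprn_gt0//; lra.
rewrite ckerE; [|by rewrite divr_gt0|by lra].
rewrite mulN1r -mulNr.
rewrite ler_pdivlMr//; apply: le_trans jL; rewrite mulrC ler_pdivrMr; last by rewrite mulr_gt0.
rewrite sqdist2E !mxE /=.
have A : (x - z 0 0) * (x - z 0 0) <= (3 / 2 * L) * (3 / 2 * L) by clear -x1 x2 x3 x4 Lp; nra.
have B : (y - z 0 1) * (y - z 0 1) <= (3 / 2 * L) * (3 / 2 * L) by clear -y1 y2 y3 y4 Lp; nra.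
clear -A B; lra.
Qed.
End SideBounds.

Variables (u v : R -> R -> R) (X0 Y0 L : R).
Hypotheses (L0 : 0 < L) (Hh : forall X Y, `|X - X0| <= 2 * L -> `|Y - Y0| <= 2 * L -> hol_at u v X Y).

(** Holomorphy is assumed on half side 2L while the contours have half side L; thanks to this margin
    the clamped functions agree with [u] and [v] near every point enclosed by the contour. *)
Let uc x y := u (clamp X0 (2 * L) x) (clamp Y0 (2 * L) y).
Let vc x y := v (clamp X0 (2 * L) x) (clamp Y0 (2 * L) y).

Let L2 : 0 <= 2 * L. Proof. by rewrite mulr_ge0// ltW. Qed.
Let L4 : 0 < L / 4. Proof. by rewrite divr_gt0. Qed.

Let lcont_clamp w : (forall X Y, `|X - X0| <= 2 * L -> `|Y - Y0| <= 2 * L -> exists p q, lin_at w X Y p q) ->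
  lcont (fun x y => w (clamp X0 (2 * L) x) (clamp Y0 (2 * L) y)).
Proof.
move=> Hw; apply: eps_lcont => X Y e e0.
have [p [q Hl]] := Hw _ _ (clamp_in X0 X L2) (clamp_in Y0 Y L2).
have [d d0 Hd] := lin_at_cont Hl e0; exists d => // s t sd td.
have := Hd (clamp X0 (2 * L) (X + s) - clamp X0 (2 * L) X) (clamp Y0 (2 * L) (Y + t) - clamp Y0 (2 * L) Y).
rewrite !subrKC; apply.
  by apply: le_lt_trans (clamp_lip _ _ _ L2) _; rewrite addrAC subrr add0r.
by apply: le_lt_trans (clamp_lip _ _ _ L2) _; rewrite addrAC subrr add0r.
Qed.

Let lcont_uc : lcont uc.
Proof. by apply: lcont_clamp => X Y HX HY; have [a [b [H _]]] := Hh HX HY; exists a, (- b). Qed.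
Let lcont_vc : lcont vc.
Proof. by apply: lcont_clamp => X Y HX HY; have [a [b [_ H]]] := Hh HX HY; exists b, a. Qed.

Let hol_uc X Y : `|X - X0| <= L -> `|Y - Y0| <= L -> hol_at uc vc X Y.
Proof.
move=> HX HY; have LL : L <= 2 * L by rewrite ler_peMl ?ler1n ?(ltW L0).
have [a [b [Hu Hv]]] := Hh (le_trans HX LL) (le_trans HY LL).
have E : exists2 d : R, 0 < d & forall s t : R, `|s| < d -> `|t| < d ->
    uc (X + s) (Y + t) = u (X + s) (Y + t) /\ vc (X + s) (Y + t) = v (X + s) (Y + t).
  exists L => // s t sL tL; have Lp := L0; rewrite /uc /vc !clamp_id//.
    by have := ler_normD (Y - Y0) t; rewrite addrAC; lra.
  by have := ler_normD (X - X0) s; rewrite addrAC; lra.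
exists a, b; split.
  by apply: lin_at_local Hu; have [d d0 Hd] := E; exists d => // s t sd td; have [] := Hd s t sd td.
by apply: lin_at_local Hv; have [d d0 Hd] := E; exists d => // s t sd td; have [] := Hd s t sd td.
Qed.

Let RK (al be ga de : R -> R -> R) (z : 'rV[R]_2) : R :=
  RI (fun x y => al x y * cker (L / 4) 0 (pt2 (x, y) - z) + be x y * cker (L / 4) 1 (pt2 (x, y) - z))
     (fun x y => ga x y * cker (L / 4) 0 (pt2 (x, y) - z) + de x y * cker (L / 4) 1 (pt2 (x, y) - z))
     (X0 - L) (Y0 - L) (L + L) (L + L).

Let DB_RK N al be ga de : lcont al -> lcont be -> lcont ga -> lcont de -> DB N (RK al be ga de).
Proof.
move=> [a1 a2] [b1 b2] [g1 g2] [d1 d2]; have Lp := L0.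
have xL : X0 - L <= X0 - L + (L + L) by lra.
have yL : Y0 - L <= Y0 - L + (L + L) by lra.
have c1 y j z := (lcont_cker j z L4).1 y; have c2 x j z := (lcont_cker j z L4).2 x.
apply: DBD.
  apply: DBB.
    exact: (@DB_itg_cker N _ _ _ (al^~ (Y0 - L)) (be^~ (Y0 - L)) (fun x => pt2 (x, Y0 - L))).
  exact: (@DB_itg_cker N _ _ _ (al^~ (Y0 - L + (L + L))) (be^~ (Y0 - L + (L + L))) (fun x => pt2 (x, Y0 - L + (L + L)))).
apply: DBB.
  exact: (@DB_itg_cker N _ _ _ (ga (X0 - L + (L + L))) (de (X0 - L + (L + L))) (fun y => pt2 (X0 - L + (L + L), y))).
exact: (@DB_itg_cker N _ _ _ (ga (X0 - L)) (de (X0 - L)) (fun y => pt2 (X0 - L, y))).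
Qed.

Let one : R -> R -> R := fun _ _ => 1.
Let zero : R -> R -> R := fun _ _ => 0.
Let mone : R -> R -> R := fun _ _ => -1.
(** With f = uc + i vc, [A1 + i A2] is the contour integral of f(zeta)/(zeta - z) and [C1 + i C2]
    that of 1/(zeta - z), the kernel being smoothed at radius L/4, away from the contour. *)
Let A1 := RK uc vc (fun x y => - vc x y) uc.
Let A2 := RK vc (fun x y => - uc x y) uc vc.
Let C1 := RK one zero zero one.
Let C2 := RK zero mone one zero.

Let inner (z : 'rV[R]_2) := `|z 0 0 - X0| <= L / 2 /\ `|z 0 1 - Y0| <= L / 2.

Let lcont_ker al be z : lcont al -> lcont be ->
  lcont (fun x y => al x y * cker (L / 4) 0 (pt2 (x, y) - z) + be x y * cker (L / 4) 1 (pt2 (x, y) - z)).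
Proof. by move=> Ha Hb; apply: lcontD; apply: lcontM => //; exact: lcont_cker. Qed.

(** (f(zeta) - f(z))/(zeta - z) is bounded near z, so [cauchy_hole] annihilates its contour
    integral. The factor [C1 + i C2] is left as it stands instead of being evaluated to 2 pi i. *)
Let cauchy_formula z : inner z ->
  A1 z = uc (z 0 0) (z 0 1) * C1 z - vc (z 0 0) (z 0 1) * C2 z /\
  A2 z = vc (z 0 0) (z 0 1) * C1 z + uc (z 0 0) (z 0 1) * C2 z.
Proof.
move=> [zX zY]; have Lp := L0; set ua := uc _ _; set va := vc _ _.
pose k rho j x y := cker rho j (pt2 (x, y) - z) : R.
pose G1 rho x y := (uc x y - ua) * k rho 0 x y - (vc x y - va) * (- k rho 1 x y).
pose G2 rho x y := (uc x y - ua) * (- k rho 1 x y) + (vc x y - va) * k rho 0 x y.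
have lk (rho : R) j : 0 < rho -> lcont (k rho j) by exact: lcont_cker.
have lu : lcont (fun x y => uc x y - ua) by apply: lcontD => //; exact: lcont_cst.
have lv : lcont (fun x y => vc x y - va) by apply: lcontD => //; exact: lcont_cst.
have lG1 (rho : R) : 0 < rho -> lcont (G1 rho).
  by move=> r0; apply: lcontD; [apply: lcontM|apply: lcontN; apply: lcontM => //; apply: lcontN] => //; exact: lk.
have lG2 (rho : R) : 0 < rho -> lcont (G2 rho).
  by move=> r0; apply: lcontD; apply: lcontM => //; [apply: lcontN|]; exact: lk.
have hG (rho X Y : R) : 0 < rho -> rho < enorm (pt2 (X, Y) - z) -> `|X - X0| <= L -> `|Y - Y0| <= L ->
    hol_at (G1 rho) (G2 rho) X Y.
  move=> r0 rz HX HY; apply: hol_at_mul; last exact: hol_at_cker.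
  have [a [b [Hu Hv]]] := hol_uc HX HY; exists a, b; split.
    have := lin_atD Hu (lin_at_cst (- ua) X Y); by rewrite !addr0.
  have := lin_atD Hv (lin_at_cst (- va) X Y); by rewrite !addr0.
have eG (rho rho' x y : R) : 0 < rho -> 0 < rho' -> rho <= enorm (pt2 (x, y) - z) ->
    rho' <= enorm (pt2 (x, y) - z) -> G1 rho x y = G1 rho' x y /\ G2 rho x y = G2 rho' x y.
  by move=> r0 r0' h h'; rewrite /G1 /G2 /k !ckerE.
have zXL : `|z 0 0 - X0| <= L by move: zX; lra.
have zYL : `|z 0 1 - Y0| <= L by move: zY; lra.
have [a [b [/lin_at_lip[d1 d10 Hd1] /lin_at_lip[d2 d20 Hd2]]]] := hol_uc zXL zYL.
set M1 := 1 + _ + _ in Hd1; set M2 := 1 + _ + _ in Hd2.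
have M10 : 0 <= M1 by rewrite !addr_ge0.
have M20 : 0 <= M2 by rewrite !addr_ge0.
(* The increments of uc and vc are at most M1 * 2t and M2 * 2t, and the kernel is at most 1/t. *)
have bG (t x y : R) : 0 < t < Num.min d1 d2 -> `|x - z 0 0| <= t -> `|y - z 0 1| <= t ->
     t <= enorm (pt2 (x, y) - z) ->
     `|G1 (t / 2) x y| <= 2 * M1 + 2 * M2 /\ `|G2 (t / 2) x y| <= 2 * M1 + 2 * M2.
  rewrite lt_min => /andP[t0 /andP[td1 td2]] xt yt tz.
  have t2 : 0 < t / 2 by rewrite divr_gt0.
  have t2t : t / 2 <= t by lra.
  have B1 : `|uc x y - ua| <= M1 * (2 * t).
    have := Hd1 _ _ (le_lt_trans xt td1) (le_lt_trans yt td1); rewrite !subrKC => /le_trans; apply.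
    by rewrite ler_wpM2l//; lra.
  have B2 : `|vc x y - va| <= M2 * (2 * t).
    have := Hd2 _ _ (le_lt_trans xt td2) (le_lt_trans yt td2); rewrite !subrKC => /le_trans; apply.
    by rewrite ler_wpM2l//; lra.
  have K j : `|k (t / 2) j x y| <= t^-1 by exact: cker_le.
  have T (w c m : R) : `|w| <= m * (2 * t) -> `|c| <= t^-1 -> `|w * c| <= 2 * m.
    move=> Hw Hc; rewrite normrM; apply: (@le_trans _ _ (m * (2 * t) * t^-1)); first exact: ler_pM.
    by rewrite le_eqVlt; apply/orP; left; apply/eqP; field; rewrite gt_eqF.
  split; first apply: le_trans (ler_normB _ _) _; last apply: le_trans (ler_normD _ _) _.
    by apply: lerD; apply: T; rewrite ?normrN.
  by apply: lerD; apply: T; rewrite ?normrN.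
have dd : 0 < Num.min d1 d2 by rewrite lt_min d10.
have l1 : lcont one by exact: lcont_cst. have l0 : lcont zero by exact: lcont_cst.
have l2 : lcont mone by exact: lcont_cst.
have Z1 : RI (G1 (L / 4)) (fun x y => - G2 (L / 4) x y) (X0 - L) (Y0 - L) (L + L) (L + L) = 0.
  apply: (@cauchy_hole _ _ _ _ z L0 zX zY G1 (fun rho x y => - G2 rho x y) (2 * M1 + 2 * M2) _ dd).
  - by move=> rho r0; split; [exact: lG1|apply: lcontN; exact: lG2].
  - by move=> rho X Y r0 rz HX HY; have [] := hol_at_closed (hG _ _ _ r0 rz HX HY).
  - by move=> rho rho' x y r0 r0' h h'; have [-> ->] := eG _ _ _ _ r0 r0' h h'.
  - by move=> t x y td xt yt tz; rewrite normrN; exact: bG.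
have Z2 : RI (G2 (L / 4)) (G1 (L / 4)) (X0 - L) (Y0 - L) (L + L) (L + L) = 0.
  apply: (@cauchy_hole _ _ _ _ z L0 zX zY G2 G1 (2 * M1 + 2 * M2) _ dd).
  - by move=> rho r0; split; [exact: lG2|exact: lG1].
  - by move=> rho X Y r0 rz HX HY; have [] := hol_at_closed (hG _ _ _ r0 rz HX HY).
  - by move=> rho rho' x y r0 r0' h h'; have [-> ->] := eG _ _ _ _ r0 r0' h h'.
  - by move=> t x y td xt yt tz; have [] := bG t x y td xt yt tz.
have lN w : lcont w -> lcont (fun x y => - w x y) by exact: lcontN.
have kk al be := @lcont_ker al be z.
split.
  have : A1 z + ((- ua) * C1 z + va * C2 z) = 0.
    rewrite -Z1 /A1 /C1 /C2 /RK RI_comb; try by apply: kk => //; exact: lN.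
    by congr RI; apply/funext => x; apply/funext => y; rewrite /G1 /G2 /k /one /zero /mone; ring.
  by move: (A1 z) (C1 z) (C2 z) => a1 c1 c2; lra.
have : A2 z + ((- va) * C1 z + (- ua) * C2 z) = 0.
  rewrite -Z2 /A2 /C1 /C2 /RK RI_comb; try by apply: kk => //; exact: lN.
  by congr RI; apply/funext => x; apply/funext => y; rewrite /G1 /G2 /k /one /zero /mone; ring.
by move: (A2 z) (C1 z) (C2 z) => a2 c1 c2; lra.
Qed.

(** Each of the four sides, of length 2L, contributes at least 2L/(9L) = 2/9; this crude bound is
    enough to divide by [C1 + i C2]. *)
Let C2_ge z : inner z -> 8 / 9 <= C2 z.
Proof.
move=> [zX zY]; have Lp := L0; move: (zX) (zY); rewrite !ler_norml => /andP[x1 x2] /andP[y1 y2].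
have F1 : L / 2 <= - (Y0 - L - z 0 1) by lra.
have F2 : L / 2 <= Y0 + L - z 0 1 by lra.
have F3 : L / 2 <= X0 + L - z 0 0 by lra.
have F4 : L / 2 <= - (X0 - L - z 0 0) by lra.
pose m := (9 * L)^-1.
have m0 : 0 < m by rewrite invr_gt0 mulr_gt0.
have E1 : X0 - L + (L + L) = X0 + L by ring.
have E2 : Y0 - L + (L + L) = Y0 + L by ring.
have xL : X0 - L <= X0 + L by lra.
have yL : Y0 - L <= Y0 + L by lra.
have ab (c x : R) : c - L <= x <= c + L -> `|x - c| <= L.
  by move=> /andP[? ?]; rewrite ler_norml; apply/andP; split; lra.
have aL (c : R) : `|c - L - c| <= L by rewrite addrAC subrr add0r normrN gtr0_norm.
have aR (c : R) : `|c + L - c| <= L by rewrite addrAC subrr add0r gtr0_norm.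
have l1 : lcont one by exact: lcont_cst. have l0 : lcont zero by exact: lcont_cst.
have l2 : lcont mone by exact: lcont_cst.
have [p1 p2] := lcont_ker z l0 l2; have [q1 q2] := lcont_ker z l1 l0.
have neg (g : R -> R) : continuous g -> continuous (fun x => -1 * g x).
  by move=> cg x; apply: cvgMl_tmp; exact: cg.
rewrite /C2 /RK /RI E1 E2.
have B1 := itg_ge (p1 (Y0 - L)) xL (m := m).
have B2 := itg_ge (neg _ (p1 (Y0 + L))) xL (m := m).
have B3 := itg_ge (q2 (X0 + L)) yL (m := m).
have B4 := itg_ge (neg _ (q2 (X0 - L))) yL (m := m).
rewrite itgZ// in B2; rewrite itgZ// in B4.
have mE : m * (X0 + L - (X0 - L)) = 2 / 9 by rewrite /m; field; rewrite gt_eqF.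
have mE' : m * (Y0 + L - (Y0 - L)) = 2 / 9 by rewrite /m; field; rewrite gt_eqF.
rewrite mE in B1 B2; rewrite mE' in B3 B4.
have T1 x : `|x - X0| <= L -> m <= -1 * cker (L / 4) 1 (pt2 (x, Y0 - L) - z).
  move=> xx; apply: (cker_sideN L0 zX zY (outer_far1 zY x (or_introl erefl)) xx (aL _)).
  by rewrite !mxE /=; exact: F1.
have T2 x : `|x - X0| <= L -> m <= cker (L / 4) 1 (pt2 (x, Y0 + L) - z).
  move=> xx; apply: (cker_side L0 zX zY (outer_far1 zY x (or_intror erefl)) xx (aR _)).
  by rewrite !mxE /=; exact: F2.
have T3 y : `|y - Y0| <= L -> m <= cker (L / 4) 0 (pt2 (X0 + L, y) - z).
  move=> yy; apply: (cker_side L0 zX zY (outer_far0 zX y (or_intror erefl)) (aR _) yy).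
  by rewrite !mxE /=; exact: F3.
have T4 y : `|y - Y0| <= L -> m <= -1 * cker (L / 4) 0 (pt2 (X0 - L, y) - z).
  move=> yy; apply: (cker_sideN L0 zX zY (outer_far0 zX y (or_introl erefl)) (aL _) yy).
  by rewrite !mxE /=; exact: F4.
have {}B1 : 2 / 9 <= itg (fun x => zero x (Y0 - L) * cker (L / 4) 0 (pt2 (x, Y0 - L) - z) +
    mone x (Y0 - L) * cker (L / 4) 1 (pt2 (x, Y0 - L) - z)) (X0 - L) (X0 + L).
  by apply: B1 => x /ab /T1; rewrite /zero /mone mul0r add0r.
have {}B2 : 2 / 9 <= -1 * itg (fun x => zero x (Y0 + L) * cker (L / 4) 0 (pt2 (x, Y0 + L) - z) +
    mone x (Y0 + L) * cker (L / 4) 1 (pt2 (x, Y0 + L) - z)) (X0 - L) (X0 + L).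
  by apply: B2 => x /ab /T2; rewrite /zero /mone mul0r add0r mulrA mulN1r opprK mul1r.
have {}B3 : 2 / 9 <= itg (fun y => one (X0 + L) y * cker (L / 4) 0 (pt2 (X0 + L, y) - z) +
    zero (X0 + L) y * cker (L / 4) 1 (pt2 (X0 + L, y) - z)) (Y0 - L) (Y0 + L).
  by apply: B3 => y /ab /T3; rewrite /zero /one mul0r addr0 mul1r.
have {}B4 : 2 / 9 <= -1 * itg (fun y => one (X0 - L) y * cker (L / 4) 0 (pt2 (X0 - L, y) - z) +
    zero (X0 - L) y * cker (L / 4) 1 (pt2 (X0 - L, y) - z)) (Y0 - L) (Y0 + L).
  by apply: B4 => y /ab /T4; rewrite /zero /one mul0r addr0 mul1r.
exact: four_sides B1 B2 B3 B4.
Qed.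

(** Near the centre f = A/C, written as A times the conjugate of C over |C|^2; A and C are contour
    integrals with bounds of all orders. *)
Lemma cauchy_DB : exists r U V, [/\ 0 < r, (forall N, DB N U), (forall N, DB N V) &
  forall x y, enorm (pt2 (x, y) - pt2 (X0, Y0)) <= r -> U (pt2 (x, y)) = u x y /\ V (pt2 (x, y)) = v x y].
Proof.
have Lp := L0; pose c := pt2 (X0, Y0).
have L2' : 0 < L / 2 by rewrite divr_gt0.
pose S z := C1 z * C1 z + C2 z * C2 z.
pose chi := bumpf c (L / 2).
(* |C|^2 interpolated with the constant 1: being at least 1/2 everywhere, it has an inverse with
   globally bounded differences. *)
pose den z := chi z * S z + (1 - chi z).
have cin z : enorm (z - c) <= L / 2 -> inner z.
  move=> H; split; apply: le_trans H.
    by have := coord_le_enorm (z - c) 0; rewrite !mxE.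
  by have := coord_le_enorm (z - c) 1; rewrite !mxE.
have S_ge z : inner z -> 1 / 2 <= S z.
  by move=> /C2_ge; rewrite /S; have := sqr_ge0 (C1 z); rewrite expr2; nra.
have den_ge z : 1 / 2 <= den z.
  rewrite /den; have [zc|zc] := leP (enorm (z - c)) (L / 2).
    apply: half_convex; [exact: bump_ge0|exact: bump_le1|exact/S_ge/cin].
  by rewrite /chi bump0 ?(ltW zc)// mul0r add0r subr0; lra.
have l1 : lcont one by exact: lcont_cst. have l0 : lcont zero by exact: lcont_cst.
have l2 : lcont mone by exact: lcont_cst.
have DC1 N : DB N C1 by exact: DB_RK.
have DC2 N : DB N C2 by exact: DB_RK.
have DA1 N : DB N A1 by apply: DB_RK => //; exact: lcontN.
have DA2 N : DB N A2 by apply: DB_RK => //; exact: lcontN.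
have Dchi N : DB N chi by apply: smooth_DB; [exact/SM_smooth/SM_bump|exact: bsupp_bump].
have Dden N : DB N (fun z => (den z)^-1).
  apply: (@DBV _ _ N den (1 / 2)) => [|| z]; first by [].
    apply: DBD; last by apply: DBB => //; exact: DB_cst.
    by apply: DBM => //; apply: DBD; exact: DBM.
  by apply: le_trans (den_ge z) (ler_norm _).
exists (L / 4), (fun z => (A1 z * C1 z + A2 z * C2 z) * (den z)^-1),
  (fun z => (A2 z * C1 z - A1 z * C2 z) * (den z)^-1); split.
- exact: L4.
- by move=> N; apply: DBM => //; apply: DBD; exact: DBM.
- by move=> N; apply: DBM => //; apply: DBB; exact: DBM.
move=> x y xy; have zi : inner (pt2 (x, y)) by apply: cin; apply: le_trans xy _; lra.
have [E1 E2] := cauchy_formula zi; have S0 : S (pt2 (x, y)) != 0.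
  by rewrite gt_eqF// (lt_le_trans _ (S_ge _ zi)).
have -> : den (pt2 (x, y)) = S (pt2 (x, y)).
  by rewrite /den /chi bump1 ?mul1r ?subrr ?addr0//; apply: le_trans xy _; lra.
have [zX zY] := zi; rewrite !pt2E0 !pt2E1 in E1 E2 zX zY.
have ucE : uc x y = u x y by rewrite /uc !clamp_id//; lra.
have vcE : vc x y = v x y by rewrite /vc !clamp_id//; lra.
rewrite ucE vcE in E1 E2; rewrite E1 E2.
by split; rewrite /S in S0 *; field.
Qed.
End CauchyDB.

(** * Local regularity of holomorphic functions *)

Section HolomorphicLocal.
Context {R : realType}.
Implicit Types (g : 'rV[R]_2 -> R) (p q : 'rV[R]_2).

Lemma enorm_le_sum (u : 'rV[R]_2) : enorm u <= `|u 0 0| + `|u 0 1|.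
Proof.
rewrite -[leRHS]ger0_norm ?addr_ge0// -sqrtr_sqr /enorm ler_sqrt ?sqr_ge0//.
rewrite !big_ord_recl big_ord0 addr0 (_ : lift ord0 ord0 = 1 :> 'I_2); last exact: val_inj.
rewrite sqrrD !real_normK ?num_real// lerD2r lerDl mulrn_wge0// mulr_ge0//.
Qed.

Lemma holomorphic_hol_at (V : set 'rV[R]_2) f X Y : holomorphic_on V f -> V (pt2 (X, Y)) ->
  hol_at (fun x y => complex.Re (f (x +i* y)%C)) (fun x y => complex.Im (f (x +i* y)%C)) X Y.
Proof.
by move=> hf Vp; apply: derivable_hol_at; have := hf _ Vp; rewrite /toC pt2E0 pt2E1.
Qed.

Lemma holomorphic_local (V : set 'rV[R]_2) f p : open V -> holomorphic_on V f -> V p ->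
  exists r U W, [/\ 0 < r, (forall N, DB N U), (forall N, DB N W) &
    forall q, enorm (q - p) <= r -> f (toC q) = (U q +i* W q)%C].
Proof.
move=> oV hf Vp; have [r0 r00 Hr] := open_ball_enorm oV Vp.
(* With L = r0/4, the square of half side 2L lies in the disc of radius 4L = r0. *)
have L0 : 0 < r0 / 4 by rewrite divr_gt0.
have [X Y HX HY|r [U [W [r1 DU DW HUW]]]] := @cauchy_DB R
    (fun x y => complex.Re (f (x +i* y)%C)) (fun x y => complex.Im (f (x +i* y)%C)) (p 0 0) (p 0 1) _ L0.
  apply: holomorphic_hol_at hf _; apply: Hr; apply: le_trans (enorm_le_sum _) _.
  by rewrite !mxE /=; lra.
exists r, U, W; split=> // q qp; have [|E1 E2] := HUW (q 0 0) (q 0 1); first by rewrite !pt2_eta.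
rewrite pt2_eta in E1 E2; rewrite E1 E2 /toC.
by case: (f _).
Qed.

Lemma lin_at_derive g X Y a b : lin_at (fun x y => g (pt2 (x, y))) X Y a b ->
  'D_(e_ 0) g (pt2 (X, Y)) = a /\ 'D_(e_ 1) g (pt2 (X, Y)) = b.
Proof.
move=> H; split; rewrite /derive; apply: cvg_lim => //; apply/cvgrPdist_le => e e0.
  have [d d0 Hd] := H e e0; near=> h.
  have h0 : h != 0 by near: h; exact: nbhs_dnbhs_neq.
  have hd : `|h| < d by near: h; exact: dnbhs0_lt.
  have := Hd h 0 hd; rewrite normr0 addr0 mulr0 !addr0 => /(_ d0) B.
  have E : h *: e_ 0 + pt2 (X, Y) = pt2 (X + h, Y).
    apply/rowP => i; rewrite !mxE eqxx /=; case: (i == 0); rewrite ?mulr1 ?mulr0 ?add0r//.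
    exact: addrC.
  rewrite /= E [h^-1 *: _]mulrC -(ler_pM2r (x := `|h|)) ?normr_gt0// -normrM.
  by rewrite mulrBl divfK// distrC; exact: B.
have [d d0 Hd] := H e e0; near=> h.
have h0 : h != 0 by near: h; exact: nbhs_dnbhs_neq.
have hd : `|h| < d by near: h; exact: dnbhs0_lt.
have := Hd 0 h; rewrite normr0 add0r mulr0 add0r addr0 => /(_ d0 hd) B.
have E : h *: e_ 1 + pt2 (X, Y) = pt2 (X, Y + h).
  apply/rowP => i; rewrite !mxE eqxx /=.
  have : i = 0 \/ i = 1 by case: i => [[|[|//]]] pi; [left|right]; exact: val_inj.
  by case=> -> /=; rewrite ?mulr0 ?mulr1 ?add0r// addrC.
rewrite /= E [h^-1 *: _]mulrC -(ler_pM2r (x := `|h|)) ?normr_gt0// -normrM.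
by rewrite mulrBl divfK// distrC; exact: B.
Unshelve. all: by end_near.
Qed.

(* Cauchy-Riemann: [g1 dz + i g2 dz] is closed where [g1 + i g2] agrees with a holomorphic function. *)
Lemma holomorphic_CR (V : set 'rV[R]_2) f g1 g2 p : holomorphic_on V f -> V p ->
  (\forall q \near p, g1 q = complex.Re (f (toC q)) /\ g2 q = complex.Im (f (toC q))) ->
  'D_(e_ 0) g1 p = 'D_(e_ 1) g2 p /\ 'D_(e_ 0) g2 p = - 'D_(e_ 1) g1 p.
Proof.
move=> hf Vp near_f; have := @holomorphic_hol_at V f (p 0 0) (p 0 1) hf; rewrite pt2_eta.
move=> /(_ Vp)[a [b [/= Hu Hv]]].
have {near_f} /nbhs_ballP[d /= d0 Hd] := near_f.
have B s t : `|s| < d -> `|t| < d -> ball p d (pt2 (p 0 0 + s, p 0 1 + t)).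
  move=> sd td; rewrite -ball_normE /=.
  rewrite -[X in X < _]/(mx_norm _) mx_normrE; apply: bigmax_lt => // -[i j] _ /=.
  rewrite (ord1 i) !mxE /=; have : j = 0 \/ j = 1.
    by case: j => [[|[|//]]] pj; [left|right]; exact: val_inj.
  by case=> -> /=; rewrite opprD addNKr normrN.
have TE x y : toC (pt2 (x, y)) = (x +i* y)%C by rewrite /toC pt2E0 pt2E1.
have L1 : lin_at (fun x y => g1 (pt2 (x, y))) (p 0 0) (p 0 1) a (- b).
  apply: lin_at_local Hu; exists d => // s t sd td.
  by have [-> _] := Hd _ (B s t sd td); rewrite TE.
have L2 : lin_at (fun x y => g2 (pt2 (x, y))) (p 0 0) (p 0 1) b a.
  apply: lin_at_local Hv; exists d => // s t sd td.
  by have [_ ->] := Hd _ (B s t sd td); rewrite TE.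
have [] := lin_at_derive L1; have [] := lin_at_derive L2; rewrite pt2_eta.
by move=> -> -> -> ->; rewrite opprK.
Qed.
End HolomorphicLocal.

(** * Support of a chain *)

Section Locality.
Context {R : realType}.
Implicit Types (g : 'rV[R]_2 -> R).

Lemma int1_0 r (J : chain R 2 1 r) : int1 J (fun=> 0) (fun=> 0) = 0.
Proof.
rewrite -[RHS](mul0r (int1 J (fun=> 0) (fun=> 0))) -(@int1Z R r J 0 _ _ (DB_cst r 0) (DB_cst r 0)).
by rewrite mul0r.
Qed.

Lemma int1_supports_avoid r (J : chain R 2 1 r) X g1 g2 p (e : R) : DB r g1 -> DB r g2 ->
  supports X J -> (forall q, enorm (q - p) <= e -> ~ X q) ->
  (forall q, e <= enorm (q - p) -> g1 q = 0 /\ g2 q = 0) -> int1 J g1 g2 = 0.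
Proof.
move=> D1 D2 XJ Xp gp; pose W := [set q : 'rV[R]_2 | e < enorm (q - p)].
have oW : open W.
  have [e0|e0] := ltP e 0.
    rewrite (_ : W = setT); first exact: openT.
    by apply/seteqP; split=> // q _; rewrite /W /=; apply: lt_le_trans e0 (enorm_ge0 _).
  by rewrite openE => q; exact: near_far.
have [||A AW AJ] := XJ W oW.
(* [supports] only speaks of nonempty open sets, hence an explicit point far from p. *)
- exists (p + (`|e| + 1) *: e_ 0); rewrite /W /= addrAC subrr add0r enormZ enorm_delta mulr1.
  by rewrite ger0_norm ?addr_ge0// (le_lt_trans (ler_norm e))// ltrDl.
- move=> q Xq; rewrite /W /= ltNge; apply/negP => /Xp; exact.
have H := int1_cvg D1 D2 AJ.
rewrite -(cvg_lim _ H)//; apply: cvg_lim => //.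
rewrite (_ : (fun i => _) = fun=> 0); first exact: cvg_cst.
apply/funext => i; rewrite /form_eval fsbig1// => q _.
have [->|Aq] := eqVneq (A i q) 0; first exact: pairing0r.
have /AW /= /ltW /gp[g10 g20] : [set q | A i q != 0] q by [].
by rewrite /pairing big1// => s _; rewrite ffunE g10 g20 if_same mul0r.
Qed.

(** [supp J] is an intersection of supporting sets and is not known to support [J] itself. But each
    point of [C] is avoided by some supporting set, and [localize] assembles the local statements,
    for one coefficient at a time. *)
Lemma int1_off_supp r (J : chain R 2 1 r) g1 g2 (C : set 'rV[R]_2) : DB r g1 -> DB r g2 ->
  compact C -> C `&` supp J = set0 -> (forall q, ~ C q -> g1 q = 0 /\ g2 q = 0) ->
  int1 J g1 g2 = 0.
Proof.
move=> D1 D2 cC CJ gC; have DBz := @DB_cst R 2 r 0.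
have H p : C p -> exists2 e : R, 0 < e & exists2 X, supports X J &
    forall q, enorm (q - p) <= e -> ~ X q.
  move=> Cp; have /existsNP[X /not_implyP[[cX XJ] nX]] : ~ supp J p.
    by move=> Jp; have : (C `&` supp J) p by []; rewrite CJ.
  have [e e0 He] := open_ball_enorm (closed_openC cX) nX.
  by exists e => //; exists X.
have H1 : DB r g1 /\ int1 J g1 (fun=> 0) = 0.
  apply: (@localize _ _ C (fun g => DB r g /\ int1 J g (fun=> 0) = 0)) => //.
  - by split=> //; exact: int1_0.
  - move=> g h [Dg Tg] [Dh Th]; split; first exact: DBD.
    have := @int1D R r J g (fun=> 0) h (fun=> 0) Dg DBz Dh DBz; rewrite Tg Th addr0 => E.
    exact: E.
  - by move=> q /gC[].
  - move=> p /H[e e0 [X XJ Xp]]; exists e => // eta Seta.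
    have De : DB r (fun q => eta q * bumpf p e q * g1 q) by apply: DBM => //; exact: DB_SM_bump.
    split=> //; apply: (int1_supports_avoid De DBz XJ Xp) => q eq.
    by rewrite bump0// mulr0 mul0r.
have H2 : DB r g2 /\ int1 J (fun=> 0) g2 = 0.
  apply: (@localize _ _ C (fun g => DB r g /\ int1 J (fun=> 0) g = 0)) => //.
  - by split=> //; exact: int1_0.
  - move=> g h [Dg Tg] [Dh Th]; split; first exact: DBD.
    have := @int1D R r J (fun=> 0) g (fun=> 0) h DBz Dg DBz Dh; rewrite Tg Th addr0 => E.
    exact: E.
  - by move=> q /gC[].
  - move=> p /H[e e0 [X XJ Xp]]; exists e => // eta Seta.
    have De : DB r (fun q => eta q * bumpf p e q * g2 q) by apply: DBM => //; exact: DB_SM_bump.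
    split=> //; apply: (int1_supports_avoid DBz De XJ Xp) => q eq.
    by rewrite bump0// mulr0 mul0r.
have [_ E1] := H1; have [_ E2] := H2.
have := @int1D R r J g1 (fun=> 0) (fun=> 0) g2 D1 DBz DBz D2; rewrite E1 E2 addr0 => E.
have e1 : (fun q => g1 q + 0) = g1 by apply/funext => q; rewrite addr0.
have e2 : (fun q => 0 + g2 q) = g2 by apply/funext => q; rewrite add0r.
by rewrite e1 e2 in E.
Qed.

Lemma closed_supp r (J : chain R 2 1 r) : closed (supp J).
Proof. by apply: closed_bigI => X [cX _]. Qed.
End Locality.

(** * Functionals annihilating derivatives on a square *)

Section Square.
Context {R : realType}.
Implicit Types (h k g : 'rV[R]_2 -> R) (p q u : 'rV[R]_2) (j : 'I_2).

Lemma is_derive_of_line g p u (d : R) : is_derive (0 : R) (1 : R) (fun t : R => g (p + t *: u)) d ->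
  is_derive p u g d.
Proof.
have E : (fun h : R => h^-1 *: (((fun s => g (p + s *: u)) \o shift 0) (h *: 1) - g (p + 0 *: u))) =
    (fun h : R => h^-1 *: ((g \o shift p) (h *: u) - g p)).
  apply/funext => h /=; rewrite addr0 scale0r addr0 [h *: 1]mulr1.
  by rewrite [in RHS]addrC (addrC (h *: u)) [in RHS](addrC (- g p)).
move=> [D dE]; split.
  by move: D; rewrite /derivable E.
by move: dE; rewrite /derive E.
Qed.

Lemma continuous_line N h p u : DB N.+2 h -> continuous (fun s : R => h (p + s *: u)).
Proof.
move=> Dh s; apply/differentiable_continuous/derivable1_diffP.
by have [] := is_derive_line (@DB_derivable _ _ N h (p + s *: u) u Dh).
Qed.

Lemma bdiff_contract (A : 'rV[R]_2 -> 'rV[R]_2) N C h w : (forall p q, A (p + q) = A p + A q) ->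
  (forall p, enorm (A p) <= enorm p) -> bdiff N C h -> bdiff N C (fun q => h (A q + w)).
Proof.
move=> AD An Hh us p sus.
have -> : forall us p, fdiffs us (fun q => h (A q + w)) p = fdiffs [seq A u | u <- us] h (A p + w).
  by elim=> [//|u vs IH] x /=; rewrite /fdiff !IH AD addrAC.
apply: le_trans (Hh _ _ _) _; first by rewrite size_map.
rewrite ler_wpM2l ?(bdiff_ge0 Hh)// /shiftprod big_map.
by apply: ler_prod => u _; rewrite enorm_ge0 An.
Qed.

(** [q] with its j-th coordinate replaced by [s], written as a linear contraction plus a translation
    so that [bdiff_contract] applies. *)
Definition setc j q (s : R) : 'rV[R]_2 := (q - q 0 j *: e_ j) + s *: e_ j.

Lemma setcE j q s i : setc j q s 0 i = if i == j then s else q 0 i.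
Proof.
rewrite !mxE eqxx /= ; case: eqP => [->|_]; rewrite ?mulr1 ?mulr0 ?subrr ?add0r//.
by rewrite subr0 addr0.
Qed.

Lemma bdiff_setc N C h j s : bdiff N C h -> bdiff N C (fun q => h (setc j q s)).
Proof.
apply: (@bdiff_contract (fun q => q - q 0 j *: e_ j)) => [p q|p].
  by rewrite mxE scalerDl opprD addrACA.
rewrite /enorm ler_sqrt ?sumr_ge0// => [|i _]; last exact: sqr_ge0.
apply: ler_sum => i _; rewrite !mxE eqxx /=.
by have [->|_] := eqVneq i j; rewrite ?mulr1 ?subrr ?mulr0 ?subr0// expr0n /= sqr_ge0.
Qed.
End Square.

Section SquarePrimitive.
Context {R : realType}.
Variables (c : 'rV[R]_2) (L : R).
Hypothesis L0 : 0 < L.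
Implicit Types (h k g : 'rV[R]_2 -> R) (p q u : 'rV[R]_2) (j : 'I_2).

Definition sqfun h := (forall N, DB N h) /\ forall q j, L <= `|q 0 j - c 0 j| -> h q = 0.

Definition fullint j h q : R := itg (fun s => h (setc j q s)) (c 0 j - L) (c 0 j + L).

Lemma DB_fullint N j h : DB N.+2 h -> DB N (fullint j h).
Proof.
move=> Dh; have Lp := L0; have [C Hh] : DB N h by apply: DB_le Dh; lia.
exists (C * (c 0 j + L - (c 0 j - L))).
apply: (@bdiff_itg R 2 N C (fun s q => h (setc j q s))) => [|q|s _]; first lra.
  exact: continuous_line Dh.
exact: bdiff_setc.
Qed.

(** A window of fixed length, instead of an integral from a fixed base point, lets differences in q
    pass under the integral. For q_j <= c_j + 4L it starts at or before c_j - L, hence sees all of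
    the square behind q. *)
Definition backint j h q : R := itg (fun s => h (q - s *: e_ j)) 0 (5 * L).

Lemma continuous_backline N h q u : DB N.+2 h -> continuous (fun s : R => h (q - s *: u)).
Proof.
move=> Dh; rewrite (_ : (fun s => _) = fun s : R => h (q + s *: (- u))).
  exact: continuous_line Dh.
by apply/funext => s; rewrite scalerN.
Qed.

Lemma DB_backint N j h : DB N.+2 h -> DB N (backint j h).
Proof.
move=> Dh; have Lp := L0; have [C Hh] : DB N h by apply: DB_le Dh; lia.
exists (C * (5 * L - 0)).
apply: (@bdiff_itg R 2 N C (fun s q => h (q - s *: e_ j))) => [|q|s _]; first lra.
  exact: continuous_backline Dh.
exact: bdiff_shift.
Qed.

Lemma backintE h j q : DB 2 h ->
  backint j h q = itg (fun s => h (q + s *: e_ j)) (- (5 * L)) 0.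
Proof.
move=> Dh; have c1 := continuous_backline (q:=q) (u:=e_ j) Dh.
have c2 := continuous_line (p:=q) (u:=e_ j) Dh.
have dG x : is_derive x (1 : R) (fun s => - prim (fun s => h (q + s *: e_ j)) (- s)) (h (q - x *: e_ j)).
  have dN : is_derive x (1 : R) (fun s : R => - s) (-1 : R).
    exact: (@is_deriveN R R^o R^o id x 1 1 (is_derive_id _ _)).
  have H := @is_deriveN R R^o R^o _ _ _ _ (is_derive1_comp (is_derive_prim (- x) c2) dN).
  by move: H; rewrite mulrN1 opprK scaleNr.
by rewrite /backint (itgE _ _ c1 dG) oppr0 /itg; ring.
Qed.

Lemma itg_shift (g : R -> R) (a b t : R) : continuous g ->
  itg (fun s => g (s + t)) a b = itg g (a + t) (b + t).
Proof.
move=> cg; have ct : continuous (fun s : R => g (s + t)).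
  move=> x; apply: (@continuous_comp _ _ _ (fun s : R => s + t) g); last exact: cg.
  by apply: cvgD; [exact: cvg_id|exact: cvg_cst].
have dG x : is_derive x (1 : R) (fun s => prim g (s + t)) (g (x + t)).
  have dt : is_derive x (1 : R) (fun s : R => s + t) (1 : R).
    have := @is_deriveD R R^o R^o id (fun=> t) x 1 1 0 (is_derive_id _ _) (is_derive_cst _ _ _).
    by rewrite addr0.
  by have := @is_derive1_comp R _ (fun s : R => s + t) _ _ _ (is_derive_prim (x + t) cg) dt; rewrite mulr1.
by rewrite (itgE _ _ ct dG).
Qed.

Lemma is_derive_backint h j q : DB 2 h ->
  is_derive q (e_ j) (backint j h) (h q - h (q - (5 * L) *: e_ j)).
Proof.
move=> Dh; apply: is_derive_of_line; have c2 := continuous_line (p:=q) (u:=e_ j) Dh.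
pose F := prim (fun s => h (q + s *: e_ j)).
have -> : (fun t => backint j h (q + t *: e_ j)) = (fun t => F t - F (t - 5 * L)).
  apply/funext => t; rewrite backintE//.
  have -> : (fun s => h (q + t *: e_ j + s *: e_ j)) = (fun s => h (q + (s + t) *: e_ j)).
    by apply/funext => s; rewrite scalerDl (addrC (s *: _)) addrA.
  by rewrite (@itg_shift _ _ _ _ c2) add0r /itg /F (addrC (- (5 * L))).
have dt : is_derive (0 : R) (1 : R) (fun s : R => s - 5 * L) (1 : R).
  have := @is_deriveB R R^o R^o id (fun=> 5 * L) 0 1 1 0 (is_derive_id _ _) (is_derive_cst _ _ _).
  by rewrite subr0.
have d1 := is_derive_prim 0 c2.
have d2 := @is_derive1_comp R _ (fun s : R => s - 5 * L) _ _ _ (is_derive_prim (0 - 5 * L) c2) dt.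
have := @is_deriveB R R^o R^o _ _ _ _ _ _ d1 d2.
by rewrite scale0r addr0 sub0r mulr1 scaleNr.
Qed.

Lemma sqfun_itg0 h j q (a b : R) : sqfun h -> a <= b ->
  (forall s, a <= s <= b -> h (setc j q s) = 0) -> itg (fun s => h (setc j q s)) a b = 0.
Proof.
move=> [Dh _] ab H; rewrite -[RHS](mul0r (b - a)) -itg_cst; apply: eq_itg => //.
  exact: continuous_line (Dh 2).
by move=> x; exact: cvg_cst.
Qed.

Lemma itg_cat (g : R -> R) (a b d : R) : itg g a d = itg g a b + itg g b d.
Proof. by rewrite /itg; ring. Qed.

Lemma backint_setc h j q : DB 2 h ->
  backint j h q = itg (fun s => h (setc j q s)) (q 0 j - 5 * L) (q 0 j).
Proof.
move=> Dh; rewrite backintE//; have -> : itg (fun s => h (setc j q s)) (q 0 j - 5 * L) (q 0 j) =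
    itg (fun s => h (setc j q s)) (- (5 * L) + q 0 j) (0 + q 0 j) by rewrite add0r addrC.
rewrite -(@itg_shift _ _ _ _ (continuous_line Dh)).
by congr itg; apply/funext => s; rewrite /setc scalerDl (addrC (s *: _)) addrA subrK.
Qed.

(** Past the far side the window contains a whole chord of the square, and integrals over chords
    vanish by hypothesis. *)
Lemma backint_out h j q : sqfun h -> (forall q, fullint j h q = 0) ->
  q 0 j <= c 0 j + 4 * L -> (exists i, L <= `|q 0 i - c 0 i|) -> backint j h q = 0.
Proof.
move=> Hh F0 q3 [i qi]; have Lp := L0; have [Dh h0] := Hh; rewrite backint_setc//.
have [ij|ij] := eqVneq i j; last first.
  by apply: sqfun_itg0 => [//||s _]; [lra|apply: (h0 _ i); rewrite setcE (negbTE ij)].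
subst i; have [qj|qj] := leP (q 0 j) (c 0 j).
  apply: sqfun_itg0 => [//||s /andP[s1 s2]]; first lra.
  apply: (h0 _ j); rewrite setcE eqxx.
  move: qi; rewrite !ler_normr => /orP[|] H; apply/orP; right; lra.
rewrite (itg_cat _ _ (c 0 j - L)) (itg_cat _ (c 0 j - L) (c 0 j + L)) [X in _ + (X + _)]F0 add0r.
have qj1 : c 0 j + L <= q 0 j by move: qi; rewrite ler_normr => /orP[|] H; lra.
rewrite !sqfun_itg0 ?addr0//; try lra.
- move=> s /andP[s1 s2]; apply: (h0 _ j); rewrite setcE eqxx ler_normr; apply/orP; left; lra.
- move=> s /andP[s1 s2]; apply: (h0 _ j); rewrite setcE eqxx ler_normr; apply/orP; right; lra.
Qed.

(** Beyond c_j + 4L the window no longer contains the chord; the bump, equal to 1 on the square,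
    removes that region. *)
Definition sqprim j h q := bumpf c (4 * L) q * backint j h q.

Lemma sqprim_sqfun j h : sqfun h -> (forall q, fullint j h q = 0) -> sqfun (sqprim j h).
Proof.
move=> Hh F0; have Lp := L0; have [Dh h0] := Hh; split=> [N|q i qi].
  apply: DBM; last exact: DB_backint.
  have := @DB_SM_bump R 2 N (fun=> 1) c (4 * L) (SM_cst 1).
  by under eq_fun do rewrite mul1r; apply; lra.
rewrite /sqprim; have [qj|qj] := leP (q 0 j) (c 0 j + 4 * L).
  by rewrite backint_out ?mulr0//; exists i.
rewrite bump0 ?mul0r//; first lra.
apply: le_trans (coord_le_enorm _ j); rewrite !mxE ler_normr; apply/orP; left; lra.
Qed.

Lemma derive_sqprim j h q : sqfun h -> (forall q, fullint j h q = 0) ->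
  'D_(e_ j) (sqprim j h) q = h q.
Proof.
move=> Hh F0; have Lp := L0; have [Dh h0] := Hh.
have cj : {for q, continuous (fun p : 'rV[R]_2 => p 0 j)}.
  by apply: smooth_cont; apply: SM_smooth; exact: SM_coord.
have [qj|qj] := ltP (q 0 j) (c 0 j + 4 * L); last first.
  have -> : h q = 0 by apply: (h0 _ j); rewrite ler_normr; apply/orP; left; lra.
  have dc := @is_derive_cst R 'rV[R]_2 R^o 0 q (e_ j).
  have [] // : is_derive q (e_ j) (sqprim j h) 0.
  apply: (@near_eq_is_derive R _ R^o (fun=> 0)) => //.
  have : \forall p \near q, c 0 j + L < (p : 'rV[R]_2) 0 j.
    apply: (cj [set x | c 0 j + L < x]); apply: lt_nbhsr; lra.
  apply: filterS => p pj; have [_ H] := sqprim_sqfun Hh F0.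
  by apply/esym/(H _ j); rewrite ler_normr; apply/orP; left; lra.
have db := is_derive_backint j q (Dh 2).
have [_ ->] : is_derive q (e_ j) (sqprim j h) (h q - h (q - (5 * L) *: e_ j)).
  apply: (near_eq_is_derive _ db).
  have : \forall p \near q, (p : 'rV[R]_2) 0 j < c 0 j + 4 * L.
    by apply: (cj [set x | x < c 0 j + 4 * L]); exact: lt_nbhsl.
  apply: filterS => p pj; rewrite /sqprim.
  have [pc|pc] := leP (enorm (p - c)) (4 * L / 2).
    by rewrite bump1 ?mul1r//; lra.
  (* Off the disc of radius 2L the point lies outside the square, where [backint] vanishes
     anyway. *)
  have pi : exists i, L <= `|p 0 i - c 0 i|.
    apply/not_existsP => H.
    have H' i : `|p 0 i - c 0 i| < L by rewrite ltNge; apply/negP; exact: H.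
    have := enorm_le_sum (p - c); rewrite !mxE.
    have := H' 0; have := H' 1; lra.
  rewrite backint_out ?mulr0//; lra.
rewrite (h0 (q - (5 * L) *: e_ j) j) ?subr0//.
have -> : (q - (5 * L) *: e_ j) 0 j = q 0 j - 5 * L by rewrite !mxE !eqxx mulr1.
rewrite ler_normr; apply/orP; right; lra.
Qed.
End SquarePrimitive.

Section SquareProportional.
Context {R : realType}.
Variables (c : 'rV[R]_2) (L : R).
Hypothesis L0 : 0 < L.
Implicit Types (h k g : 'rV[R]_2 -> R) (p q u : 'rV[R]_2) (j : 'I_2).
Local Notation sqf := (sqfun c L).
Local Notation fint := (fullint c L).

Lemma sqfunD g h : sqf g -> sqf h -> sqf (fun q => g q + h q).
Proof.
move=> [Dg g0] [Dh h0]; split=> [N|q j qj]; first exact: DBD.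
by rewrite (g0 q j) ?(h0 q j) ?addr0.
Qed.

Lemma sqfunZ (a : R) h : sqf h -> sqf (fun q => a * h q).
Proof.
move=> [Dh h0]; split=> [N|q j qj]; first exact: DBZ.
by rewrite (h0 q j) ?mulr0.
Qed.

Lemma sqfun_SM g h : SM g -> (forall N, DB N h) ->
  (forall q j, L <= `|q 0 j - c 0 j| -> g q * h q = 0) -> sqf (fun q => g q * h q).
Proof.
move=> Sg Dh gh0; have Lp := L0; split=> // N.
have -> : (fun q => g q * h q) = (fun q => g q * bumpf c (4 * L) q * h q).
  apply/funext => q; have [pc|pc] := leP (enorm (q - c)) (4 * L / 2).
    rewrite bump1 ?mulr1//; lra.
  have [i qi] : exists i, L <= `|q 0 i - c 0 i|.
    apply/not_existsP => H; have H' i : `|q 0 i - c 0 i| < L by rewrite ltNge; apply/negP; exact: H.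
    by have := enorm_le_sum (q - c); rewrite !mxE; have := H' 0; have := H' 1; lra.
  by rewrite mulrAC (gh0 _ i qi) mul0r.
by apply: DBM => //; apply: DB_SM_bump => //; lra.
Qed.

Definition tent (t : R) : R := flat 0 (L ^+ 2 - t ^+ 2).

Lemma continuous_tent (a : R) : continuous (fun s : R => tent (s - a)).
Proof.
move=> x; rewrite /tent; apply: (@continuous_comp _ _ _ (fun s => L ^+ 2 - (s - a) ^+ 2) (flat 0)).
  apply: cvgB; first exact: cvg_cst.
  have H : (s - a) @[s --> x] --> x - a by apply: cvgB; [exact: cvg_id|exact: cvg_cst].
  exact: (cvgM H H).
by apply/differentiable_continuous/derivable1_diffP; have [] := is_derive_flat 0 (L ^+ 2 - (x - a) ^+ 2).
Qed.

Lemma tent_itg (a : R) : 0 < itg (fun s => tent (s - a)) (a - L) (a + L).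
Proof.
have Lp := L0; have ct := @continuous_tent a.
rewrite (itg_cat _ _ (a - L / 2)) (itg_cat _ (a - L / 2) (a + L / 2)).
have H b d : b <= d -> 0 <= itg (fun s => tent (s - a)) b d.
  by move=> bd; rewrite -[leLHS](mul0r (d - b)); apply: itg_ge => // x _; exact: flat_ge0.
have [|x xb ->] := itg_mvt ct (_ : a - L / 2 <= a + L / 2); first lra.
rewrite ltr_wpDl ?H//; first lra.
rewrite ltr_wpDr ?H//; first lra.
rewrite mulr_gt0//; last lra.
by apply: flat_gt0; move: xb => /andP[]; nra.
Qed.

(** A smooth weight in the j-th coordinate alone, with integral 1 along the chords in direction
    j. *)
Definition theta j q : R := tent (q 0 j - c 0 j) / itg (fun s => tent (s - c 0 j)) (c 0 j - L) (c 0 j + L).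

Lemma SM_theta j : SM (theta j).
Proof.
apply: SM_mul; last exact: SM_cst.
apply: SM_flat; apply: SM_sub; first exact: SM_cst.
by apply: SM_mul; apply: SM_sub; do ?[exact: SM_coord|exact: SM_cst].
Qed.

Lemma theta0 j q : L <= `|q 0 j - c 0 j| -> theta j q = 0.
Proof.
move=> qj; rewrite /theta /tent flat_le0 ?mul0r// subr_le0 -[leRHS]real_normK ?num_real//.
by rewrite ler_sqr ?nnegrE// ltW.
Qed.

Lemma theta_setc i j q s : theta i (setc j q s) =
  if i == j then tent (s - c 0 j) / itg (fun s => tent (s - c 0 j)) (c 0 j - L) (c 0 j + L)
  else theta i q.
Proof. by rewrite /theta setcE; case: eqP => [->|]. Qed.

Lemma setc_setc j q s t : setc j (setc j q s) t = setc j q t.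
Proof. by apply/rowP => i; rewrite !setcE; case: (i == j). Qed.

Lemma fullint_out h j i q : sqf h -> i != j -> L <= `|q 0 i - c 0 i| -> fint j h q = 0.
Proof.
move=> Hh ij qi; have Lp := L0; apply: (sqfun_itg0 Hh); first lra.
by move=> s _; have [_ h0] := Hh; apply: (h0 _ i); rewrite setcE (negbTE ij).
Qed.

Definition average j h q := theta j q * fint j h q.

Lemma average_sqfun j h : sqf h -> sqf (average j h).
Proof.
move=> Hh; apply: sqfun_SM; first exact: SM_theta.
  by move=> N; apply: DB_fullint => //; have [Dh _] := Hh.
move=> q i qi; have [ij|ij] := eqVneq i j; first by rewrite -ij theta0 ?mul0r.
by rewrite (fullint_out Hh ij) ?mulr0.
Qed.

Lemma fullint_average j h q : sqf h -> fint j (average j h) q = fint j h q.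
Proof.
move=> Hh; rewrite {1}/fullint; pose Z := itg (fun s => tent (s - c 0 j)) (c 0 j - L) (c 0 j + L).
have -> : (fun s => average j h (setc j q s)) = (fun s => (fint j h q / Z) * tent (s - c 0 j)).
  apply/funext => s; rewrite /average theta_setc eqxx -/Z /fullint.
  have -> : (fun t => h (setc j (setc j q s) t)) = (fun t => h (setc j q t)).
    by apply/funext => t; rewrite setc_setc.
  by ring.
by rewrite itgZ ?divfK//; [rewrite gt_eqF ?tent_itg|exact: continuous_tent].
Qed.

Lemma itg_ext (f g : R -> R) (a b : R) : (forall x, f x = g x) -> itg f a b = itg g a b.
Proof. by move=> fg; congr itg; apply/funext. Qed.

Lemma theta_prod0 q j : L <= `|q 0 j - c 0 j| -> theta 1 q * theta 0 q = 0.
Proof.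
have [->|j0] := eqVneq j 0; first by move=> /theta0 ->; rewrite mulr0.
have -> : j = 1 by apply/val_inj; case: j j0 => [[|[|]]].
by move=> /theta0 ->; rewrite mul0r.
Qed.

Lemma theta_prod_sqfun : sqf (fun q => theta 1 q * theta 0 q).
Proof.
rewrite (_ : (fun q => _) = fun q => theta 1 q * theta 0 q * 1).
  apply: sqfun_SM => [|N'|q j qj]; [by apply: SM_mul; exact: SM_theta|exact: DB_cst|].
  by rewrite (theta_prod0 qj) mul0r.
by apply/funext => q; rewrite mulr1.
Qed.

Section Functional.
Variable T : ('rV[R]_2 -> R) -> R.
Hypothesis TD : forall g h, sqf g -> sqf h -> T (fun q => g q + h q) = T g + T h.
Hypothesis TZ : forall (a : R) h, sqf h -> T (fun q => a * h q) = a * T h.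
Hypothesis TdE : forall j g, sqf g -> T ('D_(e_ j) g) = 0.

(** h minus its average integrates to 0 along every chord in direction j, so it is the j-th
    derivative of a test function on the same square, and T annihilates it. *)
Lemma functional_average j h : sqf h -> T h = T (average j h).
Proof.
move=> Hh; have Ha := average_sqfun j Hh.
pose k q := h q + -1 * average j h q.
have Hk : sqf k by apply: sqfunD => //; exact: sqfunZ.
have k0 q : fint j k q = 0.
  have [Dh _] := Hh; have [Da _] := Ha; have ch := continuous_line (Dh 2).
  have ca := continuous_line (Da 2).
  rewrite /fullint itgD; [|exact: ch|by move=> x; apply: cvgMl_tmp; exact: ca].
  by rewrite itgZ; [rewrite -/(fint j _ _) -/(fint j _ _) fullint_average// mulN1r subrr|exact: ca].
have : T k = 0.
  rewrite (_ : k = 'D_(e_ j) (sqprim c L j k)); first by rewrite TdE//; exact: sqprim_sqfun.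
  by apply/funext => q; rewrite derive_sqprim.
by rewrite TD//; [rewrite TZ// mulN1r => /eqP; rewrite subr_eq0 => /eqP|exact: sqfunZ].
Qed.

Definition square_int h : R := itg (fun s => fint 0 h (setc 1 c s)) (c 0 1 - L) (c 0 1 + L).

(** Averaging in both directions leaves a multiple of one fixed function; the multiple, an iterated
    integral of h, does not depend on T. *)
Lemma functional_square h : sqf h -> T h = square_int h * T (fun q => theta 1 q * theta 0 q).
Proof.
move=> Hh; rewrite (functional_average 0)// (functional_average 1); last exact: average_sqfun.
rewrite -TZ; last exact: theta_prod_sqfun.
congr T; apply/funext => q; rewrite {1}/average.
suff -> : fint 1 (average 0 h) q = theta 0 q * square_int h by ring.
have [Dh _] := Hh; have cF := continuous_line (DB_fullint c L0 0 (Dh 4)).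
rewrite -[RHS]itgZ; last exact: cF.
have E x t : setc 0 (setc 1 q x) t = setc 0 (setc 1 c x) t.
  apply/rowP => i; rewrite !setcE.
  by have [//|i0] := eqVneq i 0; have [//|] := eqVneq i 1; case: i i0 => [[|[|]]].
have E2 x : average 0 h (setc 1 q x) = theta 0 q * fint 0 h (setc 1 c x).
  rewrite /average theta_setc /= /fullint.
  by rewrite (@itg_ext _ (fun s => h (setc 0 (setc 1 c x) s)))// => t; rewrite E.
exact: itg_ext.
Qed.
End Functional.

Lemma functionals_proportional (T T' : ('rV[R]_2 -> R) -> R) :
  (forall g h, sqf g -> sqf h -> T (fun q => g q + h q) = T g + T h) ->
  (forall (a : R) h, sqf h -> T (fun q => a * h q) = a * T h) ->
  (forall j g, sqf g -> T ('D_(e_ j) g) = 0) ->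
  (forall g h, sqf g -> sqf h -> T' (fun q => g q + h q) = T' g + T' h) ->
  (forall (a : R) h, sqf h -> T' (fun q => a * h q) = a * T' h) ->
  (forall j g, sqf g -> T' ('D_(e_ j) g) = 0) ->
  forall g h, sqf g -> sqf h -> T g * T' h = T h * T' g.
Proof.
move=> TD TZ Td T'D T'Z T'd g h Hg Hh.
rewrite (functional_square TD TZ Td Hg) (functional_square TD TZ Td Hh).
rewrite (functional_square T'D T'Z T'd Hg) (functional_square T'D T'Z T'd Hh); ring.
Qed.
End SquareProportional.

(** * Lebesgue integral on the plane *)

Section PlaneMeasure.
Context {R : realType}.
Implicit Types (k g h : 'rV[R]_2 -> R) (D : set 'rV[R]_2).
Local Notation mu := (@lebesgue_measure R).

Lemma pt2_dist (x y x' y' e : R) : `|x - x'| < e -> `|y - y'| < e ->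
  `|pt2 (x, y) - pt2 (x', y')| < e.
Proof.
move=> hx hy; have e0 : 0 < e by exact: le_lt_trans hx.
rewrite /Num.norm /= mx_normrE; apply/bigmax_ltP; split=> // -[i j] _ /=.
by rewrite !mxE; case: ifP.
Qed.

Lemma itv_dist (u v t t' e : R) : u <= t -> t < u + v -> u <= t' -> t' < u + v -> v < e ->
  `|t - t'| < e.
Proof. by move=> *; rewrite ltr_norml; apply/andP; split; lra. Qed.

(** An open set is the union of the half-open grid squares that it contains, a countable union of
    products of intervals. *)
Lemma measurable_pt2_open D : open D -> measurable (pt2 @^-1` D : set (R * R)).
Proof.
move=> oD.
pose I (n : nat) (i : int) : set R := [set` `[i%:~R / n.+1%:R, (i + 1)%:~R / n.+1%:R[].
pose C n (ij : int * int) : set (R * R) := I n ij.1 `*` I n ij.2.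
have -> : pt2 @^-1` D = \bigcup_n \bigcup_(ij in [set ij | C n ij `<=` pt2 @^-1` D]) C n ij.
  apply/seteqP; split=> [[x y] Dxy|z [n _] [ij H]]; last exact: H.
  move: oD; rewrite openE => /(_ _ Dxy) /nbhs_ballP[e /= e0 He].
  have [n _ ne] : exists2 n, True & n.+1%:R^-1 < e.
    exists (Num.truncn e^-1) => //; rewrite invf_plt ?posrE//; exact: truncnS_gt.
  exists n => //; pose fl (t : R) := Num.floor (t * n.+1%:R).
  have n0 : 0 < n.+1%:R :> R by [].
  have Ifl t : I n (fl t) t.
    rewrite /I /= in_itv /= ler_pdivrMr// ltr_pdivlMr// floor_le /=.
    by rewrite -[ltRHS]/((Num.floor _ + 1)%:~R) floorD1_gt.
  have Idist i t t' : I n i t -> I n i t' -> `|t - t'| < e.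
    rewrite /I /= !in_itv /= => /andP[a1 a2] /andP[b1 b2].
    have E : (i + 1)%:~R / n.+1%:R = i%:~R / n.+1%:R + n.+1%:R^-1 :> R.
      by rewrite intrD mulrDl mul1r.
    by rewrite E in a2 b2; exact: itv_dist a1 a2 b1 b2 ne.
  exists (fl x, fl y); last by split; exact: Ifl.
  move=> [x' y'] [/= Ix' Iy']; apply: He; rewrite -ball_normE /=.
  by apply: pt2_dist; [exact: Idist (Ifl x) Ix'|exact: Idist (Ifl y) Iy'].
apply: bigcupT_measurable => n; rewrite bigcup_mkcond.
apply: countable_bigcupT_measurable => [|ij]; first exact: countableP.
by case: ifP => // _; apply: measurableX; exact: measurable_itv.
Qed.

Lemma measurable_pt2_continuous k : continuous k -> measurable_fun setT (fun z : R * R => k (pt2 z)).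
Proof.
move=> ck; apply: (measurability _ (measurable_realfun.RGenOpens.measurableE R)).
move=> _ [_ [a [b ->] <-]]; rewrite setTI.
rewrite (_ : _ @^-1` _ = pt2 @^-1` (k @^-1` `]a, b[)) //; apply: measurable_pt2_open.
by apply: open_comp => [x _|]; [exact: ck|exact: interval_open].
Qed.
Lemma continuous_pt2_1 k (x : R) : continuous k -> continuous (fun y => k (pt2 (x, y))).
Proof.
move=> ck y; apply: (@continuous_comp _ _ _ (fun y => pt2 (x, y)) k); last exact: ck.
apply/cvgrPdist_lt => e e0; exists e => // t yt.
by apply: pt2_dist; first by rewrite subrr normr0.
Qed.

Lemma continuous_pt2_0 k (y : R) : continuous k -> continuous (fun x => k (pt2 (x, y))).
Proof.
move=> ck x; apply: (@continuous_comp _ _ _ (fun x => pt2 (x, y)) k); last exact: ck.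
apply/cvgrPdist_lt => e e0; exists e => // t yt.
by apply: pt2_dist; last by rewrite subrr normr0.
Qed.
End PlaneMeasure.

Section BoxIntegral.
Context {R : realType}.
Implicit Types (k g h : 'rV[R]_2 -> R) (D : set 'rV[R]_2).
Local Notation mu := (@lebesgue_measure R).
Local Notation mu2 := (mu \x mu)%E.

Lemma lebesgue_itg (g : R -> R) (a b : R) : continuous g -> a < b ->
  (\int[mu]_(x in `[a, b]) (g x)%:E = (itg g a b)%:E)%E.
Proof.
move=> cg ab; have dp x := is_derive_prim x cg; have cp := prim_continuous cg.
rewrite (@continuous_FTC2 R g (prim g) a b ab) ?EFinB//.
- exact: continuous_subspaceT.
- split=> [x _||].
  + by have [] := dp x.
  + by apply: cvg_at_right_filter; exact: cp.
  + by apply: cvg_at_left_filter; exact: cp.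
- by move=> x _; rewrite derive1E; have [_ ->] := dp x.
Qed.

Variables (a0 b0 a1 b1 : R).
Hypotheses (ab0 : a0 < b0) (ab1 : a1 < b1).
Let A : set R := `[a0, b0].
Let B : set R := `[a1, b1].

Let mA : measurable A. Proof. exact: measurable_itv. Qed.
Let mB : measurable B. Proof. exact: measurable_itv. Qed.
Let mAB : measurable (A `*` B). Proof. exact: measurableX. Qed.

Lemma box_integrable k : continuous k -> (exists M : R, forall p, `|k p| <= M) ->
  mu2.-integrable (A `*` B) (EFin \o (k \o pt2)).
Proof.
move=> ck [M kM]; apply: measurable_bounded_integrable => //.
- rewrite -[X in (X < _)%E]/(product_measure1 mu mu (A `*` B)) product_measure1E//.
  suff H : (mu A * mu B < +oo)%E by exact: H.
  by rewrite !lebesgue_measure_itv /= !lte_fin ab0 ab1 -!EFinB -EFinM ltry.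
- by apply: (measurable_funS measurableT) => //; exact: measurable_pt2_continuous.
- exists M; split; first exact: num_real.
  by move=> N MN z _ /=; rewrite (le_trans (kM _))// ltW.
Qed.

Lemma box_integral_xy k : continuous k -> (exists M : R, forall p, `|k p| <= M) ->
  (\int[mu2]_(z in A `*` B) (k (pt2 z))%:E =
   \int[mu]_(x in A) (itg (fun y => k (pt2 (x, y))) a1 b1)%:E)%E.
Proof.
move=> ck bk; have ik' := (@integrable_mkcond _ _ _ mu2 _ (EFin \o (k \o pt2)) mAB).1 (box_integrable ck bk).
rewrite integral_mkcond -integral12_prod_meas1; last exact: ik'.
rewrite [RHS]integral_mkcond; apply: eq_integral => x _.
rewrite patchE; case: ifPn => xA.
  rewrite -(lebesgue_itg _ ab1); last exact: continuous_pt2_1.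
  rewrite [RHS]integral_mkcond; apply: eq_integral => y _.
  rewrite !patchE; congr (if _ then _ else _).
  by apply/idP/idP => /set_mem H; apply/mem_set; [case: H|split=> //; exact: set_mem].
rewrite -[RHS](@integral0 _ _ _ mu setT); apply: eq_integral => y _.
by rewrite patchE memNset// => -[/mem_set xA' _]; rewrite xA' in xA.
Qed.

Lemma box_integral_yx k : continuous k -> (exists M : R, forall p, `|k p| <= M) ->
  (\int[mu2]_(z in A `*` B) (k (pt2 z))%:E =
   \int[mu]_(y in B) (itg (fun x => k (pt2 (x, y))) a0 b0)%:E)%E.
Proof.
move=> ck bk; have ik' := (@integrable_mkcond _ _ _ mu2 _ (EFin \o (k \o pt2)) mAB).1 (box_integrable ck bk).
rewrite integral_mkcond -integral21_prod_meas1; last exact: ik'.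
rewrite [RHS]integral_mkcond; apply: eq_integral => y _.
rewrite patchE; case: ifPn => yB.
  rewrite -(lebesgue_itg _ ab0); last exact: continuous_pt2_0.
  rewrite [RHS]integral_mkcond; apply: eq_integral => x _.
  rewrite !patchE; congr (if _ then _ else _).
  by apply/idP/idP => /set_mem H; apply/mem_set; [case: H|split=> //; exact: set_mem].
rewrite -[RHS](@integral0 _ _ _ mu setT); apply: eq_integral => x _.
by rewrite patchE memNset// => -[_ /mem_set yB']; rewrite yB' in yB.
Qed.
End BoxIntegral.

Section PlaneIntegral.
Context {R : realType}.
Implicit Types (k g h : 'rV[R]_2 -> R) (D : set 'rV[R]_2).
Local Notation mu := (@lebesgue_measure R).
Local Notation mu2 := (mu \x mu)%E.

Definition leb h : R := \int[mu2]_z h (pt2 z).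

Lemma norm_pt2 (x y M : R) : M < `|x| \/ M < `|y| -> M < `|pt2 (x, y)|.
Proof.
have H j : `|pt2 (x, y) 0 j| <= `|pt2 (x, y)|.
  by rewrite [leRHS]/Num.norm /= mx_normrE (le_trans _ (@le_bigmax _ _ _ _ _ (0, j)))//.
case=> /lt_le_trans; apply; first by have := H 0; rewrite pt2E0.
by have := H 1; rewrite pt2E1.
Qed.

Lemma pt2_line0 (x y : R) : pt2 (x, y) = pt2 (0, y) + x *: e_ 0.
Proof.
apply/rowP => i; rewrite !mxE; case: eqVneq => _ /=; first by rewrite mulr1 add0r.
by rewrite mulr0 addr0.
Qed.

Lemma pt2_line1 (x y : R) : pt2 (x, y) = pt2 (x, 0) + y *: e_ 1.
Proof.
apply/rowP => i; have [->|i0] := eqVneq i 0; first by rewrite !mxE /= mulr0 addr0.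
by have -> : i = 1; [apply/val_inj; case: i i0 => [[|[|]]]|rewrite !mxE /= mulr1 add0r].
Qed.

Lemma is_derive_pt2_0 g (x y : R) : derivable g (pt2 (x, y)) (e_ 0) ->
  is_derive x (1 : R) (fun x => g (pt2 (x, y))) ('D_(e_ 0) g (pt2 (x, y))).
Proof.
rewrite [pt2 (x, y)]pt2_line0 => /is_derive_line.
by under eq_fun do rewrite -pt2_line0.
Qed.

Lemma is_derive_pt2_1 g (x y : R) : derivable g (pt2 (x, y)) (e_ 1) ->
  is_derive y (1 : R) (fun y => g (pt2 (x, y))) ('D_(e_ 1) g (pt2 (x, y))).
Proof.
rewrite [pt2 (x, y)]pt2_line1 => /is_derive_line.
by under eq_fun do rewrite -pt2_line1.
Qed.

Lemma box_restrict k (a0 b0 a1 b1 : R) :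
  (forall p, k p != 0 -> (a0 <= p 0 0 <= b0) && (a1 <= p 0 1 <= b1)) ->
  (fun z => (k (pt2 z))%:E) = (fun z => (k (pt2 z))%:E) \_ (`[a0, b0] `*` `[a1, b1]).
Proof.
move=> kb; apply/funext => -[x y]; rewrite patchE; case: ifPn => // /negP H.
have [->//|] := eqVneq (k (pt2 (x, y))) 0; move=> /kb; rewrite pt2E0 pt2E1 => /andP[xa ya].
by exfalso; apply: H; apply/mem_set; split; rewrite /= in_itv.
Qed.

Lemma bsupp_box k : bsupp k -> exists2 N : R, 0 < N &
  (forall p, k p != 0 -> (- N <= p 0 0 <= N) && (- N <= p 0 1 <= N)) /\
  forall x y : R, N <= `|x| \/ N <= `|y| -> k (pt2 (x, y)) = 0.
Proof.
move=> [M kM]; exists (`|M| + 1); first by rewrite ltr_wpDl.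
have MN : M < `|M| + 1 by rewrite (le_lt_trans (ler_norm M))// ltrDl.
have H2 x y : `|M| + 1 <= `|x| \/ `|M| + 1 <= `|y| -> k (pt2 (x, y)) = 0.
  by move=> H; apply/kM/norm_pt2; case: H => H; [left|right]; exact: lt_le_trans H.
split=> // p; apply: contraNT; rewrite negb_and -!ler_norml -!ltNge => H.
by rewrite -[p]pt2_eta; apply/eqP/H2; move/orP: H => [/ltW|/ltW] ?; [left|right].
Qed.

Lemma leb_integrable k : continuous k -> bsupp k -> mu2.-integrable setT (EFin \o (k \o pt2)).
Proof.
move=> ck sk; have [N N0 [kN _]] := bsupp_box sk.
have NN : - N < N by lra.
have mB : measurable (`[- N, N] `*` `[- N, N] : set (R * R)).
  by apply: measurableX; exact: measurable_itv.
have H := (@integrable_mkcond _ _ _ mu2 _ (EFin \o (k \o pt2)) mB).1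
  (box_integrable NN NN ck (cont_bsupp_bounded ck sk)).
by rewrite -[X in _.-integrable _ X]/(fun z => (k (pt2 z))%:E) (box_restrict kN).
Qed.

Lemma lebD g h : continuous g -> bsupp g -> continuous h -> bsupp h ->
  leb (fun q => g q + h q) = leb g + leb h.
Proof. by move=> *; apply: RintegralD => //; exact: leb_integrable. Qed.

Lemma lebZ (c : R) h : continuous h -> bsupp h -> leb (fun q => c * h q) = c * leb h.
Proof. by move=> *; apply: RintegralZl => //; exact: leb_integrable. Qed.

Lemma leb_xy k (a0 b0 a1 b1 : R) : a0 < b0 -> a1 < b1 -> continuous k -> bsupp k ->
  (forall p, k p != 0 -> (a0 <= p 0 0 <= b0) && (a1 <= p 0 1 <= b1)) ->
  (leb k = fine (\int[mu]_(x in `[a0, b0]) (itg (fun y => k (pt2 (x, y))) a1 b1)%:E)%E) /\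
  (leb k = fine (\int[mu]_(y in `[a1, b1]) (itg (fun x => k (pt2 (x, y))) a0 b0)%:E)%E).
Proof.
move=> ab0 ab1 ck sk kb; have bk := cont_bsupp_bounded ck sk.
rewrite -box_integral_xy// -box_integral_yx// /leb /Rintegral.
by rewrite [in X in _ = X /\ _]integral_mkcond [in X in _ /\ _ = X]integral_mkcond -(box_restrict kb).
Qed.

(** Fubini with the inner integral in direction j, an increment of g between two points where g
    vanishes. *)
Lemma leb_derive g j : (forall p, derivable g p (e_ j)) -> continuous ('D_(e_ j) g) -> bsupp g ->
  leb ('D_(e_ j) g) = 0.
Proof.
move=> dg cg sg; have sd := derive_bsupp (e_ j) sg.
have [N1 N10 [H1 H1']] := bsupp_box sg; have [N2 N20 [H2 H2']] := bsupp_box sd.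
pose N := N1 + N2; have NN : - N < N by rewrite /N; lra.
have N1N : N1 <= N by rewrite /N; lra.
have kb p : 'D_(e_ j) g p != 0 -> (- N <= p 0 0 <= N) && (- N <= p 0 1 <= N).
  by move=> /H2 /andP[/andP[? ?] /andP[? ?]]; rewrite /N; do ![apply/andP; split]; lra.
have [E1 E2] := leb_xy NN NN cg sd kb.
have Nn : N1 <= `|N| by rewrite (le_trans N1N)// ler_norm.
have Nn' : N1 <= `|- N| by rewrite normrN.
have [j0|j0] := eqVneq j 0.
  subst j; have Z (y : R) : itg (fun x => 'D_(e_ 0) g (pt2 (x, y))) (- N) N = 0.
    have cy := continuous_pt2_0 (y := y) cg; have dG x := is_derive_pt2_0 (dg (pt2 (x, y))).
    by rewrite (itgE _ _ cy dG) !H1' ?subrr//; left.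
  by rewrite E2; under eq_integral do rewrite Z; rewrite integral0.
have j1 : j = 1 by apply/val_inj; case: j j0 {dg cg sd H2 H2' kb E1 E2} => [[|[|]]].
subst j; have Z (x : R) : itg (fun y => 'D_(e_ 1) g (pt2 (x, y))) (- N) N = 0.
  have cx := continuous_pt2_1 (x := x) cg; have dG y := is_derive_pt2_1 (dg (pt2 (x, y))).
  by rewrite (itgE _ _ cx dG) !H1' ?subrr//; right.
by rewrite E1; under eq_integral do rewrite Z; rewrite integral0.
Qed.
End PlaneIntegral.

(** * Rotation and divergence of the smoothed kernel *)

Section KernelIntegral.
Context {R : realType}.
Implicit Types (k g h : 'rV[R]_2 -> R) (p q w : 'rV[R]_2).
Local Notation mu := (@lebesgue_measure R).
Local Notation mu2 := (mu \x mu)%E.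

Lemma DB_continuous N h : DB N.+1 h -> continuous h.
Proof.
move=> [C Hh] p; have H := bdiff1 Hh; have C0 := bdiff_ge0 Hh.
move=> P /nbhs_ballP[e /= e0 He].
have d0 : 0 < e / (C + 1) by rewrite divr_gt0// ltr_wpDl.
suff : \forall q \near p, P (h q) by [].
apply: filterS (near_enorm p d0) => q pq; apply: He; rewrite -ball_normE /= distrC.
have -> : q = p + (q - p) by rewrite addrC subrK.
apply: le_lt_trans (H p (q - p)) _.
by move: pq; rewrite ltr_pdivlMr ?ltr_wpDl//; apply: le_lt_trans; rewrite mulrC ler_wpM2l ?enorm_ge0// lerDl.
Qed.

Lemma DB_bounded N h : DB N h -> exists M : R, forall p, `|h p| <= M.
Proof. by move=> [C Hh]; exists C; exact: bdiff_norm Hh. Qed.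

(** The derivative of 2 atan (t/L): the joint flux density of the field q/|q|^2 through two opposite
    sides at distance L from its centre. *)
Definition arc (L t : R) : R := 2 * L / (L ^+ 2 + t ^+ 2).

Lemma itg_arc (L a : R) : 0 < L -> continuous (fun t => arc L (t - a)) /\
  itg (fun t => arc L (t - a)) (a - L) (a + L) = pi.
Proof.
move=> L0; have Ln : L != 0 by rewrite gt_eqF.
have dG (t : R) : is_derive t (1 : R) (fun t => 2 * atan ((t - a) / L)) (arc L (t - a)).
  have d1 : is_derive t (1 : R) (fun s : R => (s - a) / L) L^-1.
    have da := @is_deriveB R R^o R^o id (fun=> a) t 1 1 0 (is_derive_id _ _) (is_derive_cst _ _ _).
    have := @is_deriveZ R R^o R^o _ L^-1 _ _ _ da; rewrite subr0 [_ *: (1 : R)]mulr1.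
    by congr is_derive; apply/funext => s; rewrite /GRing.scale /= mulrC.
  have d2 := @is_derive1_comp R _ (fun s : R => (s - a) / L) _ _ _ (is_derive1_atan _) d1.
  have := @is_deriveZ R R^o R^o _ 2 _ _ _ d2; congr is_derive.
  rewrite /arc /GRing.scale /=.
  have Lt : L ^+ 2 + (t - a) ^+ 2 != 0 by rewrite gt_eqF// ltr_pwDl ?exprn_gt0// sqr_ge0.
  by field; rewrite Ln Lt.
have ca : continuous (fun t => arc L (t - a)).
  move=> t; apply: cvgMl_tmp; apply: cvgV.
    by rewrite gt_eqF// ltr_pwDl ?exprn_gt0// sqr_ge0.
  apply: cvgD; first exact: cvg_cst.
  have H : (s - a) @[s --> t] --> t - a by apply: cvgB; [exact: cvg_id|exact: cvg_cst].
  exact: (cvgM H H).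
split=> //; rewrite (itgE _ _ ca dG).
have -> : (a + L - a) / L = 1 by field.
have -> : (a - L - a) / L = -1 by field.
by rewrite atanN atan1; field.
Qed.

Section Kernel.
Variables (rho : R) (w : 'rV[R]_2).
Hypothesis rho0 : 0 < rho.

Definition dker i j q : R := 'D_(e_ i) (fun q => cker rho j (q - w)) q.

Lemma DB_ker N j : DB N (fun q => cker rho j (q - w)).
Proof. by apply: DB_shift; exact: DB_cker. Qed.

Lemma DB_dker N i j : DB N (dker i j).
Proof. by apply: (@DB_le _ _ N N.+1) => //; apply: DB_derive; exact: DB_ker. Qed.

Lemma dkerE i j q : rho < enorm (q - w) -> dker i j q =
  (i == j)%:R * (cker rho 0 (q - w) * cker rho 0 (q - w) + cker rho 1 (q - w) * cker rho 1 (q - w)) -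
  2 * (cker rho i (q - w) * cker rho j (q - w)).
Proof.
move=> rq; have D : derivable (cker rho j) (q - w) (e_ i).
  by apply: (@DB_derivable _ _ 0); exact: DB_cker.
apply: etrans (derive_cker rho0 i j rq).
by have [_ E] := is_derive_translate D.
Qed.

(** [rotker] and [divker] are the real and imaginary parts of the density of d(dz/(z - w)) for the
    smoothed kernel. They vanish off the disc, where the form is closed. *)
Definition rotker q := dker 0 1 q - dker 1 0 q.
Definition divker q := dker 0 0 q + dker 1 1 q.

Lemma rotker0 q : rho < enorm (q - w) -> rotker q = 0.
Proof. by move=> rq; rewrite /rotker !dkerE//=; ring. Qed.

Lemma divker0 q : rho < enorm (q - w) -> divker q = 0.
Proof. by move=> rq; rewrite /divker !dkerE//=; ring. Qed.

Let L : R := 2 * rho.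
Let L0 : 0 < L. Proof. by rewrite mulr_gt0. Qed.

Lemma cker_edge j (x y : R) : `|x| = L \/ `|y| = L ->
  cker rho j (pt2 (w 0 0 + x, w 0 1 + y) - w) = pt2 (x, y) 0 j / (x ^+ 2 + y ^+ 2).
Proof.
have -> : pt2 (w 0 0 + x, w 0 1 + y) - w = pt2 (x, y).
  rewrite -[w in _ - w]pt2_eta; apply/rowP => i; rewrite !mxE.
  by case: ifP => _ /=; rewrite addrAC subrr add0r.
move=> H; rewrite ckerE ?sqdist2E ?pt2E0 ?pt2E1 -?expr2//.
have rL : rho <= L by have r0 := rho0; rewrite /L; lra.
case: H => H; apply: le_trans rL _; rewrite -H.
  by have := coord_le_enorm (pt2 (x, y)) 0; rewrite pt2E0.
by have := coord_le_enorm (pt2 (x, y)) 1; rewrite pt2E1.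
Qed.

Let box : set (R * R) := `[w 0 0 - L, w 0 0 + L] `*` `[w 0 1 - L, w 0 1 + L].
Let ab0 : w 0 0 - L < w 0 0 + L. Proof. by have := L0; lra. Qed.
Let ab1 : w 0 1 - L < w 0 1 + L. Proof. by have := L0; lra. Qed.

Lemma box_dker0 j : (\int[mu2]_(z in box) (dker 0 j (pt2 z))%:E =
  \int[mu]_(y in `[(w 0 1 - L)%R, (w 0 1 + L)%R])
    (cker rho j (pt2 (w 0 0 + L, y) - w) - cker rho j (pt2 (w 0 0 - L, y) - w))%R%:E)%E.
Proof.
have cd := DB_continuous (DB_dker 1 0 j).
rewrite box_integral_yx//; last exact: DB_bounded (DB_dker 0 0 j).
apply: eq_integral => y _; congr EFin.
have cy := continuous_pt2_0 (y := y) cd.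
have dG x := is_derive_pt2_0 (@DB_derivable _ _ 0 _ (pt2 (x, y)) (e_ 0) (DB_ker 2 j)).
by rewrite (itgE _ _ cy dG).
Qed.

Lemma box_dker1 j : (\int[mu2]_(z in box) (dker 1 j (pt2 z))%:E =
  \int[mu]_(x in `[(w 0 0 - L)%R, (w 0 0 + L)%R])
    (cker rho j (pt2 (x, w 0 1 + L) - w) - cker rho j (pt2 (x, w 0 1 - L) - w))%R%:E)%E.
Proof.
have cd := DB_continuous (DB_dker 1 1 j).
rewrite box_integral_xy//; last exact: DB_bounded (DB_dker 0 1 j).
apply: eq_integral => x _; congr EFin.
have cx := continuous_pt2_1 (x := x) cd.
have dG y := is_derive_pt2_1 (@DB_derivable _ _ 0 _ (pt2 (x, y)) (e_ 1) (DB_ker 2 j)).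
by rewrite (itgE _ _ cx dG).
Qed.

Lemma leb_box h : (forall q, rho < enorm (q - w) -> h q = 0) ->
  leb h = fine (\int[mu2]_(z in box) (h (pt2 z))%:E)%E.
Proof.
move=> h0; rewrite /leb /Rintegral [in RHS]integral_mkcond -box_restrict// => p.
apply: contraNT => H; apply/eqP/h0; have rL : rho < L by have r0 := rho0; rewrite /L; lra.
apply: lt_le_trans rL _; move: H; rewrite negb_and => /orP[] H.
  apply: le_trans (coord_le_enorm _ 0); rewrite !mxE; move: H; rewrite negb_and -!ltNge ler_normr.
  by case/orP => H; apply/orP; [right|left]; lra.
apply: le_trans (coord_le_enorm _ 1); rewrite !mxE; move: H; rewrite negb_and -!ltNge ler_normr.
by case/orP => H; apply/orP; [right|left]; lra.
Qed.

Lemma dker_integrable i j : mu2.-integrable box (fun z => (dker i j (pt2 z))%:E).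
Proof.
exact: (box_integrable ab0 ab1 (DB_continuous (DB_dker 1 i j)) (DB_bounded (DB_dker 0 i j))).
Qed.

Lemma measurable_box : measurable box.
Proof. by apply: measurableX; exact: measurable_itv. Qed.

Lemma leb_rotker : leb rotker = 0.
Proof.
have LL : `|L| = L := ger0_norm (ltW L0); have mb := measurable_box.
rewrite (leb_box rotker0); under eq_integral do rewrite EFinB.
rewrite integralB//; [|exact: dker_integrable|exact: dker_integrable].
rewrite box_dker0 box_dker1.
rewrite (eq_integral (fun=> 0%E)) => [|y _]; last first.
  have := @cker_edge 1 L (y - w 0 1); have := @cker_edge 1 (- L) (y - w 0 1).
  rewrite !(addrC (w 0 1)) subrK => -> ; last by left; rewrite normrN.
  by move=> ->; [rewrite !pt2E1 sqrrN subrr|left].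
rewrite integral0 sub0e.
rewrite (eq_integral (fun=> 0%E)) => [|x _]; last first.
  have := @cker_edge 0 (x - w 0 0) L; have := @cker_edge 0 (x - w 0 0) (- L).
  rewrite !(addrC (w 0 0)) subrK => -> ; last by right; rewrite normrN.
  by move=> ->; [rewrite !pt2E0 sqrrN subrr|right].
by rewrite integral0 oppe0.
Qed.

(** The divergence theorem on the square of half side 2 rho, whose boundary only sees the explicit
    kernel; each pair of opposite sides contributes pi. *)
Lemma leb_divker : leb divker = 2 * pi.
Proof.
have LL : `|L| = L := ger0_norm (ltW L0); have mb := measurable_box.
rewrite (leb_box divker0); under eq_integral do rewrite EFinD.
rewrite integralD//; [|exact: dker_integrable|exact: dker_integrable].
rewrite box_dker0 box_dker1.
have [c0 E0] := itg_arc (w 0 0) L0; have [c1 E1] := itg_arc (w 0 1) L0.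
have I0 : (\int[mu]_(y in `[(w 0 1 - L)%R, (w 0 1 + L)%R])
    (cker rho 0 (pt2 (w 0 0 + L, y) - w) - cker rho 0 (pt2 (w 0 0 - L, y) - w))%R%:E = pi%:E)%E.
  rewrite -E1 -lebesgue_itg//; apply: eq_integral => y _; congr EFin.
  have := @cker_edge 0 L (y - w 0 1); have := @cker_edge 0 (- L) (y - w 0 1).
  rewrite !(addrC (w 0 1)) subrK => -> ; last by left; rewrite normrN.
  by move=> ->; [rewrite !pt2E0 sqrrN /arc; ring|left].
have I1 : (\int[mu]_(x in `[(w 0 0 - L)%R, (w 0 0 + L)%R])
    (cker rho 1 (pt2 (x, w 0 1 + L) - w) - cker rho 1 (pt2 (x, w 0 1 - L) - w))%R%:E = pi%:E)%E.
  rewrite -E0 -lebesgue_itg//; apply: eq_integral => x _; congr EFin.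
  have := @cker_edge 1 (x - w 0 0) L; have := @cker_edge 1 (x - w 0 0) (- L).
  rewrite !(addrC (w 0 0)) subrK => -> ; last by right; rewrite normrN.
  by move=> ->; [rewrite !pt2E1 sqrrN /arc (addrC (_ ^+ 2)); ring|right].
by rewrite I0 I1 /=; ring.
Qed.
End Kernel.
End KernelIntegral.

(** * Stokes' formula for forms vanishing near the frontier *)

Section OpenSetIntegral.
Context {R : realType}.
Implicit Types (g h : 'rV[R]_2 -> R) (D W : set 'rV[R]_2) (p v : 'rV[R]_2).
Local Notation mu := (@lebesgue_measure R).
Local Notation mu2 := (mu \x mu)%E.

Lemma continuous_scale (c : R) h : continuous h -> continuous (fun q => c * h q).
Proof. move=> ch p; exact: (@cvgMl_tmp R _ (nbhs p) _ h c (h p) (ch p)). Qed.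

Definition cutto D g p : R := if p \in D then g p else 0.

Lemma cutto_in D g p : D p -> cutto D g p = g p.
Proof. by rewrite /cutto => /mem_set ->. Qed.

Lemma cutto_out D g p : ~ D p -> cutto D g p = 0.
Proof. by move=> nD; rewrite /cutto memNset. Qed.

Lemma integral_cutto D h : \int[mu2]_(z in pt2 @^-1` D) h (pt2 z) = leb (cutto D h).
Proof.
rewrite Rintegral_mkcond; congr (fine _); apply: eq_integral => z _; congr EFin.
Qed.

Section FrontierZero.
Variables (D W : set 'rV[R]_2).
Hypotheses (oD : open D) (oW : open W) (DW : closure D `\` D `<=` W).

(** Truncation by [D] creates no jump, since g vanishes near the frontier: around each point the
    truncated function is g or 0. *)
Lemma near_cutto g p : (forall q, W q -> g q = 0) ->
  (D p /\ \forall q \near p, g q = cutto D g q) \/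
  (~ D p /\ \forall q \near p, 0 = cutto D g q).
Proof.
move=> gW; have nearO (O : set 'rV[R]_2) : open O -> O p -> \forall q \near p, O q.
  by rewrite openE => H /H.
have [Dp|nDp] := pselect (D p).
  left; split=> //; apply: filterS (nearO _ oD Dp) => q Dq; by rewrite cutto_in.
right; split=> //; have [Cp|nCp] := pselect (closure D p).
  have Wp : W p by exact: DW.
  apply: filterS (nearO _ oW Wp) => q /gW g0.
  by rewrite /cutto g0 if_same.
have oC : open (~` closure D) by apply: closed_openC; exact: closed_closure.
apply: filterS (nearO _ oC nCp) => q Cq; rewrite cutto_out// => Dq.
by apply: Cq; exact: subset_closure.
Qed.

Lemma is_derive_cutto g p v : (forall q, W q -> g q = 0) -> (forall q, derivable g q v) ->
  is_derive p v (cutto D g) (cutto D ('D_v g) p).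
Proof.
move=> gW dg; have [[Dp H]|[Dp H]] := near_cutto p gW.
  rewrite cutto_in//; apply: (@near_eq_is_derive R _ R^o g) => //.
rewrite cutto_out//; have dc := @is_derive_cst R 'rV[R]_2 R^o 0 p v.
by apply: (@near_eq_is_derive R _ R^o (fun=> 0)).
Qed.

Lemma derive_W0 g v : (forall q, W q -> g q = 0) -> forall q, W q -> 'D_v g q = 0.
Proof.
move=> gW q Wq; have dc := @is_derive_cst R 'rV[R]_2 R^o 0 q v.
have [//|_ ->] := @near_eq_is_derive R _ R^o (fun=> 0) g q v 0 _ dc; last by [].
by move: oW; rewrite openE => /(_ _ Wq); apply: filterS => x /gW.
Qed.

Lemma continuous_cutto g : (forall q, W q -> g q = 0) -> continuous g -> continuous (cutto D g).
Proof.
move=> gW cg p; have [[Dp H]|[Dp H]] := near_cutto p gW.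
  rewrite /continuous_at cutto_in//.
  move=> P /(cg p) HP; suff : \forall q \near p, P (cutto D g q) by [].
  by apply: filterS2 H HP => q /= <-.
rewrite /continuous_at cutto_out//.
move=> P /nbhs_singleton P0; suff : \forall q \near p, P (cutto D g q) by [].
by apply: filterS H => q <-.
Qed.

(** Truncation commutes with derivation here, so the integrand extends to the plane as a combination
    of derivatives of functions with bounded support. No regularity of the frontier enters. *)
Lemma stokes_open g1 g2 : (exists M : R, forall p, D p -> `|p| <= M) ->
  DB 2 g1 -> DB 2 g2 -> (forall q, W q -> g1 q = 0) -> (forall q, W q -> g2 q = 0) ->
  \int[mu2]_(z in pt2 @^-1` D) ('D_(e_ 0) g2 (pt2 z) - 'D_(e_ 1) g1 (pt2 z)) = 0.
Proof.
move=> [M DM] D1 D2 g1W g2W.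
have sD g : bsupp (cutto D g).
  by exists M => p Mp; rewrite cutto_out// => /DM; rewrite leNgt Mp.
have dd g j : DB 2 g -> (forall q, W q -> g q = 0) ->
    'D_(e_ j) (cutto D g) = cutto D ('D_(e_ j) g).
  move=> Dg gW; apply/funext => p.
  by have [_ ->] := is_derive_cutto p gW (fun q => @DB_derivable _ _ 0 g q (e_ j) Dg).
have cd g j : DB 2 g -> (forall q, W q -> g q = 0) -> continuous ('D_(e_ j) (cutto D g)).
  move=> Dg gW; rewrite dd//; apply: continuous_cutto; first exact: derive_W0.
  exact: (@DB_continuous _ 0 _ (@DB_derive _ _ 0 _ _ Dg)).
have lz g j : DB 2 g -> (forall q, W q -> g q = 0) -> leb ('D_(e_ j) (cutto D g)) = 0.
  move=> Dg gW; apply: leb_derive => //; last exact: cd.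
  by move=> p; have [] := is_derive_cutto p gW (fun q => @DB_derivable _ _ 0 g q (e_ j) Dg).
rewrite (integral_cutto D (fun p => 'D_(e_ 0) g2 p - 'D_(e_ 1) g1 p)).
have -> : cutto D (fun p => 'D_(e_ 0) g2 p - 'D_(e_ 1) g1 p) =
    (fun p => 'D_(e_ 0) (cutto D g2) p + -1 * 'D_(e_ 1) (cutto D g1) p).
  apply/funext => p.
  have ddp g j : DB 2 g -> (forall q, W q -> g q = 0) ->
      'D_(e_ j) (cutto D g) p = cutto D ('D_(e_ j) g) p.
    by move=> Dg gW; exact: (congr1 (fun k => k p) (dd g j Dg gW)).
  rewrite !ddp// /cutto; case: ifP => _; by ring.
have c0 := cd g2 0 D2 g2W; have c1 := cd g1 1 D1 g1W.
have s0 : bsupp ('D_(e_ 0) (cutto D g2)) by exact: derive_bsupp.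
have s1 : bsupp ('D_(e_ 1) (cutto D g1)) by exact: derive_bsupp.
rewrite lebD//.
- by rewrite lebZ// !lz// mulr0 addr0.
- exact: continuous_scale c1.
- exact: bsuppM (fun=> -1) s1.
Qed.
End FrontierZero.
End OpenSetIntegral.

(** * The Hahn-Banach theorem *)

Section HahnBanach.
Context {R : realType} {V : lmodType R}.
Implicit Types (p q : V -> R) (x y : V).

Definition sublinear p :=
  (forall x y, p (x + y) <= p x + p y) /\ (forall (t : R) x, 0 <= t -> p (t *: x) <= t * p x).

Lemma sublinear0 p : sublinear p -> p 0 = 0.
Proof.
move=> [pD pZ]; apply/le_anti; have := pZ 0 0 (lexx _); rewrite scale0r mul0r => -> /=.
by have := pD 0 0; rewrite addr0 -subr_ge0 addrK.
Qed.

Lemma sublinear_ge p x : sublinear p -> - p (- x) <= p x.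
Proof.
move=> Hp; have [pD _] := Hp; have := pD x (- x).
by rewrite subrr (sublinear0 Hp) -lerBlDr sub0r.
Qed.

Lemma sublinearZ p (t : R) x : sublinear p -> 0 <= t -> p (t *: x) = t * p x.
Proof.
move=> Hp; have [_ pZ] := Hp; rewrite le_eqVlt => /orP[/eqP <-|t0].
  by rewrite scale0r mul0r sublinear0.
have ti : 0 < t^-1 by rewrite invr_gt0.
apply/le_anti/andP; split; first exact/pZ/ltW.
rewrite -(ler_pM2l ti) mulrA mulVf ?gt_eqF// mul1r.
by have := pZ t^-1 (t *: x) (ltW ti); rewrite scalerA mulVf ?gt_eqF// scale1r.
Qed.

(* Lowering p in the direction -y forces p (- y) = - p y, so a minimal sublinear
   functional is odd, hence linear. *)
Lemma sublinear_step p y : sublinear p ->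
  exists p', [/\ sublinear p', forall x, p' x <= p x & p' (- y) <= - p y].
Proof.
move=> Hp; have [pD pZ] := Hp.
pose S x := [set p (x + t *: y) - t * p y | t in [set t : R | 0 <= t]].
have S0 x : S x !=set0 by exists (p (x + 0 *: y) - 0 * p y), 0 => /=.
have Slb x : lbound (S x) (- p (- x)).
  move=> _ [t /= t0 <-]; have := pD (x + t *: y) (- x).
  rewrite addrAC subrr add0r sublinearZ//; lra.
have Sle x (t : R) : 0 <= t -> inf (S x) <= p (x + t *: y) - t * p y.
  by move=> t0; apply: ge_inf; [exists (- p (- x)); exact: Slb|exists t].
have Sle0 x : inf (S x) <= p x by have := Sle x 0 (lexx _); rewrite scale0r addr0 mul0r subr0.
exists (fun x => inf (S x)); split=> //; last first.
  by have := Sle (- y) 1 ler01; rewrite scale1r addNr (sublinear0 Hp) mul1r sub0r.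
split=> [x1 x2|s x s0].
  rewrite -lerBlDr; apply: lb_le_inf => // _ [t1 /= t10 <-].
  rewrite lerBlDr -lerBlDl; apply: lb_le_inf => // _ [t2 /= t20 <-].
  rewrite lerBlDl; apply: le_trans (Sle _ _ (addr_ge0 t10 t20)) _.
  by have := pD (x1 + t1 *: y) (x2 + t2 *: y); rewrite addrACA -scalerDl; lra.
have [->|sn] := eqVneq s 0.
  by rewrite scale0r mul0r (le_trans (Sle0 _))// (sublinear0 Hp).
have sp : 0 < s by rewrite lt_neqAle eq_sym sn.
rewrite mulrC -ler_pdivrMr//; apply: lb_le_inf => // _ [t /= t0 <-].
rewrite ler_pdivrMr// mulrC; apply: le_trans (Sle _ _ (mulr_ge0 s0 t0)) _.
by rewrite -scalerA -scalerDr mulrBr mulrA lerD2r pZ.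
Qed.

(** Pointwise infimum, finite because [- q (- x)] bounds every member from below. For two members,
    subadditivity is that of the smaller one, hence the totality. *)
Lemma sublinear_chain q (A : set (V -> R)) : A !=set0 ->
  (forall p, A p -> sublinear p /\ forall x, p x <= q x) ->
  (forall p p', A p -> A p' -> (forall x, p x <= p' x) \/ (forall x, p' x <= p x)) ->
  exists p0, sublinear p0 /\ forall p, A p -> forall x, p0 x <= p x.
Proof.
move=> [a Aa] HA tot; pose S x := [set p x | p in A].
have S0 x : S x !=set0 by exists (a x), a.
have Slb x : lbound (S x) (- q (- x)).
  move=> _ [p /HA[Hp pq] <-]; apply: le_trans (sublinear_ge x Hp).
  by rewrite lerN2.
have Sle x p : A p -> inf (S x) <= p x.
  by move=> Ap; apply: ge_inf; [exists (- q (- x)); exact: Slb|exists p].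
exists (fun x => inf (S x)); split=> [|p Ap x]; last exact: Sle.
split=> [x y|t x t0].
  rewrite -lerBlDr; apply: lb_le_inf => // _ [p1 A1 <-].
  rewrite lerBlDr -lerBlDl; apply: lb_le_inf => // _ [p2 A2 <-].
  rewrite lerBlDl; have [H|H] := tot _ _ A1 A2.
    apply: le_trans (Sle _ _ A1) _; have [[pD _] _] := HA _ A1.
    by apply: le_trans (pD _ _) _; rewrite lerD2l.
  apply: le_trans (Sle _ _ A2) _; have [[pD _] _] := HA _ A2.
  by apply: le_trans (pD _ _) _; rewrite lerD2r.
have [->|tn] := eqVneq t 0.
  rewrite scale0r mul0r (le_trans (Sle _ _ Aa))//.
  by have [/sublinear0 -> _] := HA _ Aa.
have tp : 0 < t by rewrite lt_neqAle eq_sym tn.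
rewrite mulrC -ler_pdivrMr//; apply: lb_le_inf => // _ [p Ap <-].
rewrite ler_pdivrMr// mulrC; apply: le_trans (Sle _ _ Ap) _.
by have [[_ pZ] _] := HA _ Ap; exact: pZ.
Qed.

Lemma minimal_sublinear q : sublinear q -> exists p, [/\ sublinear p, forall x, p x <= q x &
  forall p', sublinear p' -> (forall x, p' x <= p x) -> p' = p].
Proof.
move=> Hq; pose T := {p : V -> R | sublinear p /\ forall x, p x <= q x}.
have [||||[p [Hp pq]] pmin] := @Zorn T (fun s t => `[< forall x, sval t x <= sval s x >]).
- by move=> t; apply/asboolP => x.
- by move=> s t u /asboolP st /asboolP tu; apply/asboolP => x; exact: le_trans (tu x) (st x).
- move=> [s Hs] [t Ht] /asboolP /= st /asboolP /= ts; apply: eq_exist; apply/funext => x.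
  by apply/le_anti; rewrite st ts.
(* The empty chain is bounded by [q] itself. *)
- move=> A tot; have [->|/set0P[a Aa]] := eqVneq A set0.
    by exists (exist _ q (conj Hq (fun x => lexx _))).
  have [|||p0 [Hp0 p0A]] := @sublinear_chain q [set sval s | s in A].
  + by exists (sval a), a.
  + by move=> _ [s _ <-]; exact: (proj2_sig s).
  + by move=> _ _ [s As <-] [t At <-]; have [/asboolP H|/asboolP H] := tot s t As At; [right|left].
  have p0q x : p0 x <= q x.
    apply: le_trans (p0A (sval a) _ x) _; first by exists a.
    by have [_] := proj2_sig a; apply.
  exists (exist _ p0 (conj Hp0 p0q)) => s As; apply/asboolP => x /=.
  by apply: p0A; exists s.
exists p; split=> // p' Hp' p'p.
have p'q x : p' x <= q x by exact: le_trans (p'p x) (pq x).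
by have := pmin (exist _ p' (conj Hp' p'q)) (asboolT p'p) => /(congr1 sval).
Qed.

(** The value at [x0] is secured by one lowering step at [x0], performed before passing to a minimal
    functional. *)
Lemma hahn_banach q x0 : sublinear q -> exists phi : V -> R,
  [/\ forall x y, phi (x + y) = phi x + phi y, forall (t : R) x, phi (t *: x) = t * phi x,
      forall x, phi x <= q x & phi x0 = q x0].
Proof.
move=> Hq; have [q' [Hq' q'q q'x0]] := sublinear_step x0 Hq.
have [p [Hp pq' pmin]] := minimal_sublinear Hq'; have [pD pZ] := Hp.
have podd y : p (- y) = - p y.
  apply/le_anti; rewrite -[X in _ && X]lerN2 opprK sublinear_ge// andbT.
  have [p' [Hp' p'p p'y]] := sublinear_step y Hp.
  by rewrite -{1}(pmin _ Hp' p'p).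
have pq x : p x <= q x by exact: le_trans (pq' x) (q'q x).
exists p; split=> //.
- move=> x y; apply/le_anti; rewrite pD /=.
  by have := pD (x + y) (- y); rewrite addrK podd lerBrDr.
- move=> t x; have [t0|t0] := leP 0 t; first exact: sublinearZ.
  by rewrite -[t]opprK scaleNr podd sublinearZ ?mulNr// oppr_ge0 ltW.
- apply/le_anti; rewrite pq /= -lerN2 -podd.
  exact: le_trans (pq' _) q'x0.
Qed.
End HahnBanach.

(** * Supports detected by forms *)

Section SupportByForms.
Context {R : realType} {n k : nat}.
Implicit Types (A B : pchain R n k) (W X : set 'rV[R]_n) (a : kvec R n k).

Definition mkpchain (A : 'rV[R]_n -> kvec R n k) (fA : finsupp A) : pchain R n k :=
  PChain (introT (pointedP A) fA).

Definition ptc p a : pchain R n k := mkpchain (finsupp_ptchain p a).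

Lemma kmassZ (t : R) a : 0 < t -> kmass (t *: a) <= t * kmass a.
Proof.
pose D a := [set x : R | exists s : seq (R * 'M[R]_(k, n)),
  a = \sum_(u <- s) u.1 *: wedge u.2 /\ x = \sum_(u <- s) `|u.1| * kvol u.2].
have DZ (c : R) b x : 0 < c -> D b x -> D (c *: b) (c * x).
  move=> c0 [s [-> ->]]; exists [seq (c * u.1, u.2) | u <- s]; rewrite !big_map; split.
    by rewrite scaler_sumr; apply: eq_bigr => u _; rewrite scalerA.
  by rewrite mulr_sumr; apply: eq_bigr => u _; rewrite normrM (gtr0_norm c0) mulrA.
have Dlb b : lbound (D b) 0.
  move=> _ [s [_ ->]]; apply: sumr_ge0 => i _; by rewrite mulr_ge0 ?sqrtr_ge0.
move=> t0; rewrite -[kmass _]/(inf (D (t *: a))) -[kmass a]/(inf (D a)).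
have [Da|/set0P Da] := eqVneq (D a) set0.
  have -> : D (t *: a) = set0.
    apply/seteqP; split=> // x Dx; have ti : 0 < t^-1 by rewrite invr_gt0.
    by have := DZ _ _ _ ti Dx; rewrite scalerA mulVf ?gt_eqF// scale1r Da.
  by rewrite Da inf0 mulr0.
rewrite mulrC -ler_pdivrMr//; apply: lb_le_inf => // x Dx.
rewrite ler_pdivrMr// mulrC; apply: ge_inf; first by exists 0.
exact: DZ.
Qed.

Lemma dchainZ (t : R) (c : dcell R n k) :
  dchain (DCell (dc_shifts c) (dc_point c) (t *: dc_vec c)) = (fun p => t *: dchain c p).
Proof.
case: c => us p a; rewrite /dchain /=; elim: us => [|u us IH] /=.
  by apply/funext => x; rewrite /ptchain; case: ifP => // _; rewrite scaler0.
by rewrite IH; apply/funext => x; rewrite /diffop scalerBr.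
Qed.

Lemma BnormZ r (t : R) A : 0 <= t -> Bnorm r (t *: A) <= t * Bnorm r A.
Proof.
rewrite le_eqVlt => /orP[/eqP <-|t0]; first by rewrite scale0r mul0r Bnorm0.
rewrite mulrC -ler_pdivrMr//; apply: lb_le_inf; first exact: Bnorm_set_neq0.
move=> _ [s [sr As ->]]; rewrite ler_pdivrMr//.
have H : Bnorm_set r (t *: A)
    (\sum_(c <- s) dsize (DCell (dc_shifts c) (dc_point c) (t *: dc_vec c))).
  exists [seq DCell (dc_shifts c) (dc_point c) (t *: dc_vec c) | c <- s].
  rewrite all_map !big_map; split=> //; apply/funext => p.
  rewrite -[LHS]/(t *: pchain_val A p) As !fct_sumE scaler_sumr.
  by apply: eq_bigr => c _; rewrite dchainZ.
apply: le_trans (Bnorm_le H) _; rewrite mulrC mulr_sumr; apply: ler_sum => c _.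
rewrite /dsize /= mulrCA ler_wpM2l ?kmassZ//.
by apply: prodr_ge0 => u _; exact: enorm_ge0.
Qed.

Lemma dchain_Bnorm r (c : dcell R n k) : (dorder c <= r)%N ->
  Bnorm r (mkpchain (finsupp_dchain c)) <= dsize c.
Proof. by move=> cr; apply: Bnorm_le; exists [:: c]; rewrite /= cr !big_seq1. Qed.

Lemma pchain_decomp A : A = \sum_(p <- finmap.enum_fset (fset_set [set p | A p != 0]))
  \sum_s A p s *: ptc p (ekvec s).
Proof.
apply/val_inj/funext => x; rewrite raddf_sum fct_sumE.
under eq_bigr do rewrite raddf_sum fct_sumE.
have E p : \sum_s (\val (A p s *: ptc p (ekvec s))) x = if x == p then A p else 0.
  transitivity (\sum_s (if x == p then A p s *: ekvec s else 0 : kvec R n k)).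
    apply: eq_bigr => s _; rewrite -[LHS]/(A p s *: ptchain p (ekvec s) x) /ptchain.
    by case: ifP => _ //; rewrite scaler0.
  case: ifP => _; last by rewrite big1.
  apply/ffunP => u; rewrite sum_ffunE (bigD1 u)//= big1 ?addr0 => [|s su].
    by rewrite !ffunE eqxx [_ *: _]mulr1.
  by rewrite !ffunE eq_sym (negbTE su) [_ *: _]mulr0.
under eq_bigr do rewrite E.
have [Ax0|Ax0] := eqVneq (A x) 0.
  by rewrite big1 => [//|p _]; case: eqP => // <-.
rewrite (bigD1_seq x) /= ?finmap.fset_uniq ?in_fset_set ?inE//; last exact: finsupp_pchain.
by rewrite eqxx big1 ?addr0// => p; rewrite eq_sym => /negbTE ->.
Qed.

Section LinearFunctional.
Variable phi : pchain R n k -> R.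
Hypothesis phiD : forall A B, phi (A + B) = phi A + phi B.
Hypothesis phiZ : forall (t : R) A, phi (t *: A) = t * phi A.

(** Pointed chains are spanned by the (p; e_s), so the values of [phi] there are the coefficients of
    a form representing it. *)
Definition dual_form : Defs.form R n k := fun p => [ffun s => phi (ptc p (ekvec s))].

Lemma dual_formE A : phi A = form_eval dual_form A.
Proof.
have phi0 : phi 0 = 0 by rewrite -(scale0r 0) phiZ mul0r.
rewrite {1}(pchain_decomp A) (big_morph phi phiD phi0).
rewrite (@form_eval_finite _ _ _ _ _ [set p | A p != 0])//; last exact: finsupp_pchain.
rewrite fsbig_finite//=; last exact: finsupp_pchain.
apply: eq_bigr => p _; rewrite (big_morph phi phiD phi0); apply: eq_bigr => s _.
by rewrite phiZ ffunE mulrC.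
Qed.

(** A difference of a coefficient along [us] is the value of [phi] on the corresponding difference
    chain, whose norm is at most the product of the shifts. *)
Lemma DB_dual_form r : (forall A, `|phi A| <= Bnorm r A) ->
  (forall s : kidx n k, kmass (@ekvec R n k s) <= 1) -> DBform r dual_form.
Proof.
move=> phiB He s; exists 1 => us p sus; rewrite mul1r.
pose c := DCell us p (@ekvec R n k s).
have -> : fdiffs us (fun p => dual_form p s) p = phi (mkpchain (finsupp_dchain c)).
  rewrite dual_formE /= (form_eval_dchain _ c) (bigD1 s)//= ffunE eqxx mul1r big1 ?addr0// => t ts.
  by rewrite ffunE (negbTE ts) mul0r.
apply: le_trans (phiB _) _; apply: le_trans (dchain_Bnorm (c := c) sus) _.
by rewrite /dsize /= -[leRHS]mulr1 ler_wpM2l ?He// shiftprod_ge0.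
Qed.
End LinearFunctional.

(* Otherwise a linear functional vanishing on the pointed chains near X separates them
   from J, and every bounded functional is given by a form. *)
Lemma supports_forms r (J : chain R n k r) X :
  (forall a s, `|a s| <= kmass a) -> (forall s : kidx n k, kmass (@ekvec R n k s) <= 1) ->
  (forall w W, DBform r w -> open W -> X `<=` W -> (forall p, W p -> w p = 0) ->
    Defs.integral J w = 0) ->
  supports X J.
Proof.
move=> Hk He H W oW W0 XW.
pose M := [set A : pchain R n k | [set p | A p != 0] `<=` W].
have M0 : M 0 by move=> p /=; rewrite eqxx.
have MD A B : M A -> M B -> M (A + B).
  move=> MA MB p; suff : A p + B p != 0 -> W p by [].
  have [Ap|/MA//] := eqVneq (A p) 0; rewrite Ap add0r; exact: MB.
have MZ (t : R) A : M A -> M (t *: A).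
  move=> MA p; suff : t *: A p != 0 -> W p by [].
  by have [->|/MA//] := eqVneq (A p) 0; rewrite scaler0 eqxx.
suff key e : 0 < e -> exists2 A, M A & chain_dist A J < e.
  have Hi (i : nat) : {A | M A & chain_dist A J < i.+1%:R^-1}.
    by apply: cid2; apply: key; rewrite invr_gt0.
  exists (fun i => s2val (Hi i)) => [i|]; first by have := s2valP (Hi i).
  apply: (@squeeze_cvgr _ _ _ _ (fun=> 0) (fun i => i.+1%:R^-1)).
  - near=> i; rewrite [X in _ && X]ltW ?andbT; last by have := s2valP' (Hi i).
    apply: limr_ge; first by apply/cvg_ex; eexists; exact: chain_dist_cvg.
    by near=> j; exact: Bnorm_ge0.
  - exact: cvg_cst.
  - exact: cvg_harmonic.
move=> e0; apply: contrapT => /forall2NP He'.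
have far A : M A -> e <= chain_dist A J.
  by move=> MA; rewrite leNgt; apply/negP; have [] := He' A.
(* The distance to the subspace [M]: a linear functional below it vanishes on [M] and is bounded by
   [Bnorm r]. *)
pose q (A : pchain R n k) := inf [set Bnorm r (A - m) | m in M].
have qle A m : M m -> q A <= Bnorm r (A - m).
  by move=> Mm; apply: ge_inf; [exists 0 => _ [? _ <-]; exact: Bnorm_ge0|exists m].
have qge A (c : R) : (forall m, M m -> c <= Bnorm r (A - m)) -> c <= q A.
  move=> Hc; apply: lb_le_inf; first by exists (Bnorm r (A - 0)), 0.
  by move=> _ [m Mm <-]; exact: Hc.
have qsub : sublinear q.
  split=> [A B|t A t0].
    rewrite -lerBlDr; apply: (qge _ _) => m1 M1; rewrite lerBlDr -lerBlDl; apply: (qge _ _) => m2 M2.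
    rewrite lerBlDl; apply: le_trans (qle _ _ (MD _ _ M1 M2)) _.
    by rewrite opprD addrACA ler_BnormD.
  move: t0; rewrite le_eqVlt => /orP[/eqP <-|t0].
    by have := qle 0 0 M0; rewrite subr0 Bnorm0 scale0r mul0r.
  rewrite mulrC -ler_pdivrMr//; apply: (qge _ _) => m Mm; rewrite ler_pdivrMr// mulrC.
  apply: le_trans (qle _ _ (MZ t _ Mm)) _; rewrite -scalerBr; exact/BnormZ/ltW.
have e4 : 0 < e / 4 by rewrite divr_gt0.
(* [J] lies in the completion, so the functional is chosen at a nearby pointed chain. One e/4 is
   lost in this choice and another in the limit, which leaves e/2. *)
have [N HN] := repr_cauchy J e4; pose x0 := repr J N.
have qx0 : e - e / 4 <= q x0.
  apply: (qge _ _) => m Mm; rewrite lerBlDr; apply: le_trans (far m Mm) _.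
  apply: limr_le; first by apply/cvg_ex; eexists; exact: chain_dist_cvg.
  near=> i; have Ni : (N <= i)%N by near: i; exists N.
  have := ler_BnormD r (m - x0) (x0 - repr J i); rewrite addrA subrK => /le_trans; apply.
  by rewrite -BnormN opprB lerD2l ltW// HN.
have [phi [phiD phiZ phiq phix0]] := hahn_banach x0 qsub.
have phiN A : phi (- A) = - phi A by rewrite -scaleN1r phiZ mulN1r.
have phiB A : `|phi A| <= Bnorm r A.
  have qB B : q B <= Bnorm r B by have := qle B 0 M0; rewrite subr0.
  rewrite ler_norml lerNl -phiN -[X in _ && (_ <= X)]/(Bnorm r A).
  by rewrite -{1}BnormN !(le_trans (phiq _))// qB.
have phiM m : M m -> phi m = 0.
  have phiM' m' : M m' -> phi m' <= 0.
    by move=> Mm; apply: le_trans (phiq _) _; rewrite -(@Bnorm0 R n k r) -(subrr m') qle.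
  move=> Mm; apply/le_anti; rewrite phiM'//= -oppr_le0 -phiN phiM'//.
  by rewrite -scaleN1r; exact: MZ.
pose w := dual_form phi.
have Dw : DBform r w by exact: DB_dual_form.
have wW p : W p -> w p = 0.
  move=> Wp; apply/ffunP => s; rewrite !ffunE; apply: phiM => x /=.
  by rewrite /ptchain; have [->//|_] := eqVneq x p; rewrite eqxx.
have I0 := H w W Dw oW XW wW; have Iw := integral_cvg Hk (J := J) Dw; rewrite I0 in Iw.
have : e / 2 <= limn (fun i => form_eval w (repr J i)).
  apply: limr_ge; first by apply/cvg_ex; eexists; exact: Iw.
  near=> i; have Ni : (N <= i)%N by near: i; exists N.
  rewrite -dual_formE//; have := phiB (x0 - repr J i); rewrite phiD phiN phix0 ler_norml.
  move=> /andP[_]; have := HN N i (leqnn _) Ni; rewrite -/x0; move: qx0; lra.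
rewrite (cvg_lim _ Iw)// => e2; lra.
Unshelve. all: by end_near.
Qed.
End SupportByForms.

Section OpenSetChain.
Context {R : realType}.
Variables (D : set 'rV[R]_2) (Dt : chain R 2 2 1).
Hypothesis DtE : is_chain_of_open D Dt.

Lemma int2_open h : DB 1 h -> int2 Dt h = leb (cutto D h).
Proof.
move=> Dh; rewrite /int2 DtE; last exact/(DBform_Bform kmass2_coord)/DBform2.
rewrite -integral_cutto; congr (fine _); apply: eq_integral => z _; congr EFin.
by rewrite /pairing sum_kidx2 wedge2E det1 mulr1 ffunE.
Qed.

Variable B : chain R 2 1 2.
Hypothesis BE : is_boundary 2 Dt B.
Hypotheses (oD : open D) (bD : exists M : R, forall p, D p -> `|p| <= M).

Lemma form1_eta (w : Defs.form R 2 1) : w = form1 (fun p => w p (ix1 0)) (fun p => w p (ix1 1)).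
Proof.
apply/funext => p; apply/ffunP => s; rewrite ffunE {1}[s]kidx1E.
by case: (tnth _ _) => [[|[|//]]] ps /=; congr (w p (ix1 _)); exact/val_inj.
Qed.

Lemma boundary_int1 r s m (K : chain R 2 2 s) (J : chain R 2 1 r) g1 g2 :
  is_boundary m K J -> DB m g1 -> DB m g2 ->
  int1 J g1 g2 = int2 K (fun q => 'D_(e_ 0) g2 q - 'D_(e_ 1) g1 q).
Proof.
move=> KJ D1 D2; rewrite /int1 -KJ; last exact/(DBform_Bform kmass1_coord)/DBform1.
by congr Defs.integral; apply/funext => p; rewrite extd_form1.
Qed.

Lemma supp_boundary_open : supp B `<=` closure D `\` D.
Proof.
have cF : closed (closure D `\` D) by apply: closedI; [exact: closed_closure|exact: open_closedC].
suff H : supports (closure D `\` D) B by move=> p; apply.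
apply: supports_forms; [exact: kmass1_coord|exact: kmass_ekvec1|].
move=> w W Dw oW DW w0; rewrite (form1_eta w).
have D0 := Dw (ix1 0); have D1 := Dw (ix1 1).
rewrite -[LHS]/(int1 B _ _) (boundary_int1 BE)// int2_open; last first.
  by apply: DBB; apply: (@DB_derive _ _ 0).
rewrite -integral_cutto; apply: (stokes_open oD oW) => // q Wq; by rewrite w0// ffunE.
Qed.
End OpenSetChain.

(** * Winding numbers and residues *)

Section WindingFormula.
Context {R : realType} {r : nat}.
Variable J : chain R 2 1 r.
Implicit Types (g h psi : 'rV[R]_2 -> R) (p q w z : 'rV[R]_2) (C : set 'rV[R]_2).

(** The integral of (g1 + i g2) dz, split as in [form_dzE], so that only real forms have to be
    handled. *)
Definition int_dz g1 g2 : R[i] := (int1 J g1 (fun p => - g2 p) +i* int1 J g2 g1)%C.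

Lemma int_dz_off_supp g1 g2 h1 h2 C : DB r g1 -> DB r g2 -> DB r h1 -> DB r h2 ->
  compact C -> C `&` supp J = set0 -> (forall q, ~ C q -> g1 q = h1 q /\ g2 q = h2 q) ->
  int_dz g1 g2 = int_dz h1 h2.
Proof.
move=> D1 D2 E1 E2 cC CJ gC.
have H a b c d : DB r a -> DB r b -> DB r c -> DB r d -> (forall q, ~ C q -> a q = c q /\ b q = d q) ->
    int1 J a b = int1 J c d.
  move=> Da Db Dc Dd abcd; apply/eqP; rewrite -subr_eq0 -mulN1r -int1Z// -int1D//; try exact: DBZ.
  apply/eqP/(int1_off_supp _ _ cC CJ).
  - by apply: DBD => //; exact: DBZ.
  - by apply: DBD => //; exact: DBZ.
  - by move=> q /abcd[-> ->]; rewrite !mulN1r !subrr.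
congr (_ +i* _)%C; apply: H => //; try exact: DBN.
  by move=> q /gC[-> ->].
by move=> q /gC[-> ->].
Qed.

Lemma smooth_1B psi : smooth psi -> smooth (fun p => 1 - psi p).
Proof.
move=> Spsi; have H vs : exists c : R, foldr (fun v g => 'D_v g) (fun p => 1 - psi p) vs =
    (fun p => c - foldr (fun v g => 'D_v g) psi vs p).
  elim: vs => [|v vs [c IH]] /=; first by exists 1.
  exists 0; rewrite IH; apply/funext => p.
  have dp : derivable (foldr (fun v g => 'D_v g) psi vs) p v by apply/diff_derivable/Spsi.
  have dc := @is_derive_cst R 'rV[R]_2 R^o c p v.
  have [_ ->] := @is_deriveB R _ R^o _ _ p v _ _ dc (derivableP dp).
  by [].
move=> vs p; have [c ->] := H vs.
by apply: differentiableB; [exact: differentiable_cst|exact: Spsi].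
Qed.

Lemma bounded_ball w (e : R) : compact [set q | enorm (q - w) <= e].
Proof.
apply: bounded_closed_compact.
  exists (`|w| + e); split; first exact: num_real.
  move=> M HM q /= qw; apply: le_trans (ltW HM).
  rewrite -[q in `|q|](subrK w) (le_trans (ler_normD _ _))// addrC lerD2l.
  exact: le_trans (norm_le_enorm _) qw.
rewrite (_ : [set q | _] = (fun q => enorm (q - w)) @^-1` [set t | t <= e])//.
have [e0|e0] := ltP e 0.
  rewrite (_ : _ @^-1` _ = set0); first exact: closed0.
  by apply/seteqP; split=> // q /= H; have := enorm_ge0 (q - w); rewrite leNgt (le_lt_trans H e0).
rewrite (_ : _ @^-1` _ = ~` [set q | e < enorm (q - w)]).
  apply: open_closedC; rewrite openE => q qe; exact: near_far.
by apply/seteqP; split=> q /=; [move=> H; apply/negP; rewrite -leNgt|move/negP; rewrite -leNgt].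
Qed.

Lemma inv_toC (p : 'rV[R]_2) : ((toC p)^-1 = (p 0 0 / sqdist 0 p) +i* (- (p 0 1 / sqdist 0 p)))%C.
Proof.
by rewrite sqdist2E -!expr2.
Qed.

(** The cutoff in [winding] is an unspecified choice; the form it produces differs from the one of
    the smoothed kernel only inside a disc that misses the support. *)
Lemma windingE w (rho : R) : 0 < rho -> (forall p, enorm (p - w) <= rho -> ~ supp J p) ->
  winding J w = ((2 * pi%:C * 'i)^-1 *
    int_dz (fun p => cker rho 0 (p - w)) (fun p => - cker rho 1 (p - w)))%C.
Proof.
move=> rho0 Hrho; rewrite /winding; set psi := xget _ _.
have [psi_s psi_w [e [e0 He psi1]]] : pole_cutoff w (supp J) psi.
  apply: (xgetPex (cst 0)); exists (fun p => 1 - bumpf w rho p); split.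
  - by apply: SM_smooth; apply: SM_sub; [exact: SM_cst|exact: SM_bump].
  - have r2 : 0 < rho / 2 by rewrite divr_gt0.
    apply: filterS (near_enorm w r2) => p pr; rewrite bump1 ?subrr//; exact: ltW.
  - by exists rho; split=> // p rp; rewrite bump0 ?subr0.
(* [psi] does not have bounded support, but [1 - psi] does. *)
have Dpsi N : DB N psi.
  have -> : psi = (fun p => 1 - (1 - psi p)) by apply/funext => p; rewrite subKr.
  apply: DBB; first exact: DB_cst.
  apply: smooth_DB; first exact: smooth_1B.
  apply: (@bsupp_ball _ _ _ w e) => q qe; rewrite psi1 ?subrr//; exact: ltW.
(* Where [psi] is not 0, the factor 1/(p - w) coincides with the kernel smoothed at radius [d]. *)
have [d [d0 dr Hd]] : exists d : R, [/\ 0 < d, d <= rho & forall q, enorm (q - w) <= d -> psi q = 0].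
  move: psi_w => /nbhs_ballP[d /= d0 Hd]; exists (Num.min (d / 2) rho).
  rewrite lt_min divr_gt0// rho0 ge_min lexx orbT; split=> //.
  move=> q; rewrite le_min => /andP[qd _]; apply: Hd; rewrite -ball_normE /= distrC (le_lt_trans (norm_le_enorm _))//.
  by apply: le_lt_trans qd _; lra.
congr (_ * _)%C.
have -> : (fun p => (psi p)%:C%C / (toC p - toC w)) =
    (fun p => (psi p * cker d 0 (p - w)) +i* (psi p * - cker d 1 (p - w)))%C.
  apply/funext => p; have -> : toC p - toC w = toC (p - w) by rewrite /toC !mxE.
  rewrite inv_toC; have [pd|pd] := leP (enorm (p - w)) d.
    by rewrite Hd// !mul0r.
  rewrite !ckerE ?(ltW pd)//; apply/eqP; rewrite eq_complex /=; apply/andP; split; apply/eqP; ring.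
rewrite form_dzE -/(int_dz _ _).
have Dk N (t : R) j : 0 < t -> DB N (fun p => cker t j (p - w)) by move=> t0; exact: DB_ker.
apply: (int_dz_off_supp _ _ _ _ (@bounded_ball w (Num.max e rho))).
- by apply: DBM => //; exact: Dk.
- by apply: DBM => //; apply: DBN; exact: Dk.
- exact: Dk.
- by apply: DBN; exact: Dk.
- apply/seteqP; split=> // q [/= qM Jq]; move: qM; rewrite le_max => /orP[/He|/Hrho]; exact.
- move=> q /= /negP; rewrite -ltNge gt_max => /andP[eq rq].
  by rewrite psi1 ?(ltW eq)// !mul1r !ckerE ?(ltW rq)// (le_trans dr)// ltW.
Qed.
End WindingFormula.

(** * Integrals of locally defined holomorphic forms *)

Section CutoffIntegral.
Context {R : realType}.
Implicit Types (chi : 'rV[R]_2 -> R) (S V O C : set 'rV[R]_2) (f : R[i] -> R[i]).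

Definition cutre chi f p : R := chi p * complex.Re (f (toC p)).
Definition cutim chi f p : R := chi p * complex.Im (f (toC p)).

(** Each point of V has a disc on which f agrees with a function having bounds of all orders;
    compactness of the support of chi reduces to finitely many discs. *)
Lemma DB_cutoff V S chi f N : open V -> holomorphic_on V f -> cutoff V S chi ->
  DB N (cutre chi f) /\ DB N (cutim chi f).
Proof.
move=> oV hf [chi_s chi_c chi_V _]; have Dchi : DB N chi by apply: smooth_DB => //; exact: compact_bsupp.
have out g q : ~ closure [set p | chi p != 0] q -> chi q * g q = 0.
  move=> nq; suff -> : chi q = 0 by rewrite mul0r.
  by apply/eqP/negPn/negP => cq; apply: nq; exact: subset_closure.
have loc (g : 'rV[R]_2 -> R) : (forall p, V p -> exists r U, [/\ 0 < r, DB N U &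
    forall q, enorm (q - p) <= r -> g q = U q]) -> DB N (fun q => chi q * g q).
  move=> Hg; apply: (@localize _ _ _ (DB N) _ chi_c (@DB_cst R 2 N 0)).
  - by move=> *; exact: DBD.
  - by move=> q; exact: out.
  - move=> p /chi_V /Hg[r [U [r0 DU gU]]]; exists r => // eta Seta.
    have -> : (fun q => eta q * bumpf p r q * (chi q * g q)) =
        (fun q => eta q * bumpf p r q * (chi q * U q)).
      apply/funext => q; have [qr|qr] := leP (enorm (q - p)) r; first by rewrite gU.
      by rewrite bump0 ?(ltW qr)// mulr0 !mul0r.
    by apply: DBM; [exact: DB_SM_bump|exact: DBM].
split; apply: loc => p Vp; have [r [U [W [r0 DU DW fUW]]]] := holomorphic_local oV hf Vp.
  by exists r, U; split=> // q /fUW ->.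
by exists r, W; split=> // q /fUW ->.
Qed.

Lemma integral_dzE r (J : chain R 2 1 r) V chi f : open V -> holomorphic_on V f ->
  compact (supp J) -> supp J `<=` V -> cutoff V (supp J) chi ->
  integral_dz J V f = int_dz J (cutre chi f) (cutim chi f).
Proof.
move=> oV hf cJ JV Hchi; rewrite /integral_dz; set chi' := xget _ _.
(* A cutoff exists, so [xget] returns one and not its default. *)
have Hchi' : cutoff V (supp J) chi'.
  have [c [Sc cc cV cO]] := SM_cutoff cJ oV JV.
  by apply: (xgetPex (cst 0)); exists c; split=> //; exact: SM_smooth.
have -> : (fun p => (chi' p)%:C%C * f (toC p)) = (fun p => cutre chi' f p +i* cutim chi' f p)%C.
  apply/funext => p; rewrite /cutre /cutim; case: (f (toC p)) => a b.
  by apply/eqP; rewrite eq_complex /= !mul0r subr0 addr0 !eqxx.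
rewrite form_dzE -/(int_dz _ _ _).
have [D1 D2] := DB_cutoff r oV hf Hchi; have [D1' D2'] := DB_cutoff r oV hf Hchi'.
have [sc cc1 cV [W1 [oW1 JW1 chi1]]] := Hchi; have [sc2 cc2 cV2 [W2 [oW2 JW2 chi2]]] := Hchi'.
(* The two cutoffs can differ only on this compact set, which misses the support. *)
pose C := (closure [set p | chi p != 0] `|` closure [set p | chi' p != 0]) `&` ~` (W1 `&` W2).
apply: (int_dz_off_supp D1' D2' D1 D2 (C := C)).
- apply: (@subclosed_compact _ _ (closure [set p | chi p != 0] `|` closure [set p | chi' p != 0])).
  + apply: closedI; first by apply: closedU; exact: closed_closure.
    by apply: open_closedC; exact: openI.
  + exact: compactU.
  + by move=> q [].
- apply/seteqP; split=> // q [[_ nq] Jq]; apply: nq; split; [exact: JW1|exact: JW2].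
- move=> q nC; have [[q1 q2]|nO] := pselect ((W1 `&` W2) q).
    by rewrite /cutre /cutim chi1// chi2.
  have H : ~ (closure [set p | chi p != 0] `|` closure [set p | chi' p != 0]) q.
    by move=> H; apply: nC.
  have z (c : 'rV[R]_2 -> R) : ~ closure [set p | c p != 0] q -> c q = 0.
    by move=> nq; apply/eqP/negPn/negP => cq; apply: nq; exact: subset_closure.
  rewrite /cutre /cutim !z ?mul0r// => Hq; apply: H; [by left|by right].
Qed.
End CutoffIntegral.

Section WindingProportional.
Context {R : realType} {r s m : nat}.
Variables (J : chain R 2 1 r) (K : chain R 2 2 s).
Hypothesis KJ : is_boundary m K J.
Implicit Types (g h : 'rV[R]_2 -> R) (p q w : 'rV[R]_2) (L : R) (C : set 'rV[R]_2).

Lemma sqfun_far p L h q : sqfun p L h -> 2 * L < enorm (q - p) -> h q = 0.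
Proof.
move=> [_ h0] qL; have [q0|q0] := leP L `|q 0 0 - p 0 0|; first exact: h0 q0.
have [q1|q1] := leP L `|q 0 1 - p 0 1|; first exact: h0 q1.
by exfalso; have := enorm_le_sum (q - p); rewrite !mxE; lra.
Qed.

Lemma sqfun_near p L h : (forall N, DB N h) -> (forall q, L <= enorm (q - p) -> h q = 0) -> sqfun p L h.
Proof.
move=> Dh h0; split=> // q j qj; apply: h0; apply: le_trans qj _.
by have := coord_le_enorm (q - p) j; rewrite !mxE.
Qed.

Lemma sqfun_bsupp p L h : sqfun p L h -> bsupp h.
Proof. by move=> Hh; apply: (@bsupp_ball _ _ h p (2 * L)) => q; exact: sqfun_far. Qed.

Lemma sqfun_continuous p L h : sqfun p L h -> continuous h.
Proof. by move=> [Dh _]; exact: DB_continuous (Dh 1%N). Qed.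

(** Radius 2L, because the square of half side L lies in that disc. *)
Definition off_supp p L := forall q, enorm (q - p) <= 2 * L -> ~ supp J q.

Lemma int1_sqfun p L g h : off_supp p L -> sqfun p L g -> sqfun p L h -> int1 J g h = 0.
Proof.
move=> Hp Hg Hh; have [Dg _] := Hg; have [Dh _] := Hh.
apply: (int1_off_supp _ _ (@bounded_ball _ p (2 * L))) => //.
  by apply/seteqP; split=> // q [/Hp].
move=> q /= /negP; rewrite -ltNge => qL.
by rewrite (sqfun_far Hg qL) (sqfun_far Hh qL).
Qed.

Lemma sqfun0 p L : sqfun p L (fun=> 0).
Proof. by split=> // N; exact: DB_cst. Qed.

(** The partial derivatives of g are, up to sign, the densities of d(g dy) and d(g dx), and J
    annihilates both forms. *)
Lemma int2_derive p L j g : off_supp p L -> sqfun p L g -> int2 K ('D_(e_ j) g) = 0.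
Proof.
move=> Hp Hg; have [Dg _] := Hg; have Dd N i : DB N ('D_(e_ i) g).
  by apply: (@DB_le _ _ N N.+1) => //; exact: DB_derive.
have H0 := sqfun0 p L.
have d0 i q : 'D_(e_ i) (fun _ : 'rV[R]_2 => 0 : R) q = 0.
  by have [_ ->] := @is_derive_cst R 'rV[R]_2 R^o 0 q (e_ i).
have [->|j0] := eqVneq j 0.
  have := boundary_int1 KJ (DB_cst m 0) (Dg m); rewrite (int1_sqfun Hp H0 Hg) => E.
  rewrite [RHS]E; congr (int2 K); apply/funext => q; by rewrite d0 subr0.
have -> : j = 1 by apply/val_inj; case: j j0 => [[|[|]]].
have := boundary_int1 KJ (Dg m) (DB_cst m 0); rewrite (int1_sqfun Hp Hg H0).
have -> : (fun q => 'D_(e_ 0) (fun _ : 'rV[R]_2 => 0 : R) q - 'D_(e_ 1) g q) = (fun q => -1 * 'D_(e_ 1) g q).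
  by apply/funext => q; rewrite d0 sub0r mulN1r.
by rewrite int2Z// mulN1r => /esym/eqP; rewrite oppr_eq0 => /eqP.
Qed.

Lemma int2_leb p L g h : 0 < L -> off_supp p L -> sqfun p L g -> sqfun p L h ->
  int2 K g * leb h = int2 K h * leb g.
Proof.
move=> L0 Hp Hg Hh; apply: (functionals_proportional L0 (c := p) (T := int2 K) (T' := leb)) => //.
- by move=> a b [Da _] [Db _]; exact: int2D.
- by move=> a b [Db _]; exact: int2Z.
- by move=> j a Ha; exact: int2_derive Hp Ha.
- move=> a b Ha Hb; apply: lebD; [exact: sqfun_continuous Ha|exact: sqfun_bsupp Ha|
    exact: sqfun_continuous Hb|exact: sqfun_bsupp Hb].
- move=> a b Hb; apply: lebZ; [exact: sqfun_continuous Hb|exact: sqfun_bsupp Hb].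
- move=> j a Ha; have [Da _] := Ha; apply: leb_derive.
  + by move=> q; exact: (@DB_derivable _ _ 0 _ _ _ (Da 2)).
  + exact: DB_continuous (DB_derive (e_ j) (Da 2)).
  + exact: sqfun_bsupp Ha.
Qed.

Lemma sqfun_divker L p : 0 < L -> sqfun p L (divker (L / 2) p).
Proof.
move=> L0; have L2 : 0 < L / 2 by rewrite divr_gt0.
apply: sqfun_near => [N|q qL]; first by apply: DBD; exact: DB_dker.
by apply: divker0 => //; lra.
Qed.

Lemma sqfun_rotker L p : 0 < L -> sqfun p L (rotker (L / 2) p).
Proof.
move=> L0; have L2 : 0 < L / 2 by rewrite divr_gt0.
apply: sqfun_near => [N|q qL]; first by apply: DBB; exact: DB_dker.
by apply: rotker0 => //; lra.
Qed.

Lemma winding_int2 p (rho : R) : 0 < rho -> (forall q, enorm (q - p) <= rho -> ~ supp J q) ->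
  winding J p = ((2 * pi%:C * 'i)^-1 * (int2 K (rotker rho p) +i* int2 K (divker rho p)))%C.
Proof.
move=> r0 Hr; rewrite (windingE r0 Hr); congr (_ * (_ +i* _))%C.
  rewrite (boundary_int1 KJ); last 2 first.
  - exact: DB_ker.
  - by apply: DBN; apply: DBN; exact: DB_ker.
  have -> : (fun q => - - cker rho 1 (q - p)) = (fun q => cker rho 1 (q - p)).
    by apply/funext => q; rewrite opprK.
  by [].
rewrite (boundary_int1 KJ); last 2 first.
- by apply: DBN; exact: DB_ker.
- exact: DB_ker.
congr (int2 K); apply/funext => q; rewrite /divker /dker; congr (_ + _).
have D : derivable (fun x => cker rho 1 (x - p)) q (e_ 1).
  by apply: (@DB_derivable _ _ 0); exact: DB_ker.
have [_ ->] := @is_deriveN R _ R^o _ q (e_ 1) _ (derivableP D).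
by rewrite opprK.
Qed.

(** The factor is fixed by testing on [divker], of Lebesgue integral 2 pi. [rotker] has Lebesgue
    integral 0, so K annihilates it, and this makes the winding number real. *)
Lemma windingC p L : 0 < L -> off_supp p L -> exists2 n : R, winding J p = n%:C%C &
  forall h, sqfun p L h -> int2 K h = n * leb h.
Proof.
move=> L0 Hp; have L2 : 0 < L / 2 by rewrite divr_gt0.
have Sd := sqfun_divker p L0; have Sr := sqfun_rotker p L0.
have pi2 : 2 * pi != 0 :> R by rewrite mulf_neq0// gt_eqF// pi_gt0.
exists (int2 K (divker (L / 2) p) / (2 * pi)) => [|h Hh]; last first.
  have := int2_leb L0 Hp Hh Sd; rewrite leb_divker// => E.
  by apply: (mulIf pi2); rewrite E mulrAC divfK.
have Krot : int2 K (rotker (L / 2) p) = 0.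
  have := int2_leb L0 Hp Sr Sd; rewrite leb_divker// leb_rotker// mulr0 => /eqP.
  by rewrite mulf_eq0 (negbTE pi2) orbF => /eqP.
rewrite (winding_int2 L2); last by move=> q qL; apply: Hp; lra.
have E : (2 * pi%:C * 'i)%C = (0 +i* (2 * pi))%C :> R[i].
  by apply/eqP; rewrite eq_complex /=; apply/andP; split; apply/eqP; ring.
have nz : (0 +i* (2 * pi))%C != 0 :> R[i] by rewrite eq_complex /= negb_and pi2 orbT.
rewrite E Krot; apply: (mulfI nz); rewrite mulrA mulfV// mul1r.
apply/eqP; rewrite eq_complex /=; apply/andP; split; apply/eqP; first by ring.
by rewrite mulr0 add0r mulrCA mulfV ?mulr1.
Qed.

Lemma off_supp_ex p : ~ supp J p -> exists2 L, 0 < L & off_supp p L.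
Proof.
move=> nJ; have [e e0 He] := open_ball_enorm (closed_openC (@closed_supp _ _ J)) nJ.
by exists (e / 2); [rewrite divr_gt0|move=> q qe; apply: He; lra].
Qed.

(** One test function, the smoothed divergence centred at q at a small scale, fits in the squares of
    both points and has nonzero Lebesgue integral; it forces the two factors to agree. *)
Lemma winding_near p L q : 0 < L -> off_supp p L -> enorm (q - p) < L / 2 -> winding J q = winding J p.
Proof.
move=> L0 Hp qp; have L4 : 0 < L / 4 by rewrite divr_gt0.
have Hq : off_supp q (L / 4).
  move=> x xq; apply: Hp; apply: le_trans (enorm_le_sum _) _; rewrite !mxE.
  have H j : `|x 0 j - p 0 j| <= L.
    apply: le_trans (ler_distD (q 0 j) _ _) _.
    have := coord_le_enorm (q - p) j; have := coord_le_enorm (x - q) j; rewrite !mxE; lra.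
  by have := H 0; have := H 1; lra.
have [n -> Hn] := windingC L0 Hp; have [n' -> Hn'] := windingC L4 Hq.
have S' := sqfun_divker q L4.
have S : sqfun p L (divker (L / 4 / 2) q).
  have [D S0] := S'; split=> // x j xj; apply: (S0 x j).
  have := coord_le_enorm (q - p) j; rewrite !mxE; have := ler_distD (q 0 j) (x 0 j) (p 0 j); lra.
have := Hn _ S; rewrite (Hn' _ S') => /mulIf -> //.
by rewrite leb_divker ?divr_gt0// mulf_neq0// gt_eqF// pi_gt0.
Qed.

Definition wound : set 'rV[R]_2 := [set p | supp J p \/ winding J p <> 0].

Lemma closed_wound : closed wound.
Proof.
rewrite -[wound]setCK; apply: open_closedC; rewrite openE => p /not_orP[nJ /contrapT w0].
have [L L0 Hp] := off_supp_ex nJ; have L2 : 0 < L / 2 by rewrite divr_gt0.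
apply: filterS (near_enorm p L2) => q qp [Jq|]; last first.
  by rewrite (winding_near L0 Hp qp) w0.
by apply: Hp Jq; lra.
Qed.

(** Around each point of [C] the factor given by [windingC] is 0. *)
Lemma int2_off_wound h C : (forall N, DB N h) -> compact C -> C `&` wound = set0 ->
  (forall q, ~ C q -> h q = 0) -> int2 K h = 0.
Proof.
move=> Dh cC CW h0.
have [] // : (forall N, DB N h) /\ int2 K h = 0.
apply: (@localize _ _ C (fun g => (forall N, DB N g) /\ int2 K g = 0)) => //.
- split=> [N|]; first exact: DB_cst.
  by have := int2Z K 0 (DB_cst s 0); rewrite mul0r mul0r.
- move=> f g [Df f0] [Dg g0]; split=> [N|]; first exact: DBD.
  by rewrite int2D// f0 g0 addr0.
- move=> p Cp; have /not_orP[nJ /contrapT w0] : ~ wound p.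
    by move=> Wp; have : (C `&` wound) p by []; rewrite CW.
  have [L L0 Hp] := off_supp_ex nJ; exists L => // eta Seta.
  have Sq : sqfun p L (fun q => eta q * bumpf p L q * h q).
    apply: sqfun_near => [N|q qL]; first by apply: DBM => //; exact: DB_SM_bump.
    by rewrite bump0// mulr0 mul0r.
  split; first by have [] := Sq.
  have [n En Hn] := windingC L0 Hp; rewrite Hn//.
  by move: En; rewrite w0 => -[<-]; rewrite mul0r.
Qed.
End WindingProportional.

Lemma complex_scaleD (R : realType) (n u v x y : R) :
  ((n * u + x) +i* (n * v + y))%C = (n%:C * (u +i* v) + (x +i* y))%C.
Proof. by apply/eqP; rewrite eq_complex /= !mul0r subr0 addr0 !eqxx. Qed.

(** * Localization of the integral over K at the poles *)

Section Residues.
Context {R : realType}.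
Implicit Types (g h : 'rV[R]_2 -> R) (p q : 'rV[R]_2).

Lemma int2_sum s (K : chain R 2 2 s) (I : finType) (F : I -> 'rV[R]_2 -> R) :
  (forall i, DB s (F i)) -> int2 K (fun q => \sum_i F i q) = \sum_i int2 K (F i).
Proof.
move=> DF; elim: (index_enum I) => [|i t IH].
  rewrite big_nil; have := int2Z K 0 (DB_cst s 0); rewrite mul0r mul0r => E.
  by rewrite -[RHS]E; congr (int2 K); apply/funext => q; rewrite big_nil.
rewrite big_cons -IH -int2D//; last exact: DB_sum.
by congr (int2 K); apply/funext => q; rewrite big_cons.
Qed.

(* Where h does not vanish, either K is locally zero or K is locally a multiple of the
   Lebesgue integral, the factor being the winding number of a pole. *)
Lemma int2_residues r s n m (J : chain R 2 1 r) (K : chain R 2 2 s) (a : 'I_n -> 'rV[R]_2)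
    (d : 'I_n -> R) (O C : set 'rV[R]_2) h : is_boundary m K J ->
  (forall k, 0 < d k) -> (forall k, off_supp J (a k) (d k / 2)) ->
  (forall k l q, k != l -> enorm (q - a k) <= d k -> enorm (q - a l) <= d l -> False) ->
  open O -> wound J `<=` O -> compact C -> (forall N, DB N h) -> (forall q, ~ C q -> h q = 0) ->
  (forall q, O q -> h q = 0 \/ exists k, enorm (q - a k) <= d k / 4) ->
  int2 K h = \sum_k complex.Re (winding J (a k)) * leb (fun q => bumpf (a k) (d k / 2) q * h q).
Proof.
move=> KJ d0 offd disj oO PO cC Dh hC hO.
have d2 k : 0 < d k / 2 by rewrite divr_gt0.
pose gam k := bumpf (a k) (d k / 2).
have Dgam N k : DB N (fun q => gam k q * h q).
  have := @DB_SM_bump R 2 N (fun=> 1) (a k) (d k / 2) (SM_cst 1) (d2 k).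
  have -> : (fun q => 1 * bumpf (a k) (d k / 2) q) = gam k by apply/funext => q; rewrite mul1r.
  by move=> Dg; exact: DBM.
have gam1 k q : enorm (q - a k) <= d k / 4 -> \sum_l gam l q = 1.
  move=> qk; rewrite (bigD1 k)//= /gam bump1 ?d2//; last by lra.
  rewrite big1 ?addr0// => l lk; apply: bump0; first exact: d2.
  rewrite leNgt; apply/negP => ql; apply: (disj l k q lk).
    by have := d0 l; lra.
  by have := d0 k; lra.
(* On [O] the bumps sum to 1 wherever h is not 0, so [rest] lives in [C] minus [O], away from
   [wound J]. *)
pose rest q := h q + -1 * \sum_k gam k q * h q.
have Drest N : DB N rest by apply: DBD => //; apply: DBZ; apply: DB_sum => k; exact: Dgam.
have rest0 : int2 K rest = 0.
  apply: (int2_off_wound KJ (C := C `&` ~` O)) => //.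
  - apply: (subclosed_compact _ cC) => [|q []//].
    apply: closedI; last exact: open_closedC.
    by apply: compact_closed => //; exact: norm_hausdorff.
  - by apply/seteqP; split=> // q [[_ nO] /PO].
  - move=> q nC; rewrite /rest -mulr_suml.
    have [->|/eqP hq] := pselect (h q = 0); first by rewrite !mulr0 addr0.
    have Cq : C q by apply: contrapT => /hC /eqP; rewrite (negbTE hq).
    have Oq : O q by apply: contrapT => nO; apply: nC.
    have [/eqP|[k qk]] := hO q Oq; first by rewrite (negbTE hq).
    by rewrite (gam1 k)// mul1r mulN1r subrr.
have E : int2 K rest = int2 K h - \sum_k int2 K (fun q => gam k q * h q).
  by rewrite int2D// ?int2Z ?int2_sum ?mulN1r//; [exact: DB_sum|apply: DBZ; exact: DB_sum].
move: E; rewrite rest0 => /esym/eqP; rewrite subr_eq0 => /eqP ->; apply: eq_bigr => k _.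
have [nk -> Hk] := windingC KJ (d2 k) (offd k); rewrite Hk//.
apply: sqfun_near => // q qd; by rewrite /gam bump0// mul0r.
Qed.

Lemma derive_near0 g p v : (\forall q \near p, g q = 0) -> 'D_v g p = 0.
Proof.
move=> g0; have dc := @is_derive_cst R 'rV[R]_2 R^o 0 p v.
have [|_ ->] := @near_eq_is_derive R _ R^o (fun=> 0) g p v 0 _ dc; last by [].
by apply: filterS g0 => q ->.
Qed.

Lemma int_dz_boundary r s m (J : chain R 2 1 r) (K : chain R 2 2 s) g1 g2 : is_boundary m K J ->
  DB m g1 -> DB m g2 ->
  int_dz J g1 g2 = (int2 K (fun q => 'D_(e_ 0) (fun p => - g2 p) q - 'D_(e_ 1) g1 q)
    +i* int2 K (fun q => 'D_(e_ 0) g1 q - 'D_(e_ 1) g2 q))%C.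
Proof.
move=> KJ D1 D2; rewrite /int_dz (boundary_int1 KJ)//; last exact: DBN.
by rewrite (boundary_int1 KJ).
Qed.
End Residues.

(** * The residue formula for chains *)

Theorem theorem3p7p1 (R : realType) (r : nat) (r_ge1 : (1 <= r)%N)
  (J : chain R 2 1 r) (J_closed : closed_chain J)
  (U : set 'rV[R]_2) (U_open : open U) (U_bounded : bounded_set U)
  (suppJ_U : supp J `<=` U)
  (Ind0 : forall w, ~ U w -> winding J w = 0)
  (K : chain R 2 2 r.-1) (K_mass : (chain_mass K < +oo)%E)
  (bdK : is_boundary r.+1 K J)
  (m : nat) (a : 'I_m -> 'rV[R]_2) (a_in : forall k, (U `\` supp J) (a k))
  (f : R[i] -> R[i]) (f_holo : holomorphic_on (U `\` range a) f)
  (D : 'I_m -> set 'rV[R]_2)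
  (D_nbhd : forall k, open (D k) /\ D k (a k))
  (D_disj : forall k l, k != l -> closure (D k) `&` closure (D l) = set0)
  (D_sub : forall k, closure (D k) `<=` U `\` supp J)
  (Dt : 'I_m -> chain R 2 2 1)
  (DtE : forall k, is_chain_of_open (D k) (Dt k))
  (B : 'I_m -> chain R 2 1 2)
  (BE : forall k, is_boundary 2 (Dt k) (B k)) :
  integral_dz J (U `\` range a) f =
  \sum_(k < m) winding J (a k) * integral_dz (B k) (U `\` range a) f.
Proof.
set V := U `\` range a in f_holo *.
have [M UM] : exists M : R, forall p, U p -> `|p| <= M.
  have [M [_ HM]] := U_bounded; exists (M + 1) => p Up; apply: (HM (M + 1)) => //.
  by rewrite ltrDl.
have bounded_compact (S : set 'rV[R]_2) : closed S -> S `<=` U -> compact S.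
  move=> cS SU; apply: bounded_closed_compact => //.
  by exists M; split; [exact: num_real|move=> N MN p /SU /UM /le_trans; apply; exact: ltW].
have cJ : compact (supp J) by apply: bounded_compact => //; exact: closed_supp.
have PU : wound J `<=` U.
  by move=> p [/suppJ_U//|wp]; apply: contrapT => /Ind0.
have /choice[d Hd] : forall k, exists d : R, 0 < d /\ forall q, enorm (q - a k) <= d -> D k q.
  by move=> k; have [oD Da] := D_nbhd k; have [d d0 Hd] := open_ball_enorm oD Da; exists d.
have d0 k : 0 < d k by have [] := Hd k.
have dD k q : enorm (q - a k) <= d k -> D k q by have [_] := Hd k; apply.
have DU k q : D k q -> U q /\ ~ supp J q.
  by move=> Dq; have [] := D_sub k q (subset_closure Dq).
have DD k l q : closure (D k) q -> D l q -> k = l.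
  move=> Dk Dl; apply/eqP; apply: contraT => /D_disj E.
  have : (closure (D k) `&` closure (D l)) q by split=> //; exact: subset_closure.
  by rewrite E.
have DD' k l q : D k q -> D l q -> k = l by move=> Dk; apply: DD; exact: subset_closure.
have d4 k : 0 < d k / 4 by rewrite divr_gt0.
have d4D k q : enorm (q - a k) <= d k / 4 -> D k q.
  by move=> H; apply: dD; have := d0 k; lra.
have finI : finite_set [set: 'I_m] by exact: finite_finset.
(* The closures of the [D k] are included so that [chi0] is 1 near their frontiers, where the chains
   [B k] are supported. *)
pose S := wound J `|` \bigcup_k closure (D k).
have cS : compact S.
  apply: bounded_compact; last by move=> p [/PU//|[k _ /D_sub[]]].
  apply: closedU; first exact: (closed_wound bdK).
  by apply: (closed_bigcup finI) => k _; exact: closed_closure.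
have SU : S `<=` U by move=> p [/PU//|[k _ /D_sub[]]].
have [chi0 [chi0_SM chi0_c chi0_U [ O [oO SO chi01]]]] := SM_cutoff cS U_open SU.
have DO k q : D k q -> O q.
  by move=> Dq; apply: SO; right; exists k => //; exact: subset_closure.
pose bet k := bumpf (a k) (d k / 4).
(* The bumps live in the [D k], where [chi0] is 1: subtracting them makes [chi] vanish near the
   poles without enlarging the support of [chi0]. *)
pose chi q := chi0 q - \sum_k bet k q.
have chi_SM : SM chi.
  by apply: SM_sub => //; apply: SM_sum => k; exact: SM_bump.
have bet0 k q : ~ D k q -> bet k q = 0.
  move=> nD; rewrite /bet bump0// leNgt; apply/negP => H; apply/nD/d4D; exact: ltW.
pose O' := O `&` ~` \bigcup_k [set q | enorm (q - a k) <= d k / 4].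
have oO' : open O'.
  apply: openI => //; apply: closed_openC; apply: (closed_bigcup finI) => k _.
  by apply: compact_closed; [exact: norm_hausdorff|exact: bounded_ball].
have chi1 q : O' q -> chi q = 1.
  move=> [Oq nq]; rewrite /chi chi01// big1 ?subr0// => k _; rewrite /bet bump0//.
  by rewrite leNgt; apply/negP => H; apply: nq; exists k => //; exact: ltW.
have chi_a k : \forall q \near a k, chi q = 0.
  have d8 : 0 < d k / 4 / 2 by rewrite divr_gt0.
  apply: filterS (near_enorm (a k) d8) => q qd.
  have Dq : D k q by apply: d4D; have := d4 k; lra.
  rewrite /chi chi01; last exact: DO Dq.
  rewrite (bigD1 k)//= /bet bump1//; last exact: ltW.
  rewrite big1 ?addr0 ?subrr// => l lk; apply: bet0 => Dl.
  by move: lk; rewrite (DD' _ _ _ Dl Dq) eqxx.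
pose Cx := closure [set p | chi p != 0].
have chi_sub : [set p | chi p != 0] `<=` [set p | chi0 p != 0].
  move=> q /=; apply: contraNN => /eqP q0; rewrite /chi q0 big1 ?subrr// => k _.
  by apply: bet0 => /DO /chi01 /eqP; rewrite q0 eq_sym oner_eq0.
have Cx_c : compact Cx.
  apply: (subclosed_compact _ chi0_c); first exact: closed_closure.
  exact: closure_sub (@closed_closure _ _) (subset_trans chi_sub (@subset_closure _ _)).
have CxV : Cx `<=` V.
  move=> q Cq; split.
    by apply: chi0_U; apply: closure_sub Cq; [exact: closed_closure|exact: subset_trans chi_sub (@subset_closure _ _)].
  move=> [k _ akq]; subst q; have [x [/= /eqP x0 /x0]] := Cq _ (chi_a k).
  by [].
have chi_cut T : T `<=` O' -> cutoff V T chi.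
  by move=> TO; split=> //; [exact: SM_smooth|exists O'].
have oV : open V.
  have H : accessible_space 'rV[R]_2 by exact/hausdorff_accessible/norm_hausdorff.
  apply: openI => //; apply: closed_openC.
  by move: H => /accessible_finite_set_closed; apply; exact: finite_image.
have JO' : supp J `<=` O'.
  move=> q Jq; split; first by apply: SO; left; left.
  by move=> [k _ /d4D /DU[]].
have BS k : supp (B k) `<=` closure (D k) `\` D k.
  apply: (supp_boundary_open (DtE k) (BE k)); first by have [] := D_nbhd k.
  by exists M => p /DU[/UM].
have BO' k : supp (B k) `<=` O'.
  move=> q /BS[Cq nD]; split; first by apply: SO; right; exists k.
  by move=> [l _ /d4D Dl]; have E := DD _ _ _ Cq Dl; subst l.
have cB k : compact (supp (B k)).
  apply: bounded_compact; first exact: closed_supp.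
  by move=> q /BS[/D_sub[]].
have O'V : O' `<=` V.
  by move=> q Oq; apply: CxV; apply: subset_closure; rewrite /= chi1// oner_eq0.
pose g1 := cutre chi f; pose g2 := cutim chi f.
have [Dg1 Dg2] : (forall N, DB N g1) /\ (forall N, DB N g2).
  have H N := DB_cutoff N oV f_holo (chi_cut _ JO').
  by split=> N; have [] := H N.
rewrite (integral_dzE oV f_holo cJ (subset_trans JO' O'V) (chi_cut _ JO')).
have BI k : integral_dz (B k) V f = int_dz (B k) g1 g2.
  exact: (integral_dzE oV f_holo (cB k) (subset_trans (@BO' k) O'V) (chi_cut _ (@BO' k))).
rewrite (eq_bigr _ (fun k _ => congr1 (fun x => winding J (a k) * x) (BI k))).
(* [h1] and [h2] are the real and imaginary parts of the density of d(chi f dz). *)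
pose h1 q := 'D_(e_ 0) (fun p => - g2 p) q - 'D_(e_ 1) g1 q.
pose h2 q := 'D_(e_ 0) g1 q - 'D_(e_ 1) g2 q.
have Dd N v g : (forall N, DB N g) -> DB N ('D_v g).
  by move=> Dg; apply: (@DB_le _ _ N N.+1) => //; exact: DB_derive.
have Dh1 N : DB N h1 by apply: DBB; apply: Dd => // N'; apply: DBN.
have Dh2 N : DB N h2 by apply: DBB; exact: Dd.
have h1C q : ~ Cx q -> h1 q = 0 /\ h2 q = 0.
  move=> nC; have near0 : \forall x \near q, chi x = 0.
    have : nbhs q (~` Cx) by apply: open_nbhs_nbhs; split=> //; apply: closed_openC; exact: closed_closure.
    apply: filterS => x nx; apply/eqP/negPn/negP => cx; apply: nx; exact: subset_closure.
  rewrite /h1 /h2 !derive_near0 ?subrr//; apply: filterS near0 => x x0;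
    by rewrite /g1 /g2 /cutre /cutim x0 mul0r ?oppr0.
(* On [O'] the product chi f is f, and the Cauchy-Riemann equations apply. *)
have h1O q : O' q -> h1 q = 0 /\ h2 q = 0.
  move=> Oq; have [|E1 E2] := @holomorphic_CR R V f g1 g2 q f_holo (O'V _ Oq).
    have : nbhs q O' by apply: open_nbhs_nbhs.
    by apply: filterS => x Ox; rewrite /g1 /g2 /cutre /cutim chi1// !mul1r.
  have D2 : derivable g2 q (e_ 0) by apply: (@DB_derivable _ _ 0).
  have [_ E3] := @is_deriveN R _ R^o _ q (e_ 0) _ (derivableP D2).
  by rewrite /h1 /h2 E3 E2 E1 opprK !subrr.
have hO q : O q -> (h1 q = 0 /\ h2 q = 0) \/ exists k, enorm (q - a k) <= d k / 4.
  move=> Oq; have [[k _ qk]|nq] := pselect ((\bigcup_k [set q | enorm (q - a k) <= d k / 4]) q).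
    by right; exists k.
  by left; exact: h1O.
(* [off_supp] doubles its argument, so this concerns the disc of radius [d k]. *)
have offd k : off_supp J (a k) (d k / 2).
  by move=> q qd; have [|] := @DU k q _ => //; apply: dD; lra.
have disj k l q : k != l -> enorm (q - a k) <= d k -> enorm (q - a l) <= d l -> False.
  by move=> /eqP kl /dD Dk /dD Dl; apply: kl; exact: DD' Dk Dl.
have PO : wound J `<=` O by move=> q Pq; apply: SO; left.
(* Inside [D k], h lives in the small disc, where the bump of [int2_residues] equals 1; outside
   [D k] that bump is 0. The weighted integral over the plane is thus the integral over [D k]. *)
have res h : (forall N, DB N h) -> (forall q, ~ Cx q -> h q = 0) ->
    (forall q, O q -> h q = 0 \/ exists k, enorm (q - a k) <= d k / 4) ->
    int2 K h = \sum_k complex.Re (winding J (a k)) * int2 (Dt k) h.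
  move=> Dh hC hh; rewrite (int2_residues bdK d0 offd disj oO PO Cx_c Dh hC hh).
  apply: eq_bigr => k _; rewrite (int2_open (DtE k))//; congr (_ * leb _).
  apply/funext => q; have [Dq|nD] := pselect (D k q).
    rewrite cutto_in//; have [->|[l ql]] := hh q (DO _ _ Dq); first by rewrite mulr0.
    have E := DD' _ _ _ Dq (d4D _ _ ql); subst l.
    by rewrite bump1 ?mul1r ?divr_gt0//; lra.
  rewrite cutto_out// bump0 ?mul0r ?divr_gt0// leNgt; apply/negP => qd; apply: nD; apply: dD.
  by have := d0 k; lra.
rewrite (int_dz_boundary bdK)//.
have BD k : int_dz (B k) g1 g2 = (int2 (Dt k) h1 +i* int2 (Dt k) h2)%C.
  exact: (int_dz_boundary (BE k)).
rewrite (eq_bigr _ (fun k _ => congr1 (fun x => winding J (a k) * x) (BD k))).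
rewrite -/h1 -/h2 !res//; last 4 first.
- by move=> q /h1C[].
- by move=> q /hO[[]|]; [left|right].
- by move=> q /h1C[].
- by move=> q /hO[[]|]; [left|right].
apply: (big_rec3 (fun x y z => (x +i* y)%C = z)) => // k x y z _ <-.
(* The winding number is real, so multiplying by it acts separately on the real and imaginary
   parts. *)
have [|n -> _] := windingC bdK _ (@offd k); first by rewrite divr_gt0.
exact: complex_scaleD.
Qed.
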